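(* Let $q\ge 2$ be an even integer and let $\lambda>0$. Let $Z(\lambda)$ have the centered free Poisson distribution with rate $\lambda$. Let $(f_n)_{n\ge1}$ be a sequence of mirror symmetric elements of $L^2(\mathbb{R}_+^q)$, and let $I(f_n)$ be the multiple integral of order $q$ of $f_n$ with respect to the free Brownian motion $S$. Assume that $\varphi[I(f_n)^2]=\|f_n\|^2_{L^2(\mathbb{R}_+^q)}=\varphi[Z(\lambda)^2]=\lambda$ for every $n$. Then the following two assertions are equivalent, as $n\to\infty$: (i) $I(f_n)$ converges in distribution to $Z(\lambda)$; (ii) $\varphi[I(f_n)^4]-2\varphi[I(f_n)^3]\to \varphi[Z(\lambda)^4]-2\varphi[Z(\lambda)^3]=2\lambda^2-\lambda$.
   Context: Probability space. $(\mathscr{A},\varphi)$ is a tracial $W^*$-probability space: $\mathscr{A}$ is a von Neumann algebra and $\varphi$ is a unital linear functional on $\mathscr{A}$ that is weakly continuous, positive, faithful ($\varphi(XX^* )=0$ implies $X=0$) and tracial ($\varphi(XY)=\varphi(YX)$). Self-adjoint elements of $\mathscr{A}$ are called random variables. The law (distribution) of a random variable $X$ is the unique Borel probability measure $\mu_X$ on $\mathbb{R}$ with $\varphi(X^m)=\int x^m\,\mu_X(dx)$ for all integers $m\ge0$. Convergence in distribution of $X_n$ to $X$ means $\varphi(X_n^m)\to\varphi(X^m)$ for every integer $m\ge1$. (Random variables such as $Z(\lambda)$ enter only through their law, so $\varphi[Z(\lambda)^m]$ is the $m$-th moment of that law.) Free Poisson law. For $\lambda>0$ the free Poisson distribution $P(\lambda)$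 with rate $\lambda$ is the probability measure on $\mathbb{R}$ equal to $(1-\lambda)\delta_0+\widetilde\nu$ if $\lambda\in(0,1]$ and to $\widetilde\nu$ if $\lambda>1$, where $\widetilde\nu(dx)=(2\pi x)^{-1}\sqrt{4\lambda-(x-1-\lambda)^2}\,dx$ on $x\in\big((1-\sqrt\lambda)^2,(1+\sqrt\lambda)^2\big)$. Equivalently, all its free cumulants of order $m\ge1$ are equal to $\lambda$. The centered free Poisson distribution with rate $\lambda$ is the law of $Z(\lambda)=X_\lambda-\lambda 1$, where $X_\lambda$ has law $P(\lambda)$ and $1$ is the unit. Free Brownian motion. For $t>0$, $S(0,t)$ is the semicircular law $(2\pi t)^{-1}\sqrt{4t-x^2}\,dx$ on $|x|<2\sqrt t$. A free Brownian motion $S$ on $(\mathscr{A},\varphi)$ consists of a filtration $\{\mathscr{A}_t:t\ge0\}$ of von Neumann subalgebras of $\mathscr{A}$ ($\mathscr{A}_u\subset\mathscr{A}_t$ for $u<t$) and self-adjoint operators $\{S(t):t\ge0\}$ such that $S(t)\in\mathscr{A}_t$ has law $S(0,t)$ and, for $0\le u<t$, $S(t)-S(u)$ is freely independent of $\mathscr{A}_u$ and has law $S(0,t-u)$. Wigner integrals. $L^2(\mathbb{R}_+^q)$ is the space of complex-valued square-integrable functions on $\mathbb{R}_+^q$ (Lebesgue measure). The adjoint of $f$ is $f^*(t_1,\dots,t_q)=\overline{f(t_q,\dots,t_1)}$, and $f$ is mirror symmetric if $f=f^*$ almost everywhere. For $f=\prod_{i=1}^q\mathbf 1_{(a_i,b_i)}(t_i)$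 with pairwise disjoint intervals, $I(f)=(S(b_1)-S(a_1))\cdots(S(b_q)-S(a_q))$; $I$ is extended linearly to finite linear combinations of such functions and then to all of $L^2(\mathbb{R}_+^q)$ by density, using the isometry $\varphi(I(f)^*I(g))=\int_{\mathbb{R}_+^q}\overline{f}\,g$. It is standard that $I(f)$ is a bounded operator in $\mathscr{A}$, and $I(f)$ is self-adjoint if and only if $f$ is mirror symmetric. The set $\{I(f):f\in L^2(\mathbb{R}_+^q)\}$ is the $q$-th Wigner chaos associated with $S$. *)

(* Defs.v *)
From HB Require Import structures.
From mathcomp Require Import all_boot all_order all_algebra.
From mathcomp Require Import complex.
From mathcomp Require Import all_classical all_reals all_analysis.
From mathcomp Require Import measurable_realfun.
Set Implicit Arguments.
Unset Strict Implicit.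
Unset Printing Implicit Defensive.
Import Order.TTheory GRing.Theory Num.Theory.
Import numFieldNormedType.Exports.
Local Open Scope classical_set_scope.
Local Open Scope complex_scope.
Local Open Scope ring_scope.

(* The inner product is linear in its first argument. *)
Record hilbert_space (R : realType) := HilbertSpace {
  hilbert_carrier :> completeNormedModType R[i];
  inner : {dot hilbert_carrier for (@Num.conj R[i])};
  inner_norm : forall x : hilbert_carrier, `|x| ^+ 2 = inner x x }.

Section operators.
Variables (R : realType) (H : hilbert_space R).
Implicit Types (A : set (H -> H)) (X Y T : H -> H) (phi : (H -> H) -> R[i]).

Definition bounded_operator X :=
  linear X /\ exists M : R[i], forall x : H, `|X x| <= M * `|x|.

Definition is_adjoint X Y := forall u v : H, inner H (X u) v = inner H u (Y v).

(* Every bounded operator has exactly one adjoint; the default value is only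
   reached outside of the bounded operators. *)
Definition adjoint X : H -> H := xget 0 [set Y | is_adjoint X Y].

Definition self_adjoint X := is_adjoint X X.

Definition commutant A : set (H -> H) :=
  [set T | bounded_operator T /\ forall X, A X -> T \o X = X \o T].

Definition von_neumann_algebra A :=
  (forall X, A X -> exists2 Y, A Y & is_adjoint X Y) /\
  commutant (commutant A) = A.

Definition square_summable (xi : nat -> H) :=
  cvgn (series (fun k => `|xi k| ^+ 2 : (R[i])^o)).

(* The functionals T |-> \sum_k <T (xi k), eta k>, for square-summable xi and
   eta, generate the weak-* (ultraweak) topology; the vector functionals
   T |-> <T u, v> of the weak operator topology are among them. *)
Definition ultraweak_form (xi eta : nat -> H) T : (R[i])^o :=
  limn (series (fun k => inner H (T (xi k)) (eta k) : (R[i])^o)).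

Definition ultraweak_cvg (F : set_system (H -> H)) T :=
  forall xi eta, square_summable xi -> square_summable eta ->
    ultraweak_form xi eta @ F --> ultraweak_form xi eta T.

(* Continuity on A, by filters containing A. *)
Definition weakly_continuous A phi :=
  forall F : set_system (H -> H), ProperFilter F -> F A ->
    forall T, A T -> ultraweak_cvg F T ->
      (phi : (H -> H) -> (R[i])^o) @ F --> (phi T : (R[i])^o).

Definition unital_subalgebra A :=
  [/\ A id,
      forall (a : R[i]) X Y, A X -> A Y -> A (a *: X + Y) &
      forall X Y, A X -> A Y -> A (X \o Y)].

Definition generated_algebra X : set (H -> H) :=
  smallest unital_subalgebra [set X].

Definition freely_independent phi A1 A2 :=
  forall (n : nat) (c : nat -> bool) (X : nat -> H -> H),
    (0 < n)%N ->
    (forall i, (i < n)%N -> (if c i then A1 else A2) (X i)) ->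
    (forall i, (i < n)%N -> phi (X i) = 0) ->
    (forall i, (i.+1 < n)%N -> c i != c i.+1) ->
    phi (\big[(fun Y Z : H -> H => Y \o Z)/id]_(i < n) X i) = 0.

End operators.

(* The positivity condition uses the order of R[i], for which 0 <= z means that
   z is real and nonnegative. *)
Record tracial_wstar_space (R : realType) := TracialWstarSpace {
  wstar_hilbert : hilbert_space R;
  wstar_algebra : set (wstar_hilbert -> wstar_hilbert);
  wstar_state : (wstar_hilbert -> wstar_hilbert) -> R[i];
  wstar_algebraP : von_neumann_algebra wstar_algebra;
  state_linear : forall (a : R[i]) X Y, wstar_algebra X -> wstar_algebra Y ->
    wstar_state (a *: X + Y) = a * wstar_state X + wstar_state Y;
  state_unital : wstar_state id = 1;
  state_continuous : weakly_continuous wstar_algebra wstar_state;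
  state_positive : forall X, wstar_algebra X ->
    0 <= wstar_state (X \o adjoint X);
  state_faithful : forall X, wstar_algebra X ->
    wstar_state (X \o adjoint X) = 0 -> X = 0;
  state_tracial : forall X Y, wstar_algebra X -> wstar_algebra Y ->
    wstar_state (X \o Y) = wstar_state (Y \o X) }.

Arguments wstar_algebra {R} _ _.
Arguments wstar_state {R} _ _.

Definition operator (R : realType) (P : tracial_wstar_space R) : Type :=
  wstar_hilbert P -> wstar_hilbert P.

Section laws.
Variable R : realType.
Local Notation leb := (@lebesgue_measure R).

(* All the laws below are compactly supported, so that fine never meets an
   infinite or undefined integral. *)
Definition moment (mu : set (measurableTypeR R) -> \bar R) (m : nat) : R :=
  fine (\int[mu]_x (x ^+ m)%:E).

Local Lemma density_sigma_additive (g : R -> R) : measurable_fun setT g ->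
  (forall x, 0 <= g x) ->
  semi_sigma_additive (fun A : set (measurableTypeR R) =>
    (\int[leb]_(x in A) (g x)%:E)%E).
Proof.
move=> mg g0 /= F mF tF mUF; apply: cvg_toP.
  apply: ereal_nondecreasing_is_cvgn => m n mn.
  apply: lee_sum_nneg_natr => // k _ _.
  by apply: integral_ge0 => /= x Fkx; rewrite lee_fin g0.
rewrite ge0_integral_bigcup//=.
- by apply: measurable_funTS; exact/measurable_EFinP.
- by move=> x _; rewrite lee_fin g0.
Qed.


Local Lemma measurable_sqrt (g : R -> R) : measurable_fun setT g ->
  measurable_fun setT (fun x => Num.sqrt (g x)).
Proof.
move=> mg; apply: (@measurableT_comp _ _ _ _ _ _ (@Num.sqrt R)) => //.
by apply: continuous_measurable_fun; exact: sqrt_continuous.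
Qed.

Local Lemma measurable_inv : measurable_fun setT (@GRing.inv R).
Proof.
rewrite -(setUv [set (0 : R)]); apply/measurable_funU => //.
  exact: measurableC.
split; first exact: measurable_fun_set1.
apply: open_continuous_measurable_fun.
  by rewrite openC; exact: closed_eq.
by move=> x; rewrite inE /= => /eqP x0; exact: inv_continuous.
Qed.

Definition semicircular_pdf (t x : R) : R :=
  if `|x| < 2 * Num.sqrt t then
    (2 * pi * t)^-1 * Num.sqrt (4 * t - x ^+ 2) else 0.

Definition semicircular (t : R) : set (measurableTypeR R) -> \bar R :=
  fun A => (\int[leb]_(x in A) (semicircular_pdf t x)%:E)%E.

Lemma semicircular_pdf_ge0 t x : 0 <= semicircular_pdf t x.
Proof.
rewrite /semicircular_pdf; case: ifPn => // xt; rewrite mulr_ge0 ?sqrtr_ge0//.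
rewrite invr_ge0 !mulr_ge0 ?pi_ge0// leNgt; apply: contraTN xt => t0.
by rewrite -leNgt ler0_sqrtr ?mulr0// ltW.
Qed.

Lemma measurable_semicircular_pdf t : measurable_fun setT (semicircular_pdf t).
Proof.
apply: measurable_fun_ifT => //.
  by apply: measurable_fun_ltr => //; exact: measurable_normr.
apply: measurable_funM => //; apply: measurable_sqrt.
by apply: measurable_funB => //; exact: measurable_funX.
Qed.

Local Lemma semicircular0 t : semicircular t set0 = 0%E.
Proof. by rewrite /semicircular integral_set0. Qed.

Local Lemma semicircular_ge0 t A : (0 <= semicircular t A)%E.
Proof.
by apply: integral_ge0 => /= x _; rewrite lee_fin semicircular_pdf_ge0.
Qed.

Local Lemma semicircular_sigma_additive t : semi_sigma_additive (semicircular t).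
Proof.
apply: density_sigma_additive; first exact: measurable_semicircular_pdf.
exact: semicircular_pdf_ge0.
Qed.

HB.instance Definition _ t := isMeasure.Build _ _ _ (semicircular t)
  (semicircular0 t) (@semicircular_ge0 t) (@semicircular_sigma_additive t).

Definition free_poisson_pdf (lambda x : R) : R :=
  if (1 - Num.sqrt lambda) ^+ 2 < x < (1 + Num.sqrt lambda) ^+ 2 then
    (2 * pi * x)^-1 * Num.sqrt (4 * lambda - (x - 1 - lambda) ^+ 2) else 0.

Definition free_poisson_ac (lambda : R) : set (measurableTypeR R) -> \bar R :=
  fun A => (\int[leb]_(x in A) (free_poisson_pdf lambda x)%:E)%E.

Lemma free_poisson_pdf_ge0 lambda x : 0 <= free_poisson_pdf lambda x.
Proof.
rewrite /free_poisson_pdf; case: ifPn => // /andP[x0 _].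
rewrite mulr_ge0 ?sqrtr_ge0// invr_ge0 !mulr_ge0 ?pi_ge0//.
by rewrite (le_trans _ (ltW x0))// sqr_ge0.
Qed.

Lemma measurable_free_poisson_pdf lambda :
  measurable_fun setT (free_poisson_pdf lambda).
Proof.
apply: measurable_fun_ifT => //.
  by apply: measurable_and => //; exact: measurable_fun_ltr.
apply: measurable_funM.
  apply: (@measurableT_comp _ _ _ _ _ _ (@GRing.inv R)).
    exact: measurable_inv.
  exact: measurable_funM.
apply: measurable_sqrt; apply: measurable_funB => //.
by apply: measurable_funX; do 2 apply: measurable_funB => //.
Qed.

Local Lemma free_poisson_ac0 lambda : free_poisson_ac lambda set0 = 0%E.
Proof. by rewrite /free_poisson_ac integral_set0. Qed.

Local Lemma free_poisson_ac_ge0 lambda A : (0 <= free_poisson_ac lambda A)%E.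
Proof.
by apply: integral_ge0 => /= x _; rewrite lee_fin free_poisson_pdf_ge0.
Qed.

Local Lemma free_poisson_ac_sigma_additive lambda :
  semi_sigma_additive (free_poisson_ac lambda).
Proof.
apply: density_sigma_additive; first exact: measurable_free_poisson_pdf.
exact: free_poisson_pdf_ge0.
Qed.

HB.instance Definition _ lambda := isMeasure.Build _ _ _
  (free_poisson_ac lambda) (free_poisson_ac0 lambda)
  (@free_poisson_ac_ge0 lambda) (@free_poisson_ac_sigma_additive lambda).

(* The mass at 0 of P(lambda). *)
Definition free_poisson_atom (lambda : R) : R :=
  if lambda <= 1 then 1 - lambda else 0.

Lemma free_poisson_atom_ge0 lambda : 0 <= free_poisson_atom lambda.
Proof. by rewrite /free_poisson_atom; case: ifPn => // ?; rewrite subr_ge0. Qed.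

Definition free_poisson (lambda : R) :
    {measure set (measurableTypeR R) -> \bar R} :=
  measure_add (mscale (NngNum (free_poisson_atom_ge0 lambda))
                 (\d_(0 : measurableTypeR R)))
    (free_poisson_ac lambda).

(* The law of Z(lambda) = X - lambda 1 for X of law P(lambda). *)
Definition centered_free_poisson (lambda : R) :
    set (measurableTypeR R) -> \bar R :=
  pushforward (free_poisson lambda)
    (fun x : measurableTypeR R => x - lambda : measurableTypeR R).

End laws.

Section lebesgue_tuple.
Variable R : realType.
Local Notation T := (measurableTypeR R).
Local Notation leb := (@lebesgue_measure R).

Definition tuple_cons n (p : T * n.-tuple T) : n.+1.-tuple T :=
  cons_tuple p.1 p.2.

Definition lebesgue_cons n
    (mu : {sigma_finite_measure set (n.-tuple T) -> \bar R}) :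
    set (n.+1.-tuple T) -> \bar R :=
  pushforward (leb \x mu)%E (@tuple_cons n).

Section lebesgue_cons.
Variables (n : nat) (mu : {sigma_finite_measure set (n.-tuple T) -> \bar R}).

Local Lemma measurable_cons_tuple : measurable_fun setT (@tuple_cons n).
Proof. exact: measurable_cons. Qed.

Local Lemma lebesgue_cons0 : lebesgue_cons mu set0 = 0%E.
Proof. by rewrite /lebesgue_cons /pushforward preimage_set0 measure0. Qed.

Local Lemma lebesgue_cons_ge0 A : (0 <= lebesgue_cons mu A)%E.
Proof. by apply: integral_ge0 => *; exact: measure_ge0. Qed.

Local Lemma lebesgue_cons_sigma_additive : semi_sigma_additive (lebesgue_cons mu).
Proof.
have mcons A : measurable A -> measurable (@tuple_cons n @^-1` A).
  by move=> mA; rewrite -[X in measurable X]setTI; exact: measurable_cons_tuple.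
move=> F mF tF mUF; rewrite /lebesgue_cons /pushforward preimage_bigcup.
apply: measure_semi_sigma_additive.
- by move=> k; exact: mcons.
- apply/trivIsetP => /= i j _ _ ij; rewrite -preimage_setI.
  by move/trivIsetP : tF => /(_ _ _ _ _ ij) ->//; rewrite preimage_set0.
- by rewrite -preimage_bigcup; exact: mcons.
Qed.

HB.instance Definition _ := isMeasure.Build _ _ _ (lebesgue_cons mu)
  lebesgue_cons0 lebesgue_cons_ge0 lebesgue_cons_sigma_additive.

Local Lemma lebesgue_cons_sigma_finite : sigma_finite setT (lebesgue_cons mu).
Proof.
have /sigma_finiteP[F [UF ndF finF]] := sigma_finiteT leb.
have /sigma_finiteP[G [UG ndG finG]] := sigma_finiteT mu.
pose E k : set (n.+1.-tuple T) :=
  [set t : n.+1.-tuple T | F k (thead t)] `&`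
    [set t : n.+1.-tuple T | G k (behead_tuple t)].
exists E => [|k].
- apply/seteqP; split => // t _.
  have [i _ Fi] : (\bigcup_i F i) (thead t) by rewrite -UF.
  have [j _ Gj] : (\bigcup_i G i) (behead_tuple t) by rewrite -UG.
  exists (maxn i j) => //; split.
  + by move/subsetPset : (ndF _ _ (leq_maxl i j)); exact.
  + by move/subsetPset : (ndG _ _ (leq_maxr i j)); exact.
- split.
  + apply: measurableI; rewrite -[X in measurable X]setTI.
    * by apply: (measurable_tnth ord0) => //; have [] := finF k.
    * by apply: measurable_behead => //; have [] := finG k.
  + rewrite /lebesgue_cons /pushforward.
    rewrite [X in ((leb \x mu) X)%E](_ : _ = F k `*` G k); last first.
      apply/seteqP; split => -[x t] [] /=.
        by rewrite theadE => ? Gt; split => //=; congr (G k _) : Gt; exact/val_inj.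
      by move=> Fx Gt; split => //=; congr (G k _) : Gt; exact/val_inj.
    have [mF Foo] := finF k; have [mG Goo] := finG k.
    by rewrite product_measure1E// lte_mul_pinfty// ge0_fin_numE.
Qed.

HB.instance Definition _ := Measure_isSigmaFinite.Build _ _ _
  (lebesgue_cons mu) lebesgue_cons_sigma_finite.

End lebesgue_cons.

Fixpoint lebesgue_tuple (n : nat) :
    {sigma_finite_measure set (n.-tuple T) -> \bar R} :=
  match n with
  | 0 => \d_(nil_tuple T)
  | n'.+1 => lebesgue_cons (lebesgue_tuple n')
  end.

End lebesgue_tuple.

Section wigner_integrals.
Variables (R : realType) (q : nat).
Local Notation Rq := (q.-tuple (measurableTypeR R)).
Implicit Types (f : Rq -> R[i]) (b : q.-tuple (R * R)).

Definition orthant : set Rq := [set t | forall i, 0 <= (tnth t i : R)].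

Definition l2normsq f : \bar R :=
  (\int[lebesgue_tuple R q]_(t in orthant) (ComplexField.Normc.normc (f t) ^+ 2)%:E)%E.

(* Elements of L^2(R_+^q) are represented by functions, whose values outside
   of the orthant are irrelevant. *)
Definition l2_orthant f :=
  [/\ measurable_fun orthant (fun t => complex.Re (f t)),
      measurable_fun orthant (fun t => complex.Im (f t)) &
      (l2normsq f < +oo)%E].

Definition mirror_symmetric f :=
  {ae lebesgue_tuple R q, forall t, orthant t ->
    f t = (f [tuple of rev t])^*%C}.

(* b stands for the box \prod_i ]b_i.1, b_i.2[. *)
Definition off_diagonal_box b :=
  (forall i, 0 <= (tnth b i).1 < (tnth b i).2) /\
  (forall i j, i != j ->
    [set` `](tnth b i).1, (tnth b i).2[] `&`
    [set` `](tnth b j).1, (tnth b j).2[] = set0 :> set R).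

Definition box_indicator b : Rq -> R[i] := fun t =>
  \prod_(i < q) ((tnth t i : R) \in `](tnth b i).1, (tnth b i).2[)%:R.

Definition step_function (s : seq (R[i] * q.-tuple (R * R))) : Rq -> R[i] :=
  fun t => \sum_(p <- s) p.1 * box_indicator p.2 t.

End wigner_integrals.

(* iter m X is the m-th power of the operator X. *)
Definition has_law (R : realType) (P : tracial_wstar_space R)
    (X : operator P) (mu : set (measurableTypeR R) -> \bar R) :=
  forall m : nat, wstar_state P (iter m X) = (moment mu m)%:C.

(* That S(0) = 0 follows from the laws of S(t) and S(t) - S(0) and their
   freeness from the algebra at time 0. *)
Record free_brownian_motion (R : realType) (P : tracial_wstar_space R) :=
  FreeBrownianMotion {
  filtration : R -> set (operator P);
  brownian :> R -> operator P;
  filtration_algebra : forall t, 0 <= t -> von_neumann_algebra (filtration t);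
  filtration_sub : forall t, 0 <= t -> filtration t `<=` wstar_algebra P;
  filtration_le : forall u t, 0 <= u -> u < t ->
    filtration u `<=` filtration t;
  brownian_adapted : forall t, 0 <= t -> filtration t (brownian t);
  brownian_self_adjoint : forall t, 0 <= t -> self_adjoint (brownian t);
  brownian_law : forall t, 0 < t -> has_law (brownian t) (semicircular t);
  brownian_increment_free : forall u t, 0 <= u -> u < t ->
    freely_independent (wstar_state P)
      (generated_algebra (brownian t - brownian u)) (filtration u);
  brownian_increment_law : forall u t, 0 <= u -> u < t ->
    has_law (brownian t - brownian u) (semicircular (t - u)) }.

Section wigner_integral.
Variables (R : realType) (P : tracial_wstar_space R).
Variables (S : free_brownian_motion P) (q : nat).
Local Notation Rq := (q.-tuple (measurableTypeR R)).

Definition box_integral (b : q.-tuple (R * R)) : operator P :=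
  \big[(fun Y Z : operator P => Y \o Z)/id]_(i < q)
    (S (tnth b i).2 - S (tnth b i).1).

Definition step_integral (s : seq (R[i] * q.-tuple (R * R))) : operator P :=
  \sum_(p <- s) p.1 *: box_integral p.2.

(* X is the limit in L^2(phi) of the integrals of off-diagonal step functions
   converging to f in L^2(R_+^q). *)
Definition is_wigner_integral (f : Rq -> R[i]) (X : operator P) :=
  wstar_algebra P X /\
  exists s : nat -> seq (R[i] * q.-tuple (R * R)),
    [/\ forall k p, p \in s k -> off_diagonal_box p.2,
        l2normsq (fun t => f t - step_function (s k) t) @[k --> \oo] --> 0%E &
        (wstar_state P (adjoint (X - step_integral (s k)) \o
                      (X - step_integral (s k))) : (R[i])^o)
          @[k --> \oo] --> (0 : (R[i])^o)].

(* For f in L^2(R_+^q), such an X exists (the L^2-limit is a bounded operator,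
   by the free Haagerup inequality) and is unique (phi is faithful). *)
Definition wigner_integral (f : Rq -> R[i]) : operator P :=
  xget 0 [set X | is_wigner_integral f X].

Definition cvg_in_distribution (X : nat -> operator P)
    (mu : set (measurableTypeR R) -> \bar R) :=
  forall m : nat, (0 < m)%N ->
    (wstar_state P (iter m (X n)) : (R[i])^o) @[n --> \oo] -->
    ((moment mu m)%:C : (R[i])^o).

End wigner_integral.

(* Main.v *)
(* Off-diagonal step functions on a grid turn I(f) into a finite sum
   T = \sum_w c(w) U(w) over words w of length q in normalized increments, where
   U(w), a product of Chebyshev polynomials over the runs of w, is an orthonormal
   family.  The products U(u) U(w) are governed by contractions of words, so with
   q = p + p the combination phi(T^4) - 2 phi(T^3) equals 2 lambda^2 - lambda plus a
   defect: the sum of the squared norms of the contractions of c with itself of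
   orders other than 0, p, q, and of the difference between c and its contraction of
   order p.  The elements C_n of order n q with coefficients c^{(x) n} then satisfy
   T C_{n+1} = C_{n+2} + C_{n+1} + lambda C_n up to an error in L^2(phi) controlled by
   the square root of the defect.  This is the three-term recursion of the orthogonal
   polynomials of the centered free Poisson law, hence every moment of T is within a
   constant times the square root of the defect of that of Z(lambda); the bound
   passes to the limit I(f).  The Haagerup inequality |phi((T^* T)^n)| <=
   ((q + 1) |c|)^(2 n) bounds the operators T uniformly, and self-adjointness of I(f)
   comes from phi[I(f)^2] = |f|^2. *)
Require Import Defs.
From HB Require Import structures.
From mathcomp Require Import all_boot all_order all_algebra.
From mathcomp Require Import complex.
From mathcomp Require Import all_classical all_reals all_analysis.
From mathcomp Require Import measurable_realfun lra ring zify.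
Set Implicit Arguments.
Unset Strict Implicit.
Unset Printing Implicit Defensive.
Import Order.TTheory GRing.Theory Num.Theory.
Import numFieldNormedType.Exports.
Local Open Scope classical_set_scope.
Local Open Scope complex_scope.
Local Open Scope ring_scope.

(** On a grid a contraction is a finite sum over words, so no contraction of functions and no
    operator norm is needed: estimates live in the norm [nrm] of L^2(phi), and a bound on an
    operator means |T y| <= K |y| for all y. The step approximations T need be neither self-adjoint
    nor of variance exactly lambda. Hence the defect is written with [st], with |T| and phi(T T)
    kept apart, and the discrepancy of the variance enters the recursion as a separate error; only
    the limit is known to be self-adjoint. Evenness of q acts twice. The contraction of order p puts
    a component of order q into T T, and phi(T^3) pairs it with c; the square |contr_p c - c|^2 is
    completed by |c|^2, the source of the term - lambda, while orders 0 and q give lambda^2 each.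
    The same contraction, applied to the first factor of a tensor power of c, approximately gives
    that tensor power back: this is the middle term of the recursion. The C_n replace the orthogonal
    polynomials of T because T C_n is explicit, and phi(C_n) = 0 for n >= 1 is all the orthogonality
    that the moments require. *)

Local Notation normc := ComplexField.Normc.normc.

(** * Tracial states *)

Section complex_facts.
Variable R : rcfType.
Implicit Types (z : R[i]) (x : R).

Lemma rcD x1 x2 : (x1 + x2)%:C = x1%:C + x2%:C :> R[i].
Proof. exact: rmorphD. Qed.

Lemma rcB x1 x2 : (x1 - x2)%:C = x1%:C - x2%:C :> R[i].
Proof. exact: rmorphB. Qed.

Lemma rcM x1 x2 : (x1 * x2)%:C = x1%:C * x2%:C :> R[i].
Proof. exact: rmorphM. Qed.

Lemma rcX x n : (x ^+ n)%:C = x%:C ^+ n :> R[i].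
Proof. exact: rmorphXn. Qed.

Lemma rcV x : (x^-1)%:C = (x%:C)^-1 :> R[i].
Proof. exact: fmorphV. Qed.

Lemma rc_sum (I : Type) (s : seq I) (P : pred I) (F : I -> R) :
  (\sum_(i <- s | P i) F i)%:C = \sum_(i <- s | P i) (F i)%:C :> R[i].
Proof. exact: rmorph_sum. Qed.

Lemma rc_eq0 x : (x%:C == 0 :> R[i]) = (x == 0).
Proof. exact: fmorph_eq0. Qed.

Lemma normcE z : `|z| = (normc z)%:C. Proof. by []. Qed.

Lemma normc_ge0 z : 0 <= normc z.
Proof. by rewrite -ler0c -normcE. Qed.

Lemma conjC_complex z : Num.conj z = (z^*)%C.
Proof.
case: (eqVneq z 0) => [->|z0]; first by rewrite rmorph0 conjc0.
by apply: (mulfI z0); rewrite -normCK sqr_normc.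
Qed.

Lemma normc_real x : normc x%:C = `|x|.
Proof. by rewrite /= expr0n addr0 sqrtr_sqr. Qed.

Lemma normc_conj z : normc (Num.conj z) = normc z.
Proof. by apply: complexI; rewrite -!normcE norm_conjC. Qed.

Lemma mulconjc z : Num.conj z * z = (normc z ^+ 2)%:C.
Proof. by rewrite mulrC -normCK normcE rcX. Qed.

Lemma normcD z1 z2 : normc (z1 + z2) <= normc z1 + normc z2.
Proof. by rewrite -lecR rcD -!normcE ler_normD. Qed.

Lemma normcNE z : normc (- z) = normc z.
Proof. by apply: complexI; rewrite -!normcE normrN. Qed.

Lemma normcB z1 z2 : normc (z1 - z2) <= normc z1 + normc z2.
Proof. by rewrite (le_trans (normcD _ _))// normcNE. Qed.

Lemma normc_sum (I : Type) (s : seq I) (P : pred I) (F : I -> R[i]) :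
  normc (\sum_(i <- s | P i) F i) <= \sum_(i <- s | P i) normc (F i).
Proof.
by rewrite -lecR -normcE rc_sum (le_trans (ler_norm_sum _ _ _)).
Qed.

Lemma Re_le_normc z : complex.Re z <= normc z.
Proof. by rewrite -lecR -normcE (le_trans _ (normc_ge_Re _))// lecR ler_norm. Qed.

Lemma ReD z1 z2 : complex.Re (z1 + z2) = complex.Re z1 + complex.Re z2.
Proof. by case: z1 => ? ?; case: z2. Qed.

Lemma ReN z : complex.Re (- z) = - complex.Re z.
Proof. by case: z. Qed.

Lemma Re_conj z : complex.Re (Num.conj z) = complex.Re z.
Proof. by rewrite conjC_complex; case: z. Qed.

Lemma Im_conj z : complex.Im (Num.conj z) = - complex.Im z.
Proof. by rewrite conjC_complex; case: z. Qed.

Lemma ImD z1 z2 : complex.Im (z1 + z2) = complex.Im z1 + complex.Im z2.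
Proof. by case: z1 => ? ?; case: z2. Qed.

Lemma ImM z1 z2 : complex.Im (z1 * z2) =
  complex.Re z1 * complex.Im z2 + complex.Im z1 * complex.Re z2.
Proof. by case: z1 => ? ?; case: z2. Qed.

Lemma Re_realM x z : complex.Re (x%:C * z) = x * complex.Re z.
Proof. by case: z => a b /=; rewrite mul0r subr0. Qed.

Lemma normcM z1 z2 : normc (z1 * z2) = normc z1 * normc z2.
Proof. exact: ComplexField.Normc.normcM. Qed.

Lemma ge0_complexE z : 0 <= z -> z = (complex.Re z)%:C.
Proof. by case: z => a b; rewrite lecE/= => /andP[/eqP -> _]. Qed.

Lemma conjC_real_complex x : Num.conj (x%:C : R[i]) = x%:C.
Proof. by rewrite conjC_complex conjc_real. Qed.

End complex_facts.

Record tracial_state (R : rcfType) (A : algType R[i]) (st : A -> A)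
    (phi : A -> R[i]) : Prop := TracialState {
  starP : forall a x y, st (a *: x + y) = Num.conj a *: st x + st y;
  starM : forall x y, st (x * y) = st y * st x;
  starK : forall x, st (st x) = x;
  phiP : forall a x y, phi (a *: x + y) = a * phi x + phi y;
  phi1 : phi 1 = 1;
  phi_ge0 : forall x, 0 <= phi (st x * x);
  phi_faithful : forall x, phi (st x * x) = 0 -> x = 0;
  phi_trace : forall x y, phi (x * y) = phi (y * x) }.

Section tracial_state_theory.
Variables (R : rcfType) (A : algType R[i]) (st : A -> A) (phi : A -> R[i]).
Hypothesis tr : tracial_state st phi.
Implicit Types (x y z : A) (a : R[i]).

Lemma phiD x y : phi (x + y) = phi x + phi y.
Proof. by have := phiP tr 1 x y; rewrite scale1r mul1r. Qed.

Lemma phi0 : phi 0 = 0.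
Proof. by apply: (addrI (phi 0)); rewrite -phiD !addr0. Qed.

Lemma phiZ a x : phi (a *: x) = a * phi x.
Proof. by have := phiP tr a x 0; rewrite addr0 phi0 addr0. Qed.

Lemma phiN x : phi (- x) = - phi x.
Proof. by rewrite -scaleN1r phiZ mulN1r. Qed.

Lemma phiB x y : phi (x - y) = phi x - phi y.
Proof. by rewrite phiD phiN. Qed.

Lemma phi_sum (I : Type) (s : seq I) (P : pred I) (F : I -> A) :
  phi (\sum_(i <- s | P i) F i) = \sum_(i <- s | P i) phi (F i).
Proof. exact: (big_morph phi phiD phi0). Qed.

Lemma starD x y : st (x + y) = st x + st y.
Proof. by have := starP tr 1 x y; rewrite rmorph1 !scale1r. Qed.

Lemma star0 : st 0 = 0.
Proof. by apply: (addrI (st 0)); rewrite -starD !addr0. Qed.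

Lemma starZ a x : st (a *: x) = Num.conj a *: st x.
Proof. by have := starP tr a x 0; rewrite addr0 star0 addr0. Qed.

Lemma starN x : st (- x) = - st x.
Proof. by rewrite -scaleN1r starZ rmorphN rmorph1 scaleN1r. Qed.

Lemma starB x y : st (x - y) = st x - st y.
Proof. by rewrite starD starN. Qed.

Lemma star1 : st 1 = 1.
Proof. by rewrite -[LHS]mul1r -{1}(starK tr 1) -(starM tr) mul1r (starK tr). Qed.

Lemma star_sum (I : Type) (s : seq I) (P : pred I) (F : I -> A) :
  st (\sum_(i <- s | P i) F i) = \sum_(i <- s | P i) st (F i).
Proof. exact: (big_morph st starD star0). Qed.

Lemma starX x n : st (x ^+ n) = st x ^+ n.
Proof. by elim: n => [|n IH]; rewrite ?expr0 ?star1// exprS exprSr (starM tr) IH. Qed.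

Definition nrm x : R := Num.sqrt (complex.Re (phi (st x * x))).

Lemma nrm_ge0 x : 0 <= nrm x. Proof. exact: sqrtr_ge0. Qed.

Lemma phi_sqr x : phi (st x * x) = (nrm x ^+ 2)%:C.
Proof.
have := phi_ge0 tr x; move=> /[dup] h /ge0_complexE e.
by rewrite e sqr_sqrtr// -ler0c -e.
Qed.

Lemma nrm_star x : nrm (st x) = nrm x.
Proof. by rewrite /nrm (starK tr) (phi_trace tr). Qed.

Lemma nrm_eq0 x : nrm x = 0 -> x = 0.
Proof. by move=> h; apply: (phi_faithful tr); rewrite phi_sqr h expr0n. Qed.

Lemma nrm0 : nrm 0 = 0.
Proof. by rewrite /nrm mulr0 phi0 sqrtr0. Qed.

Lemma nrmZ a x : nrm (a *: x) = normc a * nrm x.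
Proof.
apply/eqP; rewrite -(@eqrXn2 _ 2) ?mulr_ge0 ?nrm_ge0 ?normc_ge0//.
apply/eqP/complexI; rewrite -phi_sqr starZ -scalerAl -scalerAr scalerA phiZ.
by rewrite mulconjc phi_sqr -rcM exprMn.
Qed.

Lemma nrmN x : nrm (- x) = nrm x.
Proof. by rewrite -scaleN1r nrmZ normcNE ComplexField.Normc.normc1 mul1r. Qed.

(** A consequence of positivity: for [y = 1 + a *: x] the value phi(st y * y) is real, so a phi(x) +
    conj(a) phi(st x) is real; a = 1 and a = i determine phi(st x). *)
Lemma phi_star x : phi (st x) = Num.conj (phi x).
Proof.
have h (a : R[i]) : Num.conj (a * phi x + Num.conj a * phi (st x)) =
    a * phi x + Num.conj a * phi (st x).
  have /(congr1 (@phi)) : st (1 + a *: x) * (1 + a *: x) =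
    1 + (a *: x + Num.conj a *: st x) + st (a *: x) * (a *: x).
    by rewrite starD star1 mulrDl mul1r mulrDr mulr1 starZ !addrA.
  rewrite !phiD (phi1 tr) !phi_sqr !phiZ.
  move=> e; have -> : a * phi x + Num.conj a * phi (st x) =
    (nrm (1 + a *: x) ^+ 2 - nrm (a *: x) ^+ 2 - 1)%:C.
    by rewrite !rcB e; ring.
  exact: conjC_real_complex.
have h1 := h 1; have hi := h 'i%C.
move: (congr1 (@complex.Im R) h1) (congr1 (@complex.Im R) hi).
rewrite !rmorph1 !mul1r !Im_conj !ImD !ImM !Re_conj !Im_conj/= => e1 ei.
by rewrite [LHS]complexE [RHS]complexE Re_conj Im_conj; congr (_%:C + _ * _%:C); lra.
Qed.

Lemma phi_CS x y : normc (phi (st x * y)) <= nrm x * nrm y.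
Proof.
have [x0|x0] := eqVneq (nrm x) 0.
  by rewrite (nrm_eq0 x0) star0 mul0r phi0 nrm0 mul0r/= expr0n/= addr0 sqrtr0.
set c := phi (st x * y); set n2 := nrm x ^+ 2.
have n2_gt0 : 0 < n2 by rewrite exprn_gt0// lt_neqAle eq_sym x0 nrm_ge0.
have cE : phi (st y * x) = Num.conj c.
  by rewrite -phi_star (starM tr) (starK tr).
have : 0 <= complex.Re (phi (st (y - (c / n2%:C) *: x) * (y - (c / n2%:C) *: x))).
  by rewrite phi_sqr/= sqr_ge0.
rewrite starB starZ mulrBl !mulrBr -!scalerAl -!scalerAr !scalerA !phiB !phiZ.
have nC : n2%:C != 0 :> R[i] by rewrite rc_eq0 gt_eqF.
have cd : Num.conj (c / n2%:C) = Num.conj c / n2%:C.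
  by rewrite -rcV rmorphM/= conjC_real_complex.
rewrite -/c cE !phi_sqr -/n2 cd.
have -> : (nrm y ^+ 2)%:C - c / n2%:C * Num.conj c -
    (Num.conj c / n2%:C * c - Num.conj c / n2%:C * (c / n2%:C) * n2%:C) =
    (nrm y ^+ 2)%:C - (Num.conj c * c) / n2%:C by field.
rewrite mulconjc -rcV -rcM -rcB/=.
rewrite subr_ge0 ler_pdivrMr// -exprMn ler_pXn2r ?nnegrE ?mulr_ge0 ?nrm_ge0 ?normc_ge0//.
by rewrite mulrC.
Qed.

Lemma nrmD x y : nrm (x + y) <= nrm x + nrm y.
Proof.
rewrite -(@ler_pXn2r _ 2) ?nnegrE ?addr_ge0 ?nrm_ge0//.
have -> : nrm (x + y) ^+ 2 = nrm x ^+ 2 + 2 * complex.Re (phi (st x * y)) + nrm y ^+ 2.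
  apply: complexI; rewrite -phi_sqr starD mulrDl !mulrDr !phiD !phi_sqr.
  rewrite -[X in st y * X](starK tr x) -(starM tr) phi_star.
  rewrite !rcD rcM -!addrA; congr (_ + _); rewrite !addrA; congr (_ + _).
  by rewrite conjC_complex addcJ rmorph_nat.
rewrite sqrrD lerD2r lerD2l -[leRHS]mulr_natl ler_pM2l ?ltr0n//.
exact: le_trans (Re_le_normc _) (phi_CS _ _).
Qed.

Lemma nrmB x y : nrm (x - y) <= nrm x + nrm y.
Proof. by rewrite (le_trans (nrmD _ _))// nrmN. Qed.

Lemma nrm_sum (I : Type) (s : seq I) (P : pred I) (F : I -> A) :
  nrm (\sum_(i <- s | P i) F i) <= \sum_(i <- s | P i) nrm (F i).
Proof.
elim/big_rec2: _ => [|i u v _ IH]; first by rewrite nrm0.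
by rewrite (le_trans (nrmD _ _))// lerD2l.
Qed.

Lemma nrm1 : nrm 1 = 1.
Proof. by rewrite /nrm star1 mulr1 (phi1 tr) sqrtr1. Qed.

Lemma phi_le_nrm x : normc (phi x) <= nrm x.
Proof. by have := phi_CS 1 x; rewrite star1 mul1r nrm1 mul1r. Qed.

End tracial_state_theory.

(** Lagrange's identity: twice the gap is the sum of the squares of all 2 by 2 minors, so no square
    root is needed. *)
Lemma sum_CS (R : realDomainType) (I : Type) (s : seq I) (a b : I -> R) :
  (\sum_(i <- s) a i * b i) ^+ 2 <=
  (\sum_(i <- s) a i ^+ 2) * (\sum_(i <- s) b i ^+ 2).
Proof.
rewrite -subr_ge0 -(pmulr_rge0 _ (ltr0n _ 2)).
have -> : 2 * ((\sum_(i <- s) a i ^+ 2) * (\sum_(i <- s) b i ^+ 2) -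
    (\sum_(i <- s) a i * b i) ^+ 2) =
  \sum_(i <- s) \sum_(j <- s) (a i * b j - a j * b i) ^+ 2.
  transitivity (\sum_(i <- s) (a i ^+ 2 * (\sum_(j <- s) b j ^+ 2) +
      (\sum_(j <- s) a j ^+ 2) * b i ^+ 2 -
      2 * ((a i * b i) * \sum_(j <- s) a j * b j))).
    rewrite sumrB big_split/= -mulr_suml -[X in _ = _ + X - _]mulr_sumr.
    by rewrite -[X in _ = _ - X]mulr_sumr -[X in _ = _ - _ * X]mulr_suml; ring.
  apply: eq_bigr => i _; rewrite !mulr_sumr mulr_suml -big_split/= -sumrB.
  by apply: eq_bigr => j _; ring.
by apply: sumr_ge0 => i _; apply: sumr_ge0 => j _; exact: sqr_ge0.
Qed.

Lemma normc_sum_CS (R : rcfType) (I : Type) (s : seq I) (a b : I -> R[i]) :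
  normc (\sum_(i <- s) a i * b i) ^+ 2 <=
  (\sum_(i <- s) normc (a i) ^+ 2) * (\sum_(i <- s) normc (b i) ^+ 2).
Proof.
apply: le_trans (sum_CS _ _ _).
rewrite ler_pXn2r ?nnegrE ?normc_ge0//; last first.
  by apply: sumr_ge0 => i _; rewrite mulr_ge0 ?normc_ge0.
by rewrite (le_trans (normc_sum _ _ _))//; under eq_bigr do rewrite normcM.
Qed.

(** * Chebyshev words and contractions *)

Section words.
Variable I : finType.
Implicit Types (u v w : seq I) (d : nat).

(** Plain sequences instead of tuples: cutting words by [take] and [drop] and gluing them needs no
    cast between lengths. *)
Fixpoint words d : seq (seq I) :=
  if d is d'.+1 then [seq i :: w | i <- enum I, w <- words d'] else [:: [::]].

Section big_words.
Variables (V : nmodType).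
Implicit Type F : seq I -> V.

Lemma big_words0 F : \sum_(w <- words 0) F w = F [::].
Proof. by rewrite big_seq1. Qed.

Lemma big_wordsS d F :
  \sum_(w <- words d.+1) F w = \sum_(i : I) \sum_(w <- words d) F (i :: w).
Proof. by rewrite /= big_allpairs_dep big_enum. Qed.

Lemma big_words_cat a b F : \sum_(w <- words (a + b)) F w =
  \sum_(u <- words a) \sum_(v <- words b) F (u ++ v).
Proof.
elim: a F => [|a IH] F; first by rewrite big_words0.
rewrite addSn !big_wordsS; apply: eq_bigr => i _.
by rewrite (IH (fun w => F (i :: w))).
Qed.

Lemma mem_words d w : (w \in words d) = (size w == d).
Proof.
elim: d w => [|d IH] [|i w]//=; first by apply/allpairsP => -[[? ?] []].
apply/allpairsP/idP => [[[j v]] /= [_ + [_ ->]]|sw]; first by rewrite IH.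
by exists (i, w); rewrite mem_enum IH.
Qed.

Lemma uniq_words d : uniq (words d).
Proof.
elim: d => //= d IH; apply: allpairs_uniq_dep; rewrite ?enum_uniq//.
by move=> [i w] [j v] /= _ _ [-> ->].
Qed.

Lemma eq_big_words d F G : (forall w, size w = d -> F w = G w) ->
  \sum_(w <- words d) F w = \sum_(w <- words d) G w.
Proof. by move=> h; apply: eq_big_seq => w; rewrite mem_words => /eqP/h. Qed.

Lemma big_words_rev d F :
  \sum_(w <- words d) F (rev w) = \sum_(w <- words d) F w.
Proof.
rewrite -(big_map rev xpredT F); apply: perm_big; apply: uniq_perm.
- by rewrite (map_inj_uniq (can_inj revK)) uniq_words.
- exact: uniq_words.
- move=> w; rewrite -{1}(revK w) mem_map ?mem_words ?size_rev//.
  exact: can_inj revK.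
Qed.

End big_words.

Lemma big_words_pick (K : pzRingType) (V : lmodType K) d v (F : seq I -> V) :
  \sum_(w <- words d) (w == v)%:R *: F w = (size v == d)%:R *: F v.
Proof.
rewrite -mem_words; have [vd|vd] := boolP (v \in words d).
  rewrite (bigD1_seq v)//= ?uniq_words// eqxx big1 ?addr0// => w /negPf ->.
  by rewrite scale0r.
rewrite big_seq big1 ?scale0r// => w wd; case: eqP => [e|]; rewrite ?scale0r//.
by rewrite -e wd in vd.
Qed.

End words.

Section free_family.
Variables (R : rcfType) (A : algType R[i]) (st : A -> A) (phi : A -> R[i]).
Hypothesis tr : tracial_state st phi.
Variables (I : finType) (x : I -> A).
Implicit Types (i j : I) (u v w : seq I) (c f g : seq I -> R[i]).

(** The correction is present only when the first two letters agree. On a run of n equal letters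
    this is the recursion U_(n+1) = y U_n - U_(n-1) of the polynomials orthonormal for the
    semicircular law of variance 1. *)
Fixpoint cheb w : A :=
  if w is i :: w' then
    x i * cheb w' - (if w' is j :: w'' then (i == j)%:R *: cheb w'' else 0)
  else 1.

Definition xprod u : A := \prod_(i <- u) x i.

Lemma mulx_cheb i w : x i * cheb w =
  cheb (i :: w) + (if w is j :: w' then (i == j)%:R *: cheb w' else 0).
Proof. by rewrite /= subrK. Qed.

Let last_contraction n i v w : size v = n ->
  (take n w == v)%:R *:
    (if drop n w is j :: w' then (i == j)%:R *: cheb w' else 0) =
  (take n.+1 w == rcons v i)%:R *: cheb (drop n.+1 w).
Proof.
elim: v n w => [|a v IH] [|n]//= [|j w] /=; rewrite ?scale0r ?scaler0//.
- by move=> _; rewrite take0 drop0 eqseq_cons eqxx andbT scale1r eq_sym.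
- by case=> sv; rewrite !eqseq_cons; case: eqP => //= _; rewrite ?IH// !scale0r.
Qed.

(** The letters of u act from the last to the first, and each one either cancels the head of the
    current word or is prepended to it. Neighbours in u differ, so a prepended letter is never
    cancelled by the next one: the r cancellations all come before the prependings, and there is one
    term for each r. *)
Lemma xprod_cheb u w : sorted (fun i j => i != j) u ->
  xprod u * cheb w = \sum_(r < (size u).+1)
    (take r w == rev (drop (size u - r) u))%:R *:
      cheb (take (size u - r) u ++ drop r w).
Proof.
elim: u w => [|i u IH] w us.
  by rewrite /xprod big_nil mul1r big_ord1/= take0 drop0 scale1r.
rewrite /xprod big_cons -mulrA -/(xprod u) IH; last exact: path_sorted us.
rewrite mulr_sumr [RHS]big_ord_recr/=.
under eq_bigr => r _ do rewrite -scalerAr mulx_cheb scalerDr.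
rewrite big_split/=; congr (_ + _).
  by apply: eq_bigr => r _; rewrite subSn//= -ltnS.
(* Unless all of u has been cancelled, the current word starts with the neighbour of i in u, which
   differs from i: only the last summand allows a further cancellation. *)
rewrite big_ord_recr/= big1 ?add0r => [|r _]; last first.
  case: u us {IH} r => [|j u] /= us [r hr]//=.
  rewrite subSn //=; move: us => /andP[/negPf -> _].
  by rewrite scale0r scaler0.
by rewrite !subnn !take0 !drop0/= rev_cons last_contraction ?size_rev.
Qed.

Definition hom d f : A := \sum_(w <- words I d) f w *: cheb w.

Lemma hom0 f : hom 0 f = f [::] *: 1.
Proof. by rewrite /hom big_words0. Qed.

Definition hnorm d f : R := Num.sqrt (\sum_(w <- words I d) normc (f w) ^+ 2).

Lemma sqr_hnorm d f :
  hnorm d f ^+ 2 = \sum_(w <- words I d) normc (f w) ^+ 2.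
Proof. by rewrite sqr_sqrtr// sumr_ge0// => w _; exact: sqr_ge0. Qed.

Lemma hnorm_ge0 d f : 0 <= hnorm d f. Proof. exact: sqrtr_ge0. Qed.

Lemma eq_hom d f g : (forall w, size w = d -> f w = g w) -> hom d f = hom d g.
Proof. by move=> fg; apply: eq_big_words => w /fg ->. Qed.

Lemma homB d f g : hom d (fun w => f w - g w) = hom d f - hom d g.
Proof. by rewrite /hom -sumrB; apply: eq_bigr => w _; rewrite scalerBl. Qed.

Lemma homZ d a f : hom d (fun w => a * f w) = a *: hom d f.
Proof. by rewrite /hom scaler_sumr; apply: eq_bigr => w _; rewrite scalerA. Qed.

(* The contraction of order r of c, of order q, with f. *)
Definition contr q r c f w : R[i] :=
  \sum_(z <- words I r) c (take (q - r) w ++ z) * f (rev z ++ drop (q - r) w).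

(** Distinct neighbours are exactly what [xprod_cheb] asks of a word. The property is not inherited
    by contractions and tensor products, where two letters meet at a junction. *)
Definition off_diagonal q c :=
  forall w, size w = q -> ~~ sorted (fun i j => i != j) w -> c w = 0.

(** On a word with distinct neighbours the recursion of [cheb] subtracts nothing, so [cheb] is the
    plain product of the letters. *)
Lemma off_diagonal_hom q c : off_diagonal q c ->
  hom q c = \sum_(u <- words I q) c u *: xprod u.
Proof.
move=> oc; apply: eq_big_words => u su.
have [us|us] := boolP (sorted (fun i j => i != j) u); last first.
  by rewrite (oc u su us) !scale0r.
congr (_ *: _); rewrite -[RHS]mulr1 -[1]/(cheb [::]) xprod_cheb// big_ord_recl.
rewrite /= big1 ?addr0; first by rewrite subn0 drop_size take_size cats0 eqxx scale1r.
move=> [r hr] _ /=; rewrite eq_sym -size_eq0 size_rev size_drop /bump/= add1n subKn//.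
by rewrite scale0r.
Qed.

Let hom_contr a r b c f :
  \sum_(u <- words I (a + r)) \sum_(w <- words I (r + b))
    (take r w == rev (drop a u))%:R *:
      ((c u * f w) *: cheb (take a u ++ drop r w)) =
  hom (a + b) (fun w => \sum_(z <- words I r)
    c (take a w ++ z) * f (rev z ++ drop a w)).
Proof.
rewrite /hom !big_words_cat; apply: eq_big_words => u su.
transitivity (\sum_(z <- words I r) \sum_(v <- words I b)
    (c (u ++ z) * f (rev z ++ v)) *: cheb (u ++ v)).
  apply: eq_big_words => z sz; rewrite big_words_cat exchange_big/=.
  rewrite [RHS](_ : _ = \sum_(v <- words I b) (size (rev z) == r)%:R *:
    ((c (u ++ z) * f (rev z ++ v)) *: cheb (u ++ v))); last first.
    by apply: eq_bigr => v _; rewrite size_rev sz eqxx scale1r.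
  apply: eq_bigr => v _.
  rewrite -(big_words_pick r (rev z)
    (fun y => (c (u ++ z) * f (y ++ v)) *: cheb (u ++ v))).
  apply: eq_big_words => y sy.
  by rewrite !take_size_cat// !drop_size_cat.
rewrite exchange_big/=; apply: eq_bigr => v _; rewrite scaler_suml.
by apply: eq_bigr => z _; rewrite take_size_cat// drop_size_cat.
Qed.

(** The discrete form of the product formula for Wigner integrals. Only the left factor is
    off-diagonal: the right one will be a contraction or a tensor power, and expanding it in [cheb]
    rather than in plain products keeps the formula exact. *)
Lemma hom_mul q d c f : off_diagonal q c ->
  hom q c * hom d f =
  \sum_(r < q.+1 | (r <= d)%N) hom ((q - r) + (d - r)) (contr q r c f).
Proof.
move=> oc; rewrite off_diagonal_hom// mulr_suml.
transitivity (\sum_(u <- words I q) \sum_(w <- words I d) \sum_(r < q.+1)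
    (take r w == rev (drop (q - r) u))%:R *:
      ((c u * f w) *: cheb (take (q - r) u ++ drop r w))).
  apply: eq_big_words => u su; rewrite mulr_sumr; apply: eq_bigr => w _.
  have [us|us] := boolP (sorted (fun i j => i != j) u); last first.
    rewrite (oc u su us) scale0r mul0r big1// => r _.
    by rewrite mul0r scale0r scaler0.
  rewrite -scalerAl -scalerAr scalerA xprod_cheb// su scaler_sumr.
  by apply: eq_bigr => r _; rewrite !scalerA mulrC.
under eq_bigr => u _ do rewrite exchange_big.
rewrite exchange_big/= [RHS]big_mkcond/=; apply: eq_bigr => r _.
have rq : (r <= q)%N by rewrite -ltnS.
case: ifPn => [rd|]; last first.
  rewrite -ltnNge => dr; apply: big1_seq => u /=; rewrite mem_words => /eqP su.
  apply: big1_seq => w /=; rewrite mem_words => /eqP sw.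
  case: eqP => [|_]; last by rewrite scale0r.
  move=> /(congr1 size); rewrite size_rev size_drop su subKn//.
  by rewrite take_oversize sw ?(ltnW dr)// => e; rewrite e ltnn in dr.
by have := hom_contr (q - r) r (d - r) c f; rewrite subnK// subnKC.
Qed.

Hypothesis xsa : forall i, st (x i) = x i.
Hypothesis phi_cheb : forall w, phi (cheb w) = (w == [::])%:R.

(** The first letter of u is self-adjoint, so it moves to the other factor, where it is prepended to
    w or cancels its head; the correction terms of both recursions then match, by induction on the
    length of u. *)
Lemma phi_star_cheb u w : phi (st (cheb u) * cheb w) = (u == w)%:R.
Proof.
have [n] := ubnP (size u); elim: n u w => // n IH [|i u] w.
  by move=> _; rewrite /= (star1 tr) mul1r phi_cheb eq_sym.
rewrite ltnS => un.
have -> : st (cheb (i :: u)) * cheb w = st (cheb u) * (x i * cheb w) -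
    (if u is j :: u' then (i == j)%:R *: (st (cheb u') * cheb w) else 0).
  rewrite /= (starB tr) (starM tr) xsa mulrBl mulrA; congr (_ - _).
  by case: u {un} => [|j u]; rewrite ?(star0 tr) ?mul0r// (starZ tr) conjC_nat -scalerAl.
rewrite mulx_cheb mulrDr (phiB tr) (phiD tr) IH//.
case: w u un => [|k w] [|j u] un; rewrite ?mulr0 ?(phi0 tr) ?(phiZ tr) ?subr0 ?addr0//.
- have -> : phi (st (cheb u) * 1) = (u == [::])%:R by apply: (IH u [::]); exact: ltnW.
  by rewrite -natrM mulnb !eqseq_cons eq_sym; case: (i == j) => /=; rewrite subrr.
- rewrite -scalerAr (phiZ tr) (IH [::])// -natrM mulnb !eqseq_cons.
  by rewrite add0r.
- rewrite -scalerAr (phiZ tr) IH; last exact: ltnW.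
  rewrite IH//.
  by rewrite -!natrM !mulnb !eqseq_cons [j == i]eq_sym [X in X - _]addrC addrK.
Qed.

Lemma phi_star_hom d e f g : phi (st (hom d f) * hom e g) =
  (d == e)%:R * \sum_(w <- words I d) Num.conj (f w) * g w.
Proof.
rewrite (star_sum tr) mulr_suml (phi_sum tr) mulr_sumr.
apply: eq_big_words => u su; rewrite mulr_sumr (phi_sum tr).
have [<-|de] := eqVneq d e; rewrite ?mul1r ?mul0r.
  transitivity (\sum_(w <- words I d)
      (w == u)%:R *: (Num.conj (f u) * g w : R[i]^o)).
    apply: eq_bigr => w _; rewrite (starZ tr) -scalerAl -scalerAr scalerA (phiZ tr).
    by rewrite phi_star_cheb mulrC eq_sym.
  by rewrite big_words_pick su eqxx scale1r.
apply: big1_seq => w /=; rewrite mem_words => /eqP sw.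
rewrite (starZ tr) -scalerAl -scalerAr scalerA (phiZ tr) phi_star_cheb.
by case: eqP => [uw|]; rewrite ?mulr0//; rewrite -su uw sw eqxx in de.
Qed.

Lemma phi_hom d f : phi (hom d f) = (d == 0%N)%:R * f [::].
Proof.
have -> : hom d f = st (hom 0 (fun=> 1)) * hom d f.
  by rewrite /hom big_words0 /= scale1r (star1 tr) mul1r.
rewrite phi_star_hom big_words0 rmorph1 mul1r eq_sym//.
Qed.

Lemma nrm_hom d f : nrm st phi (hom d f) = hnorm d f.
Proof.
rewrite /nrm /hnorm phi_star_hom eqxx mul1r; congr (Num.sqrt _).
under eq_bigr do rewrite mulconjc.
by rewrite -rc_sum.
Qed.

(** Cauchy-Schwarz in the contracted letters, for each choice of the remaining outer letters. *)
Lemma contr_le q d r c f : (r <= q)%N -> (r <= d)%N ->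
  hnorm ((q - r) + (d - r)) (contr q r c f) <= hnorm q c * hnorm d f.
Proof.
move=> rq rd; rewrite -(@ler_pXn2r _ 2) ?nnegrE ?mulr_ge0 ?hnorm_ge0//.
rewrite exprMn !sqr_hnorm.
rewrite -[X in _ <= (\sum_(_ <- words I X) _) * _](subnK rq).
rewrite -[X in _ <= _ * \sum_(_ <- words I X) _](subnKC rd) !big_words_cat.
rewrite [X in _ <= _ * X]exchange_big/= mulr_suml.
rewrite (@eq_big_words _ _ _ _ (fun u => \sum_(v <- words I (d - r))
    normc (\sum_(z <- words I r) c (u ++ z) * f (rev z ++ v)) ^+ 2)); last first.
  move=> u su; apply: eq_bigr => v _; rewrite /contr.
  by under eq_bigr => z _ do rewrite take_size_cat// drop_size_cat//.
apply: ler_sum => u _; rewrite mulr_sumr; apply: ler_sum => v _.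
rewrite -(big_words_rev r (fun z => normc (f (z ++ v)) ^+ 2)).
exact: normc_sum_CS.
Qed.

(** A certificate that y is a finite sum of homogeneous elements whose norms add up to at most M.
    Unlike the norm of L^2(phi), such a bound passes through a multiplication summand by summand,
    without sorting the terms by degree. *)
Inductive l1_bounded : R -> A -> Prop :=
| l1_hom d f : l1_bounded (hnorm d f) (hom d f)
| l1_zero : l1_bounded 0 0
| l1_add M1 M2 y1 y2 : l1_bounded M1 y1 -> l1_bounded M2 y2 ->
    l1_bounded (M1 + M2) (y1 + y2)
| l1_le M1 M2 y : M1 <= M2 -> l1_bounded M1 y -> l1_bounded M2 y.

Lemma l1_nrm M y : l1_bounded M y -> nrm st phi y <= M.
Proof.
elim=> {M y} [d f||M1 M2 y1 y2 _ h1 _ h2|M1 M2 y M12 _ h].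
- by rewrite nrm_hom.
- by rewrite (nrm0 tr).
- by rewrite (le_trans (nrmD tr _ _))// lerD.
- exact: le_trans M12.
Qed.

(** Each homogeneous summand is turned into at most q + 1 contractions, one for each order, and none
    of them exceeds the product of the norms: hence the factor [q.+1]. *)
Lemma l1_mul q c M y : off_diagonal q c -> l1_bounded M y ->
  l1_bounded (q.+1%:R * hnorm q c * M) (hom q c * y).
Proof.
move=> oc; elim=> {M y} [d f||M1 M2 y1 y2 _ h1 _ h2|M1 M2 y M12 _ h].
- rewrite hom_mul// -mulrA.
  rewrite mulr_natl -[X in _ *+ X]card_ord -sumr_const (bigID (fun r : 'I__ => (r <= d)%N))/=.
  apply: (@l1_le (\sum_(r < q.+1 | (r <= d)%N) hnorm q c * hnorm d f)).
    by rewrite lerDl sumr_ge0// => r _; rewrite mulr_ge0 ?hnorm_ge0.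
  apply: (big_ind2 l1_bounded); [exact: l1_zero| by move=> ? ? ? ?; exact: l1_add|].
  move=> r rd; apply: l1_le (l1_hom _ _).
  by apply: contr_le => //; rewrite -ltnS.
- by rewrite !mulr0; exact: l1_zero.
- by rewrite !mulrDr; exact: l1_add.
- by apply: l1_le h; rewrite ler_wpM2l// mulr_ge0 ?hnorm_ge0.
Qed.

Lemma star_xprod u : st (xprod u) = xprod (rev u).
Proof.
rewrite /xprod; elim: u => [|i u IH]; first by rewrite !big_nil (star1 tr).
by rewrite big_cons (starM tr) IH xsa rev_cons -cats1 big_cat/= big_seq1.
Qed.

(** The discrete counterpart of the adjoint kernel f^*. *)
Definition conj_rev c w := Num.conj (c (rev w)).

Lemma off_diagonal_conj_rev q c : off_diagonal q c -> off_diagonal q (conj_rev c).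
Proof.
move=> oc w sw h; rewrite /conj_rev oc ?rmorph0 ?size_rev//.
by rewrite rev_sorted (eq_sorted (e' := fun i j => i != j))// => i j; rewrite eq_sym.
Qed.

Lemma hnorm_conj_rev q c : hnorm q (conj_rev c) = hnorm q c.
Proof.
rewrite /hnorm -(big_words_rev _ (fun w => normc (c w) ^+ 2)).
by under eq_bigr do rewrite normc_conj.
Qed.

Lemma star_hom q c : off_diagonal q c -> st (hom q c) = hom q (conj_rev c).
Proof.
move=> oc; rewrite !off_diagonal_hom//; last exact: off_diagonal_conj_rev.
rewrite (star_sum tr) -[RHS]big_words_rev; apply: eq_bigr => w _.
by rewrite (starZ tr) star_xprod /conj_rev revK.
Qed.

Lemma normc_phi_pow q c n : off_diagonal q c ->
  normc (phi ((st (hom q c) * hom q c) ^+ n)) <=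
  (q.+1%:R * hnorm q c) ^+ (2 * n).
Proof.
move=> oc; rewrite (le_trans (phi_le_nrm tr _))// l1_nrm//.
elim: n => [|n IH].
  rewrite !expr0; have -> : 1 = hom 0 (fun=> 1) by rewrite /hom big_words0 scale1r.
  apply: l1_le (l1_hom _ _).
  by rewrite /hnorm big_words0 ComplexField.Normc.normc1 expr1n sqrtr1.
set K := q.+1%:R * hnorm q c in IH *.
rewrite mulnS (exprD _ 2) [X in l1_bounded _ X]exprS expr2 -!mulrA.
rewrite {1}star_hom//.
apply: (@l1_le (q.+1%:R * hnorm q (conj_rev c) * (K * K ^+ (2 * n)))).
  by rewrite hnorm_conj_rev -/K !mulrA.
apply: l1_mul; first exact: off_diagonal_conj_rev.
by apply: l1_mul => //; rewrite -star_hom.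
Qed.

Definition tensor a f g w := f (take a w) * g (drop a w).

Lemma hnorm_tensor a b f g :
  hnorm (a + b) (tensor a f g) = hnorm a f * hnorm b g.
Proof.
apply/eqP; rewrite -(@eqrXn2 _ 2) ?mulr_ge0 ?hnorm_ge0//; apply/eqP.
rewrite exprMn !sqr_hnorm big_words_cat mulr_suml.
apply: eq_big_words => u su; rewrite mulr_sumr; apply: eq_bigr => w _.
by rewrite /tensor take_size_cat// drop_size_cat// normcM exprMn.
Qed.

Definition tensor_power q c n : seq I -> R[i] := iter n (tensor q c) (fun=> 1).

Lemma hnorm_tensor_power q c n : hnorm (n * q) (tensor_power q c n) = hnorm q c ^+ n.
Proof.
elim: n => [|n IH]; last by rewrite mulSn /= hnorm_tensor IH exprS.
by rewrite mul0n /hnorm big_words0 [tensor_power _ _ _ _]/(1 : R[i])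
  ComplexField.Normc.normc1 expr1n sqrtr1.
Qed.

(** A contraction of order at most q involves only the first q letters of the right factor, so it
    stays inside c and f is carried along unchanged. *)
Lemma hom_mul_tensor q c b f : off_diagonal q c ->
  hom q c * hom (q + b) (tensor q c f) =
  \sum_(r < q.+1) hom ((q - r) + (q - r) + b)
     (tensor ((q - r) + (q - r)) (contr q r c c) f).
Proof.
move=> oc; rewrite hom_mul//; apply: eq_big => [[r hr]|[r hr] _]/=.
  by rewrite (leq_trans (_ : r <= q)%N)// leq_addr.
have -> : (q - r + (q + b - r) = q - r + (q - r) + b)%N by lia.
apply: eq_hom => w sw.
rewrite /tensor /contr mulr_suml; apply: eq_big_words => z sz.
have rq : (r <= q)%N by rewrite -ltnS.
rewrite take_cat drop_cat size_rev sz ltnNge rq /= drop_drop take_takel ?leq_addr//.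
by rewrite take_drop mulrA.
Qed.

End free_family.

(** * The fourth moment defect *)

Section fourth_moment.
Variables (R : rcfType) (A : algType R[i]) (st : A -> A) (phi : A -> R[i]).
Hypothesis tr : tracial_state st phi.
Variables (I : finType) (x : I -> A).
Hypothesis xsa : forall i, st (x i) = x i.
Hypothesis phi_cheb : forall w, phi (cheb x w) = (w == [::])%:R.
Implicit Types (w : seq I) (f g : seq I -> R[i]).
Local Notation hom := (hom x).
Local Notation hnorm := (hnorm (R := R) (I := I)).
Variables (p : nat) (c : seq I -> R[i]).
Hypothesis p_gt0 : (0 < p)%N.
Local Notation q := (p + p)%N.
Hypothesis oc : off_diagonal q c.
Local Notation T := (hom q c).

Let middle (r : 'I_q.+1) := [&& r != 0 :> nat, r != p :> nat & r != q :> nat].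

Let big_middle (V : nmodType) (F : nat -> V) : \sum_(r < q.+1) F r =
  F 0%N + F p + F q + \sum_(r < q.+1 | middle r) F r.
Proof.
have pq : (p < q.+1)%N by lia.
rewrite (bigD1 ord0)//= (bigD1 (Ordinal pq))//=; last first.
  by rewrite -val_eqE/=; lia.
rewrite (bigD1 ord_max)//=; last by rewrite -!val_eqE/=; lia.
rewrite !addrA; congr (_ + _); apply: eq_bigl => r.
by rewrite /middle -!val_eqE/= andbA.
Qed.

Lemma hom_sqr : T * T =
  \sum_(r < q.+1) hom ((q - r) + (q - r)) (contr q r c c).
Proof.
by rewrite hom_mul//; apply: eq_bigl => r; rewrite -ltnS ltn_ord.
Qed.

Lemma hnorm_subr d f g : hnorm d (fun w => f w - g w) ^+ 2 =
  hnorm d f ^+ 2 - 2 * complex.Re (\sum_(w <- words I d) Num.conj (g w) * f w) +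
  hnorm d g ^+ 2.
Proof.
rewrite !sqr_hnorm (big_morph _ (@ReD R) (erefl : complex.Re (0 : R[i]) = 0)).
rewrite mulr_sumr -sumrB -big_split/=; apply: eq_bigr => w _.
apply: complexI; rewrite -mulconjc rcD rcB -!mulconjc rmorphB/=.
rewrite [(2 * _)%:C]rcM rmorph_nat -addcJ -conjC_complex rmorphM/= conjCK; ring.
Qed.

Lemma hnorm_contr0 : hnorm (q + q) (contr q 0 c c) = hnorm q c ^+ 2.
Proof.
rewrite -[RHS]/(hnorm q c * hnorm q c) -hnorm_tensor /hnorm; congr Num.sqrt.
apply: eq_bigr => w _; rewrite /contr big_words0 /= subn0 cats0.
by [].
Qed.

Lemma hnorm0 f : hnorm 0 f = normc (f [::]).
Proof. by rewrite /hnorm big_words0 sqrtr_sqr ger0_norm ?normc_ge0. Qed.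

Lemma phi_sqr_contr : phi (T * T) = contr q q c c [::].
Proof.
rewrite hom_sqr (phi_sum tr) big_ord_recr/= big1 ?add0r => [|r _].
  by rewrite subnn (phi_hom tr)//= mul1r.
rewrite (phi_hom tr)//= (_ : _ == _ = false) ?mul0r//.
by have := ltn_ord r; lia.
Qed.

(** Components of different degrees are orthogonal, and the degree 2 (q - r) equals q only for r =
    p. *)
Lemma phi_star_sqr_contr : phi (st T * (T * T)) =
  \sum_(w <- words I q) Num.conj (c w) * contr q p c c w.
Proof.
rewrite hom_sqr mulr_sumr (phi_sum tr).
have pq : (p < q.+1)%N by lia.
rewrite (bigD1 (Ordinal pq))//= big1 ?addr0 => [|r].
  by rewrite (phi_star_hom tr)// addnK eqxx mul1r.
rewrite -val_eqE/= => rp; rewrite (phi_star_hom tr)// (_ : _ == _ = false) ?mul0r//.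
by have := ltn_ord r; lia.
Qed.

Lemma nrm_sqr_contr : nrm st phi (T * T) ^+ 2 =
  \sum_(r < q.+1) hnorm ((q - r) + (q - r)) (contr q r c c) ^+ 2.
Proof.
apply: complexI; rewrite -(phi_sqr tr) hom_sqr (star_sum tr) mulr_suml (phi_sum tr).
rewrite rc_sum; apply: eq_bigr => r _.
rewrite mulr_sumr (phi_sum tr) (bigD1 r)//= big1 ?addr0 => [|s].
  by rewrite (phi_sqr tr) (nrm_hom tr).
rewrite -val_eqE/= => rs; rewrite (phi_star_hom tr)// (_ : _ == _ = false) ?mul0r//.
by have := ltn_ord r; have := ltn_ord s; lia.
Qed.

(* It vanishes exactly when the contraction of order p of c with itself is c and
   those of the other orders between 0 and q are zero. *)
Definition defect : R :=
  \sum_(r < q.+1 | middle r) hnorm ((q - r) + (q - r)) (contr q r c c) ^+ 2 +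
  hnorm q (fun w => contr q p c c w - c w) ^+ 2.

Lemma defect_ge0 : 0 <= defect.
Proof. by rewrite addr_ge0 ?sqr_ge0// sumr_ge0// => r _; exact: sqr_ge0. Qed.

(** The norm of T T splits orthogonally over the orders: order 0 contributes |T|^4, order q
    contributes |phi(T T)|^2, and the terms - 2 Re phi(st T T T) + |T|^2 complete the square for
    order p. For T self-adjoint with variance lambda the right-hand side is phi(T^4) - 2 phi(T^3) -
    (2 lambda^2 - lambda). *)
Lemma defectE : defect = nrm st phi (T * T) ^+ 2 -
  2 * complex.Re (phi (st T * (T * T))) + nrm st phi T ^+ 2 -
  nrm st phi T ^+ 4 - normc (phi (T * T)) ^+ 2.
Proof.
rewrite /defect nrm_sqr_contr phi_star_sqr_contr phi_sqr_contr (nrm_hom tr)//.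
rewrite hnorm_subr (big_middle (fun r =>
  hnorm ((q - r) + (q - r)) (contr q r c c) ^+ 2)) subn0 hnorm_contr0 subnn addnK.
rewrite [hnorm (0 + 0) _]hnorm0; ring.
Qed.

Definition chaos_power n : A := hom (n * q) (tensor_power q c n).

Lemma chaos_power0 : chaos_power 0 = 1.
Proof. by rewrite /chaos_power mul0n hom0 scale1r. Qed.

Lemma chaos_power1 : chaos_power 1 = T.
Proof.
rewrite /chaos_power mul1n; apply: eq_hom => w sw.
by rewrite /= /tensor -sw take_size mulr1.
Qed.

Lemma nrm_chaos_power n : nrm st phi (chaos_power n) = hnorm q c ^+ n.
Proof. by rewrite (nrm_hom tr)// hnorm_tensor_power. Qed.

Lemma phi_chaos_power n : phi (chaos_power n) = (n == 0%N)%:R.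
Proof.
rewrite (phi_hom tr)// muln_eq0; case: n => [|n] /=; first by rewrite mul1r.
by rewrite (_ : _ == _ = false) ?mul0r//; lia.
Qed.

(** Order 0 gives C_(n+2), order q gives phi(T T) C_n, and order p gives C_(n+1) up to the
    coefficients contr_p c - c. Each of the remaining orders, at most q + 1 of them, and this
    difference have norm at most the square root of the defect: hence [q.+2]. *)
Lemma chaos_power_step n lambda :
  nrm st phi (T * chaos_power n.+1 -
    (chaos_power n.+2 + chaos_power n.+1 + lambda *: chaos_power n)) <=
  (q.+2%:R * Num.sqrt defect + normc (phi (T * T) - lambda)) * hnorm q c ^+ n.
Proof.
pose tens a f : A := hom (a + n * q) (tensor a f (tensor_power q c n)).
have nrm_tens a f : nrm st phi (tens a f) = hnorm a f * hnorm q c ^+ n.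
  by rewrite (nrm_hom tr)// hnorm_tensor hnorm_tensor_power.
pose F r := tens ((q - r) + (q - r))%N (contr q r c c).
have -> : T * chaos_power n.+1 - (chaos_power n.+2 + chaos_power n.+1 +
      lambda *: chaos_power n) =
    \sum_(r < q.+1 | middle r) F r + tens q (fun w => contr q p c c w - c w) +
    (phi (T * T) - lambda) *: chaos_power n.
  rewrite {1}/chaos_power mulSn /= hom_mul_tensor// (big_middle F).
  have -> : F 0%N = chaos_power n.+2.
    rewrite /F /tens /chaos_power subn0.
    have -> : (n.+2 * q = q + q + n * q)%N by rewrite !mulSn !addnA.
    apply: eq_hom => w _.
    rewrite /= /tensor /contr big_words0 subn0/= cats0 drop_drop take_takel ?leq_addr//.
    by rewrite take_drop mulrA.
  have -> : F q = phi (T * T) *: chaos_power n.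
    rewrite /F /tens subnn phi_sqr_contr /chaos_power -homZ; apply: eq_hom => w _.
    by rewrite /tensor take0 drop0.
  have -> : tens q (fun w => contr q p c c w - c w) = F p - chaos_power n.+1.
    rewrite /F /tens addnK /chaos_power mulSn -homB; apply: eq_hom => w _.
    by rewrite /tensor mulrBl.
  rewrite scalerBl; apply/eqP; rewrite subr_eq; apply/eqP.
  by rewrite [RHS](AC (1*2*2*3) (6*2*4*1*(3*7)*(5*8)))/= !addNr !addr0.
rewrite (le_trans (nrmD tr _ _))// (nrmZ tr) nrm_chaos_power mulrDl lerD2r.
rewrite (le_trans (nrmD tr _ _))// -natr1 mulrDl mul1r mulrDl lerD//.
  rewrite (le_trans (nrm_sum tr _ _ _))//.
  apply: (@le_trans _ _ (\sum_(r < q.+1) Num.sqrt defect * hnorm q c ^+ n)).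
    rewrite [leRHS](bigID middle)/= -[leLHS]addr0 lerD//.
      apply: ler_sum => r rm; rewrite nrm_tens ler_wpM2r ?exprn_ge0 ?hnorm_ge0//.
      rewrite -[leLHS]ger0_norm ?hnorm_ge0// -sqrtr_sqr ler_wsqrtr// /defect.
      rewrite (bigD1 r)//= -addrA lerDl addr_ge0 ?sqr_ge0// sumr_ge0// => s _.
      exact: sqr_ge0.
    by apply: sumr_ge0 => r _; rewrite mulr_ge0 ?sqrtr_ge0 ?exprn_ge0 ?hnorm_ge0.
  by rewrite sumr_const card_ord -mulrA mulr_natl.
rewrite nrm_tens ler_wpM2r ?exprn_ge0 ?hnorm_ge0//.
rewrite -[leLHS]ger0_norm ?hnorm_ge0// -sqrtr_sqr ler_wsqrtr// /defect lerDr.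
by apply: sumr_ge0 => r _; exact: sqr_ge0.
Qed.

End fourth_moment.

(** * Operator bounds and limits of moments in L^2(phi) *)

Lemma bernoulli_ineq (R : realDomainType) (y : R) n : 0 <= y -> 1 + y *+ n <= (1 + y) ^+ n.
Proof.
move=> y0; elim: n => [|n IH]; first by rewrite mulr0n addr0 expr0.
rewrite exprS mulrSr addrA mulrDl mul1r lerD//.
rewrite ler_peMr// exprn_ege1// lerDl//.
Qed.

(* If r exceeded k the powers (r / k) ^ 2 ^ n would be unbounded. *)
Lemma le_of_expr2n_le (R : realType) (r k C : R) : 0 <= k ->
  (forall n, r ^+ (2 ^ n) <= C * k ^+ (2 ^ n)) -> r <= k.
Proof.
move=> k0 h; rewrite leNgt; apply/negP => kr.
have [kz|kn] := eqVneq k 0.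
  by have := h 0%N; rewrite expn0 !expr1 kz mulr0 leNgt -{1}kz kr.
have kp : 0 < k by rewrite lt_neqAle eq_sym kn.
pose y := r / k - 1.
have y0 : 0 < y by rewrite subr_gt0 ltr_pdivlMr// mul1r.
have hC n : y *+ n <= C.
  have : (r / k) ^+ (2 ^ n) <= C.
    by rewrite expr_div_n ler_pdivrMr ?exprn_gt0.
  have -> : r / k = 1 + y by rewrite /y; ring.
  apply: le_trans; apply: le_trans (bernoulli_ineq _ (ltW y0)).
  apply: (@le_trans _ _ (y *+ 2 ^ n)); last by rewrite lerDr.
  by rewrite ler_wpMn2l ?(ltW y0)// ltnW// ltn_expl.
have := hC (Num.bound (C / y)); rewrite leNgt -mulr_natr mulrC -ltr_pdivrMr//.
by rewrite archi_boundP// divr_ge0 ?(ltW y0)//; have := hC 0%N; rewrite mulr0n.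
Qed.

Lemma cvg_sqr0 (R : realType) (u : nat -> R) : (forall k, 0 <= u k) ->
  u k ^+ 2 @[k --> \oo] --> (0 : R) -> u k @[k --> \oo] --> (0 : R).
Proof.
move=> u0 h; rewrite (_ : u = Num.sqrt \o (fun k => u k ^+ 2)); last first.
  by apply/funext => k /=; rewrite sqrtr_sqr ger0_norm.
rewrite -[0 in X in _ --> X](@sqrtr0 R).
by apply: continuous_cvg => //; exact: sqrt_continuous.
Qed.

(* With monic orthogonal polynomials P_0 = 1, P_1 = x,
   P_(n+2) = x P_(n+1) - P_(n+1) - lambda P_n, this is the integral of x ^+ m P_n
   with respect to the centered free Poisson law. *)
Fixpoint jacobi_moment (R : pzRingType) (lambda : R) m n : R :=
  if m is m'.+1 then
    if n is n'.+1 then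
      jacobi_moment lambda m' n'.+2 + jacobi_moment lambda m' n'.+1 +
      lambda * jacobi_moment lambda m' n'
    else jacobi_moment lambda m' 1
  else (n == 0%N)%:R.

Section tracial_convergence.
Variables (R : realType) (A : algType R[i]) (st : A -> A) (phi : A -> R[i]).
Hypothesis tr : tracial_state st phi.
Local Notation nrm := (nrm st phi).
Implicit Types (y z : A).

(* With h = st t * t, Cauchy-Schwarz gives nrm (h ^+ n * y) ^+ 2 <=
   nrm y * nrm (h ^+ (2 * n) * y); iterating transfers the growth rate of the
   moments of h to its action on an arbitrary y. *)
Lemma nrm_mul_le_of_moments t K : 0 <= K ->
  (forall n, normc (phi ((st t * t) ^+ n)) <= K ^+ (2 * n)) ->
  forall y, nrm (t * y) <= K * nrm y.
Proof.
move=> K0 hK y; set h := st t * t.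
have sh : st h = h by rewrite /h (starM tr) (starK tr).
have shn n : st (h ^+ n) = h ^+ n by rewrite (starX tr) sh.
pose b n := nrm (h ^+ n * y).
have b2 n : b n ^+ 2 <= nrm y * b (n + n)%N.
  rewrite -lecR -(phi_sqr tr) (starM tr) shn.
  have -> : st y * h ^+ n * (h ^+ n * y) = st y * (h ^+ (n + n) * y).
    by rewrite exprD !mulrA.
  have e : 0 <= phi (st y * (h ^+ (n + n) * y)).
    have := phi_ge0 tr (h ^+ n * y).
    by rewrite (starM tr) shn exprD !mulrA.
  by rewrite (ge0_complexE e) lecR (le_trans (Re_le_normc _))// (phi_CS tr).
(* Traciality collects y and its adjoint into one factor, so that y enters only through a constant
   independent of n; this constant disappears when roots of order 2^n are taken. *)
have bB n : b n ^+ 2 <= K ^+ (4 * n) * nrm (y * st y).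
  rewrite -lecR -(phi_sqr tr) (starM tr) shn.
  have -> : phi (st y * h ^+ n * (h ^+ n * y)) = phi (st (h ^+ (n + n)) * (y * st y)).
    by rewrite -mulrA (phi_trace tr) shn exprD !mulrA.
  have e : 0 <= phi (st (h ^+ (n + n)) * (y * st y)).
    have := phi_ge0 tr (h ^+ n * y).
    by rewrite (starM tr) shn -mulrA (phi_trace tr) shn exprD !mulrA.
  rewrite (ge0_complexE e) lecR (le_trans (Re_le_normc _))// (le_trans (phi_CS tr _ _))//.
  rewrite ler_wpM2r ?(nrm_ge0 st phi)//.
  rewrite -(@ler_pXn2r _ 2) ?nnegrE ?exprn_ge0 ?(nrm_ge0 st phi)//.
  rewrite -lecR -(phi_sqr tr) shn -exprD.
  have e2 : 0 <= phi (h ^+ (n + n + (n + n))).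
    by have := phi_ge0 tr (h ^+ (n + n)); rewrite shn -exprD.
  rewrite (ge0_complexE e2) lecR (le_trans (Re_le_normc _))// (le_trans (hK _))//.
  by rewrite -exprM (_ : (2 * (n + n + (n + n)) = 4 * n * 2)%N)//; lia.
have ty : nrm (t * y) ^+ 2 <= nrm y * b 1%N.
  rewrite -lecR -(phi_sqr tr).
  have e := phi_ge0 tr (t * y); rewrite (ge0_complexE e) lecR.
  rewrite (le_trans (Re_le_normc _))// (starM tr) /b expr1 /h.
  by rewrite -mulrA (mulrA (st t)) (phi_CS tr).
have [y0|y0] := eqVneq (nrm y) 0.
  have -> : y = 0 by exact: (nrm_eq0 tr y0).
  by rewrite mulr0 (nrm0 tr) mulr0.
have yp : 0 < nrm y by rewrite lt_neqAle eq_sym y0 (nrm_ge0 st phi).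
have iter n : (b 1%N / nrm y) ^+ (2 ^ n) <= b (2 ^ n)%N / nrm y.
  elim: n => [|n IH]; first by rewrite expn0 expr1.
  rewrite expnSr exprM.
  apply: (@le_trans _ _ ((b (2 ^ n)%N / nrm y) ^+ 2)).
    by rewrite ler_pXn2r ?nnegrE ?exprn_ge0 ?divr_ge0 ?(nrm_ge0 st phi).
  rewrite expr_div_n ler_pdivrMr ?exprn_gt0// muln2 -addnn.
  by rewrite [leRHS](_ : _ = nrm y * b (2 ^ n + 2 ^ n)%N) ?b2//; field.
have b1 : b 1%N / nrm y <= K ^+ 2.
  have : (b 1%N / nrm y) ^+ 2 <= K ^+ 4.
    apply: (@le_of_expr2n_le _ _ _ (nrm (y * st y) / nrm y ^+ 2)); first exact: exprn_ge0.
    move=> n; rewrite -!exprM mulnC exprM.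
    apply: (@le_trans _ _ ((b (2 ^ n)%N / nrm y) ^+ 2)).
      by rewrite ler_pXn2r ?nnegrE ?exprn_ge0 ?divr_ge0 ?(nrm_ge0 st phi).
    rewrite expr_div_n ler_pdivrMr ?exprn_gt0// mulrAC divfK ?expf_neq0//.
    by rewrite mulrC bB.
  by rewrite (exprM K 2 2) ler_pXn2r ?nnegrE ?exprn_ge0 ?divr_ge0 ?(nrm_ge0 st phi).
rewrite -(@ler_pXn2r _ 2) ?nnegrE ?mulr_ge0 ?(nrm_ge0 st phi)//.
rewrite ler_pdivrMr// in b1.
apply: le_trans ty _; rewrite exprMn mulrC.
by rewrite [leRHS](_ : _ = K ^+ 2 * nrm y * nrm y) ?ler_wpM2r ?(nrm_ge0 st phi)// expr2 mulrA.
Qed.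

Section limit.
Variables (t_ : nat -> A) (X : A) (K : R).
Hypothesis t_X : nrm (t_ k - X) @[k --> \oo] --> (0 : R).
Hypothesis t_le : \forall k \near \oo, forall y, nrm (t_ k * y) <= K * nrm y.
Hypothesis K0 : 0 <= K.

(** Convergence of [t_ k] to X in L^2(phi) does not directly control [(t_ k - X) * y]. In a pairing
    with z the trace brings y and [st z] together as one fixed element, so the pairing passes to the
    limit; then z = X y gives the norm. *)
Lemma nrm_limit_mul_le y : nrm (X * y) <= K * nrm y.
Proof.
have key z : normc (phi (st z * (X * y))) <= K * nrm z * nrm y.
  apply/ler_addgt0Pr => e e0.
  have h : nrm (y * st z) * nrm (t_ k - X) @[k --> \oo] --> (0 : R).
    by rewrite -[0 in X in _ --> X](mulr0 (nrm (y * st z))); exact: cvgMr.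
  have : \forall k \near \oo, nrm (y * st z) * nrm (t_ k - X) < e.
    by apply: (cvgr_lt (0 : R)).
  move=> /(filterI t_le)[k _ /(_ k (leqnn k))[/= tk ek]].
  have -> : phi (st z * (X * y)) = phi (st z * (t_ k * y)) - phi ((t_ k - X) * (y * st z)).
    rewrite [phi ((t_ k - X) * _)](_ : _ = phi (st z * (t_ k * y)) - phi (st z * (X * y))).
      by ring.
    by rewrite -(phiB tr) -mulrBr -mulrBl mulrA (phi_trace tr).
  rewrite (le_trans (normcB _ _))// lerD//.
    rewrite (le_trans (phi_CS tr _ _))// [K * _]mulrC -mulrA ler_wpM2l//.
    exact: (nrm_ge0 st phi).
  rewrite -[t_ k - X](starK tr) (le_trans (phi_CS tr _ _))// (nrm_star tr).
  by rewrite mulrC ltW.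
have [n0|n0] := eqVneq (nrm (X * y)) 0.
  by rewrite n0 mulr_ge0// (nrm_ge0 st phi).
have np : 0 < nrm (X * y) by rewrite lt_neqAle eq_sym n0 (nrm_ge0 st phi).
rewrite -(ler_pM2r np) -expr2 mulrAC; apply: le_trans (key (X * y)).
by rewrite (phi_sqr tr) normc_real ger0_norm// sqr_ge0.
Qed.

(** By traciality and Cauchy-Schwarz, |d y|^2 <= |d| |d (y st y)| for [d = t_ k - X]. The first
    factor tends to 0 and the second is at most 2 K |y st y|. *)
Lemma nrm_subr_mul_cvg y : nrm ((t_ k - X) * y) @[k --> \oo] --> (0 : R).
Proof.
apply: cvg_sqr0 => [k|]; first exact: (nrm_ge0 st phi).
set B := 2 * K * nrm (y * st y).
have h : nrm (t_ k - X) * B @[k --> \oo] --> (0 : R).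
  by rewrite -[0 in X in _ --> X](mul0r B); exact: cvgMl.
apply: (squeeze_cvgr _ (cvg_cst 0) h); near=> k.
rewrite sqr_ge0/= -lecR -(phi_sqr tr); set d := t_ k - X.
have := phi_ge0 tr (d * y) => e; rewrite (ge0_complexE e) lecR.
rewrite (le_trans (Re_le_normc _))//.
have -> : phi (st (d * y) * (d * y)) = phi (st (st d) * st (d * (y * st y))).
  rewrite !(starM tr) !(starK tr) (phi_trace tr) -!mulrA.
  by rewrite (phi_trace tr) !mulrA (phi_trace tr) !mulrA.
rewrite (le_trans (phi_CS tr _ _))// !(nrm_star tr) ler_wpM2l ?(nrm_ge0 st phi)//.
rewrite /d mulrBl (le_trans (nrmB tr _ _))// /B -mulrA mulr_natl mulr2n lerD ?nrm_limit_mul_le//.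
by near: k; apply: filterS t_le => k.
Unshelve. all: by end_near. Qed.

Lemma nrm_pow_cvg n : nrm (t_ k ^+ n - X ^+ n) @[k --> \oo] --> (0 : R).
Proof.
elim: n => [|n IH].
  rewrite (_ : (fun k => _) = cst 0); first exact: cvg_cst.
  by apply/funext => k; rewrite !expr0 subrr (nrm0 tr).
have h : K * nrm (t_ k ^+ n - X ^+ n) + nrm ((t_ k - X) * X ^+ n) @[k --> \oo] --> (0 : R).
  rewrite -[0 in X in _ --> X](addr0 0) -{1}(mulr0 K).
  by apply: cvgD; [exact: cvgMr|exact: nrm_subr_mul_cvg].
apply: (squeeze_cvgr _ (cvg_cst 0) h); near=> k; rewrite (nrm_ge0 st phi)/=.
have -> : t_ k ^+ n.+1 - X ^+ n.+1 =
    t_ k * (t_ k ^+ n - X ^+ n) + (t_ k - X) * X ^+ n.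
  by rewrite !exprS mulrBr mulrBl addrA subrK.
rewrite (le_trans (nrmD tr _ _))// lerD2r.
by near: k; apply: filterS t_le => k.
Unshelve. all: by end_near. Qed.

Lemma phi_pow_cvg n : normc (phi (t_ k ^+ n) - phi (X ^+ n)) @[k --> \oo] --> (0 : R).
Proof.
apply: (squeeze_cvgr _ (cvg_cst 0) (nrm_pow_cvg n)); near=> k.
by rewrite normc_ge0 -(phiB tr) (phi_le_nrm tr).
Unshelve. all: by end_near. Qed.

Lemma nrm_powr_cvg n : nrm (t_ k ^+ n) @[k --> \oo] --> nrm (X ^+ n).
Proof.
apply/cvgrPdist_le => e e0; near=> k.
have : nrm (t_ k ^+ n - X ^+ n) <= e.
  by near: k; have /cvgr_le := nrm_pow_cvg n; exact.
apply: le_trans.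
have h1 : nrm (t_ k ^+ n) <= nrm (t_ k ^+ n - X ^+ n) + nrm (X ^+ n).
  by rewrite -[in leLHS](subrK (X ^+ n) (t_ k ^+ n)) (nrmD tr).
have h2 : nrm (X ^+ n) <= nrm (t_ k ^+ n - X ^+ n) + nrm (t_ k ^+ n).
  rewrite -(nrmN tr (_ - _)) opprB -[in leLHS](subrK (t_ k ^+ n) (X ^+ n)).
  by rewrite (nrmD tr).
by rewrite ler_norml; apply/andP; split; lra.
Unshelve. all: by end_near. Qed.

Lemma phi_star_pow_cvg m n : complex.Re (phi (st (t_ k ^+ m) * t_ k ^+ n)) @[k --> \oo] -->
  complex.Re (phi (st (X ^+ m) * X ^+ n)).
Proof.
apply/cvgrPdist_le => e e0.
have h : nrm (t_ k ^+ m - X ^+ m) * nrm (t_ k ^+ n) +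
    nrm (X ^+ m) * nrm (t_ k ^+ n - X ^+ n) @[k --> \oo] -->
    0 * nrm (X ^+ n) + nrm (X ^+ m) * 0.
  apply: cvgD; last by apply: cvgMr; exact: nrm_pow_cvg.
  by apply: cvgM; [exact: nrm_pow_cvg|exact: nrm_powr_cvg].
rewrite mul0r mulr0 addr0 in h.
near=> k.
have : nrm (t_ k ^+ m - X ^+ m) * nrm (t_ k ^+ n) +
    nrm (X ^+ m) * nrm (t_ k ^+ n - X ^+ n) <= e.
  by near: k; have /cvgr_le := h; exact.
apply: le_trans; rewrite distrC -ReN -ReD -(phiB tr).
have -> : st (t_ k ^+ m) * t_ k ^+ n - st (X ^+ m) * X ^+ n =
    st (t_ k ^+ m - X ^+ m) * t_ k ^+ n + st (X ^+ m) * (t_ k ^+ n - X ^+ n).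
  by rewrite (starB tr) mulrBl mulrBr addrA subrK.
rewrite (phiD tr) -lecR (le_trans (normc_ge_Re _))// normcE lecR.
by rewrite (le_trans (normcD _ _))// lerD// (phi_CS tr).
Unshelve. all: by end_near. Qed.

End limit.

Section jacobi.
Variables (lambda K M : R).
Hypotheses (lambda0 : 0 <= lambda) (K0 : 0 <= K).

(** Propagates the errors through the recursion of [jacobi_moment]. The summand [K ^+ m' * M ^+ n']
    is the new error: a remainder of norm at most eta M^n', multiplied by m' copies of t. *)
Fixpoint jacobi_bound m n : R :=
  if m is m'.+1 then
    if n is n'.+1 then
      jacobi_bound m' n'.+2 + jacobi_bound m' n'.+1 +
      lambda * jacobi_bound m' n' + K ^+ m' * M ^+ n'
    else jacobi_bound m' 1
  else 0.

Lemma nrm_pow_mul_le t n y : (forall y, nrm (t * y) <= K * nrm y) ->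
  nrm (t ^+ n * y) <= K ^+ n * nrm y.
Proof.
move=> tK; elim: n => [|n IH]; first by rewrite !expr0 !mul1r.
by rewrite !exprS -!mulrA (le_trans (tK _))// ler_wpM2l.
Qed.

(** The numbers phi(t^m C_n) satisfy, up to these errors, the recursion in (m, n) of
    [jacobi_moment], with the same values at m = 0. The induction on m therefore runs over all n at
    once, although only n = 0 is wanted. *)
Lemma jacobi_approx t (C : nat -> A) eta :
  C 0%N = 1 -> C 1%N = t -> (forall n, phi (C n) = (n == 0%N)%:R) ->
  (forall y, nrm (t * y) <= K * nrm y) ->
  (forall n, nrm (t * C n.+1 - (C n.+2 + C n.+1 + lambda%:C *: C n)) <= eta * M ^+ n) ->
  forall m, normc (phi (t ^+ m) - (jacobi_moment lambda m 0)%:C) <=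
    jacobi_bound m 0 * eta.
Proof.
move=> C0 C1 phiC tK tC m.
suff h n : normc (phi (t ^+ m * C n) - (jacobi_moment lambda m n)%:C) <=
    jacobi_bound m n * eta by have := h 0%N; rewrite C0 mulr1.
elim: m n => [|m IH] n.
  rewrite expr0 mul1r phiC mul0r /=.
  by case: (n == 0%N); rewrite ?subrr ComplexField.Normc.normc0.
rewrite exprSr -mulrA; case: n => [|n]; first by rewrite C0 mulr1 -{2}C1; exact: IH.
have [E [-> nE]] : exists E, t * C n.+1 = C n.+2 + C n.+1 + lambda%:C *: C n + E /\
    nrm E <= eta * M ^+ n.
  by exists (t * C n.+1 - (C n.+2 + C n.+1 + lambda%:C *: C n)); rewrite addrC subrK.
rewrite !mulrDr !(phiD tr) -scalerAr (phiZ tr) /= !rcD rcM.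
set a1 := phi (_ * C n.+2); set a2 := phi (_ * C n.+1); set a3 := phi (_ * C n).
set a4 := phi (_ * E).
rewrite (_ : _ - _ = (a1 - (jacobi_moment lambda m n.+2)%:C) +
   (a2 - (jacobi_moment lambda m n.+1)%:C) +
   lambda%:C * (a3 - (jacobi_moment lambda m n)%:C) + a4); last by ring.
rewrite !mulrDl (le_trans (normcD _ _))// lerD//; last first.
  rewrite (le_trans (phi_le_nrm tr _))// (le_trans (nrm_pow_mul_le _ _ tK))//.
  by rewrite -mulrA ler_wpM2l ?exprn_ge0// mulrC.
rewrite (le_trans (normcD _ _))// lerD//; last first.
  by rewrite normcM normc_real ger0_norm// -[leRHS]mulrA ler_wpM2l// IH.
by rewrite (le_trans (normcD _ _))// lerD// IH.
Qed.

End jacobi.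

End tracial_convergence.

(** * Moments of the free Poisson law *)

Section real_integrals.
Variable R : realType.
Local Notation leb := (@lebesgue_measure R).
Implicit Types (F f h : R -> R).

Lemma is_derive_LRcontinuous F f a b : (forall x : R, is_derive x 1 F (f x)) ->
  derivable_oo_LRcontinuous F a b.
Proof.
move=> dF; have cF x : {for x, continuous F}.
  by apply: differentiable_continuous; apply/derivable1_diffP; have [] := dF x.
split=> [x _||]; first by have [] := dF x.
- exact: cvg_at_right_filter (cF a).
- exact: cvg_at_left_filter (cF b).
Qed.

Lemma integral_is_derive F f a b : a < b -> (forall x : R, is_derive x 1 F (f x)) ->
  continuous f -> (\int[leb]_(x in `[a, b]) (f x)%:E = (F b - F a)%:E)%E.
Proof.
move=> ab dF cf; rewrite (continuous_FTC2 ab (F := F))//.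
- exact: continuous_subspaceT.
- exact: is_derive_LRcontinuous dF.
- by move=> x _; rewrite derive1E; have [] := dF x.
Qed.

Lemma integral_semicircle_subst (c rho : R) h : 0 < rho ->
  {within `[c - 2 * rho, c + 2 * rho], continuous h} ->
  (\int[leb]_(x in `[(c - 2 * rho)%R, (c + 2 * rho)%R])
     (h x * Num.sqrt (4 * rho ^+ 2 - (x - c) ^+ 2))%R%:E =
   \int[leb]_(x in `[0%R, pi])
     (4 * rho ^+ 2 * (h (c + 2 * rho * cos x) * sin x ^+ 2))%R%:E)%E.
Proof.
move=> rho0 ch; pose F x := c + 2 * rho * cos x.
have dF (x : R) : is_derive x 1 F (- (2 * rho * sin x)).
  by apply: is_derive_eq; rewrite /GRing.scale/= ; ring.
have F'E : derive1 F = fun x => - (2 * rho * sin x).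
  by apply/funext => x; rewrite derive1E; have [] := dF x.
have cF' : continuous (derive1 F).
  rewrite F'E => x; apply: cvgN; apply: cvgM; first exact: cvg_cst.
  exact: continuous_sin.
have -> : c - 2 * rho = F pi by rewrite /F cospi; ring.
have -> : c + 2 * rho = F 0 by rewrite /F cos0; ring.
rewrite integration_by_substitution_decreasing ?pi_ge0//.
- apply: eq_integral => x; rewrite inE/= in_itv/= => /andP[x0 xpi]; congr EFin.
  transitivity (h (F x) * Num.sqrt (4 * rho ^+ 2 - (F x - c) ^+ 2) * - derive1 F x) => //.
  rewrite F'E opprK.
  have -> : 4 * rho ^+ 2 - (F x - c) ^+ 2 = (2 * rho * sin x) ^+ 2.
    by rewrite !exprMn sin2cos2 /F; ring.
  by rewrite sqrtr_sqr ger0_norm ?mulr_ge0 ?sin_ge0_pi ?x0// ?ltW//; rewrite /F; ring.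
- move=> x y x0 y0 xy; rewrite /F ltrD2l ltr_pM2l ?mulr_gt0// ltr_cos//.
- by apply/cvg_ex; exists (derive1 F 0); exact: cvg_at_right_filter (cF' 0).
- by apply/cvg_ex; exists (derive1 F pi); exact: cvg_at_left_filter (cF' pi).
- exact: is_derive_LRcontinuous dF.
- have e1 : F pi = c - 2 * rho by rewrite /F cospi; ring.
  have e2 : F 0 = c + 2 * rho by rewrite /F cos0; ring.
  rewrite e1 e2 => x; apply: cvgM; first exact: ch.
  move: x; apply: continuous_subspaceT => x.
  apply: (@continuous_comp _ _ _ (fun x => 4 * rho ^+ 2 - (x - c) ^+ 2) Num.sqrt); last first.
    exact: sqrt_continuous.
  apply: cvgB; first exact: cvg_cst.
  apply: (@continuous_comp _ _ _ (fun x => x - c) (fun y => y ^+ 2)); last first.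
    exact: exprn_continuous.
  by apply: cvgB; [exact: cvg_id|exact: cvg_cst].
Qed.

End real_integrals.

Section density.
Variable R : realType.
Local Notation leb := (@lebesgue_measure R).
Local Notation T := (measurableTypeR R).
Variables (nu : {measure set T -> \bar R}) (g : R -> R).
Hypotheses (mg : measurable_fun setT g) (g0 : forall x, 0 <= g x).
Hypothesis nuE : forall A : set T, measurable A ->
  nu A = (\int[leb]_(x in A) (g x)%:E)%E.

Import HBNNSimple.

Let ge0_mule_fun f : (forall x, 0 <= f x) -> forall x, (0 <= (f x * g x)%:E)%E.
Proof. by move=> f0 x; rewrite lee_fin mulr_ge0. Qed.

Let integral_density_indic E : measurable E ->
  (\int[nu]_x (\1_E x)%:E = \int[leb]_x (\1_E x * g x)%R%:E)%E.
Proof.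
move=> mE; rewrite integral_indic// setIT nuE// integral_mkcond.
apply: eq_integral => x _; rewrite patchE indicE.
by case: ifPn => xE; rewrite ?mul1r ?mul0r.
Qed.

Let integral_density_nnsfun (f : {nnsfun T >-> R}) :
  (\int[nu]_x (f x)%:E = \int[leb]_x (f x * g x)%R%:E)%E.
Proof.
under [LHS]eq_integral do rewrite fimfunE -fsumEFin//.
rewrite [LHS]ge0_integral_fsum//; last 2 first.
  - by move=> r; exact/measurable_EFinP/measurableT_comp.
  - by move=> n x _; rewrite EFinM nnfun_muleindic_ge0.
under [RHS]eq_integral.
  move=> x xD; rewrite EFinM fimfunE -fsumEFin// muleC ge0_mule_fsumr; last first.
    by move=> r; rewrite EFinM nnfun_muleindic_ge0.
  over.
rewrite [RHS]ge0_integral_fsum//; last 2 first.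
  - move=> r; apply/measurable_EFinP; apply: measurable_funM => //.
    exact: measurable_funM.
  - move=> n x _; rewrite mule_ge0//; first by rewrite lee_fin.
    by rewrite EFinM nnfun_muleindic_ge0.
apply: eq_fsbigr => r _.
rewrite integralZl_indic_nnsfun//= integral_density_indic//.
have [r0|r0] := leP 0 r.
  rewrite -ge0_integralZl//.
  - by apply: eq_integral => x _; rewrite -!EFinM; congr EFin; ring.
  - by apply/measurable_EFinP; exact: measurable_funM.
  - by move=> x _; apply: ge0_mule_fun => y; rewrite indicE.
have e x : x \notin (f @^-1` [set r] : set T).
  by apply/negP; rewrite inE/= => fx; have : 0 <= f x by []; rewrite fx leNgt r0.
rewrite [X in (_ * X)%E]integral0_eq ?mule0; last first.
  by move=> x _; rewrite indicE (negPf (e x)) mul0r.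
apply/esym/integral0_eq => x _.
by rewrite indicE (negPf (e x)) mulr0 mule0.
Qed.

Lemma ge0_integral_density (f : R -> R) : measurable_fun setT f ->
  (forall x, 0 <= f x) ->
  (\int[nu]_x (f x)%:E = \int[leb]_x (f x * g x)%R%:E)%E.
Proof.
move=> mf f0; have mf' : measurable_fun setT (EFin \o f) by exact/measurable_EFinP.
pose f_ := nnsfun_approx (@measurableT _ T) mf'.
transitivity (lim (\int[nu]_x (f_ n x)%:E @[n --> \oo])%E).
  rewrite -monotone_convergence//=.
  - apply: eq_integral => x _; apply/esym/cvg_lim => //=.
    by apply: cvg_nnsfun_approx => // y _ /=; rewrite lee_fin.
  - by move=> n; exact/measurable_EFinP/measurable_funTS.
  - by move=> n ? _; rewrite lee_fin.
  - by move=> ? _ ? ? mn; rewrite lee_fin; exact/lefP/nd_nnsfun_approx.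
transitivity (lim (\int[leb]_x (f_ n x * g x)%R%:E @[n --> \oo])%E).
  by apply: congr_lim; apply/funext => n /=; exact: integral_density_nnsfun.
rewrite -monotone_convergence//=.
- apply: eq_integral => x _; apply/cvg_lim => //=.
  rewrite EFinM; under eq_fun do rewrite EFinM.
  apply: cvgeZr => //.
  by apply: cvg_nnsfun_approx => // y _ /=; rewrite lee_fin.
- by move=> n; apply/measurable_EFinP; exact: measurable_funM.
- by move=> n x _; exact: ge0_mule_fun.
- move=> x _ m n mn; rewrite lee_fin ler_wpM2r//; exact/lefP/nd_nnsfun_approx.
Qed.

Lemma integral_density (f : R -> R) : measurable_fun setT f ->
  (\int[nu]_x (f x)%:E = \int[leb]_x (f x * g x)%R%:E)%E.
Proof.
move=> mf; rewrite integralE [RHS]integralE.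
have pE (u : R -> R) x : ((fun x => (u x)%:E) ^\+)%E x = (Num.max (u x) 0)%:E.
  by rewrite funeposE EFin_max.
have nE (u : R -> R) x : ((fun x => (u x)%:E) ^\-)%E x = (Num.max (- u x) 0)%:E.
  by rewrite funenegE EFin_max EFinN.
under eq_integral do rewrite pE.
under [X in (_ - X)%E]eq_integral do rewrite nE.
under [X in (_ = X - _)%E]eq_integral do rewrite pE.
under [X in (_ = _ - X)%E]eq_integral do rewrite nE.
rewrite !ge0_integral_density//.
- congr (_ - _)%E; apply: eq_integral => x _; congr EFin.
    by rewrite -[in RHS](mul0r (g x)) maxr_pMl.
  by rewrite -mulNr -[in RHS](mul0r (g x)) maxr_pMl.
- by apply: measurable_maxr => //; exact: measurableT_comp.
- by move=> x; rewrite le_max lexx orbT.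
- exact: measurable_maxr.
- by move=> x; rewrite le_max lexx orbT.
Qed.

End density.

(** * The semicircular law and Chebyshev polynomials *)

Section semicircle.
Variable R : realType.
Local Notation leb := (@lebesgue_measure R).
Implicit Types (f g : R -> R) (p : {poly R}) (t : R).

Lemma integrable_continuous_itv f (a b : R) : continuous f ->
  leb.-integrable `[a, b] (EFin \o f).
Proof.
move=> cf; apply: continuous_compact_integrable; first exact: segment_compact.
exact: continuous_subspaceT.
Qed.

Lemma integral_itv_Rintegral f (a b : R) : continuous f ->
  (\int[leb]_(x in `[a, b]) (f x)%:E = (\int[leb]_(x in `[a, b]) f x)%R%:E)%E.
Proof.
move=> cf; rewrite /Rintegral fineK//.
have := @integrable_continuous_itv f a b cf.
by apply: integrable_fin_num; exact: measurable_itv.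
Qed.

Lemma Rintegral_is_derive (F f : R -> R) (a b : R) : a < b ->
  (forall x : R, is_derive x 1 F (f x)) -> continuous f ->
  \int[leb]_(x in `[a, b]) f x = F b - F a.
Proof. by move=> ab dF cf; rewrite /Rintegral (integral_is_derive ab dF cf). Qed.

Lemma continuous_horner_comp p f : continuous f -> continuous (fun x => p.[f x]).
Proof.
move=> cf x; apply: (@continuous_comp _ _ _ f (fun y => p.[y])); first exact: cf.
exact: continuous_horner.
Qed.

Lemma continuous_sin2 : continuous (fun x : R => sin x ^+ 2).
Proof.
move=> x; apply: (@continuous_comp _ _ _ (@sin R) (fun y => y ^+ 2)).
  exact: continuous_sin.
exact: exprn_continuous.
Qed.

Lemma continuous_affine_cos (c r : R) : continuous (fun x : R => c + r * cos x).
Proof.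
move=> x; apply: cvgD; first exact: cvg_cst.
by apply: cvgM; [exact: cvg_cst|exact: continuous_cos].
Qed.

Lemma continuous_trig p (c r : R) :
  continuous (fun x : R => p.[c + r * cos x] * sin x ^+ 2).
Proof.
move=> x; apply: cvgM; last exact: continuous_sin2.
exact: (@continuous_horner_comp p _ (@continuous_affine_cos c r) x).
Qed.

(* Integral of p (c + r y) with respect to the semicircular law of variance 1. *)
Definition semicircle (c r : R) p : R :=
  2 / pi * \int[leb]_(x in `[0, pi]) (p.[c + r * (2 * cos x)] * sin x ^+ 2).

Lemma semicircleE c r p : semicircle c r p =
  2 / pi * \int[leb]_(x in `[0, pi]) (p.[c + (r * 2) * cos x] * sin x ^+ 2).
Proof.
by rewrite /semicircle; congr (_ * _); apply: eq_Rintegral => x _; rewrite mulrA.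
Qed.

Lemma semicircleP c r a p1 p2 :
  semicircle c r (a *: p1 + p2) = a * semicircle c r p1 + semicircle c r p2.
Proof.
rewrite !semicircleE mulrCA -mulrDr; congr (_ * _).
rewrite -RintegralZl//=; last by apply: integrable_continuous_itv; exact: continuous_trig.
rewrite -RintegralD//=.
- by apply: eq_Rintegral => x _; rewrite hornerD hornerZ; ring.
- apply: integrable_continuous_itv => x; apply: cvgM; first exact: cvg_cst.
  exact: continuous_trig.
- by apply: integrable_continuous_itv; exact: continuous_trig.
Qed.

(** The Chebyshev polynomial of the second kind evaluated at X / 2, hence monic; this is the case of
    a single repeated letter in [cheb]. *)
Fixpoint chebU n : {poly R} :=
  if n is n'.+1 then
    'X * chebU n' - (if n' is n''.+1 then chebU n'' else 0)
  else 1.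

Lemma chebU_cos n (x : R) : (chebU n).[2 * cos x] * sin x = sin (n.+1%:R * x).
Proof.
have [k] := ubnP n; elim: k n => // k IH [|[|n]]; rewrite ltnS => nk.
- by rewrite /= hornerC !mul1r.
- by rewrite /= subr0 mulr1 hornerX [in RHS]mulr_natl sin_mulr2n mulr2n; ring.
- have -> : chebU n.+2 = 'X * chebU n.+1 - chebU n by [].
  rewrite hornerD hornerN hornerM hornerX mulrBl -mulrA IH// IH; last exact: ltnW.
  have -> : n.+3%:R * x = n.+2%:R * x + x by rewrite -[in LHS]natr1; ring.
  have -> : n.+1%:R * x = n.+2%:R * x - x by rewrite -[in RHS]natr1; ring.
  by rewrite !sinD sinN cosN; ring.
Qed.

Lemma Rintegral_cosM n : \int[leb]_(x in `[0, pi]) cos (n%:R * x) = (n == 0%N)%:R * pi.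
Proof.
have cc (k : R) : continuous (fun x : R => cos (k * x)).
  move=> x; apply: continuous_comp; last exact: continuous_cos.
  by apply: cvgM; [exact: cvg_cst|exact: cvg_id].
case: n => [|n].
  rewrite mul1r -[RHS]subr0 -[RHS]/(id pi - id 0).
  apply: Rintegral_is_derive; rewrite ?pi_gt0// => x.
  by rewrite mul0r cos0; exact: is_derive_id.
transitivity (sin (n.+1%:R * pi) / n.+1%:R - sin (n.+1%:R * 0) / n.+1%:R : R).
  apply: (@Rintegral_is_derive (fun x => sin (n.+1%:R * x) / n.+1%:R)).
  - exact: pi_gt0.
  - move=> x; apply: is_derive_eq.
    by rewrite !scaler0 add0r /GRing.scale/= mulr1 mulrCA mulVf ?mulr1.
  - exact: cc.
have sin0pi k : sin (k%:R * pi) = 0 :> R.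
  elim: k => [|k IH]; first by rewrite mul0r sin0.
  by rewrite -natr1 mulrDl mul1r sinDpi IH oppr0.
by rewrite sin0pi mulr0 sin0 !mul0r subr0.
Qed.

Lemma semicircle_chebU n : semicircle 0 1 (chebU n) = (n == 0%N)%:R.
Proof.
rewrite /semicircle.
have -> : \int[leb]_(x in `[0, pi]) ((chebU n).[0 + 1 * (2 * cos x)] * sin x ^+ 2) =
    \int[leb]_(x in `[0, pi]) (2^-1 * cos (n%:R * x) - 2^-1 * cos (n.+2%:R * x)).
  apply: eq_Rintegral => x _; rewrite add0r mul1r expr2 mulrA chebU_cos.
  have -> : n%:R * x = n.+1%:R * x - x by rewrite -natr1; ring.
  have -> : n.+2%:R * x = n.+1%:R * x + x by rewrite -[in LHS]natr1; ring.
  by rewrite !cosD sinN cosN; field.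
have cc (k : nat) : continuous (fun x : R => 2^-1 * cos (k%:R * x)).
  move=> x; apply: cvgM; first exact: cvg_cst.
  apply: continuous_comp; last exact: continuous_cos.
  by apply: cvgM; [exact: cvg_cst|exact: cvg_id].
rewrite RintegralB//; try exact: integrable_continuous_itv.
rewrite !RintegralZl//; try (apply: integrable_continuous_itv => x;
  apply: continuous_comp; last exact: continuous_cos;
  by apply: cvgM; [exact: cvg_cst|exact: cvg_id]).
rewrite !Rintegral_cosM mul0r mulr0 subr0 mulrCA mulrA.
have : pi != 0 :> R by rewrite gt_eqF// pi_gt0.
by move=> pi0; rewrite !mulrA mulVf ?pnatr_eq0// mul1r mulrAC mulVf// mul1r.
Qed.

Lemma integral_semicircle_support (c rho : R) (h : R -> R) : 0 < rho ->
  {within `[c - 2 * rho, c + 2 * rho], continuous h} ->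
  (\int[leb]_x (if (c - 2 * rho < x < c + 2 * rho)%R then
     h x * Num.sqrt (4 * rho ^+ 2 - (x - c) ^+ 2) else 0)%R%:E =
   \int[leb]_(x in `[0%R, pi])
     (4 * rho ^+ 2 * (h (c + 2 * rho * cos x) * sin x ^+ 2))%R%:E)%E.
Proof.
move=> rho0 ch; rewrite -integral_semicircle_subst// [RHS]integral_mkcond.
apply: eq_integral => x _; rewrite patchE mem_setE in_itv/=.
have [/andP[x1 x2]|] := ifPn; first by rewrite !ltW.
case: ifPn => // /andP[x1 x2]; rewrite negb_and -!leNgt => x3.
(* Only the two endpoints are left, where the square root vanishes: the open and the closed support
   agree pointwise. *)
rewrite (_ : 4 * rho ^+ 2 - (x - c) ^+ 2 = 0) ?sqrtr0 ?mulr0//.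
have [->|->] : x = c - 2 * rho \/ x = c + 2 * rho; [|ring|ring].
by case/orP: x3 => h3; [left|right]; apply/eqP; rewrite eq_le; apply/andP; split.
Qed.

Lemma moment_semicircular t m : 0 < t ->
  moment (semicircular t) m = semicircle 0 (Num.sqrt t) 'X^m.
Proof.
move=> t0; have st0 : 0 < Num.sqrt t by rewrite sqrtr_gt0.
rewrite /moment (integral_density (measurable_semicircular_pdf t)
  (@semicircular_pdf_ge0 _ t)) //.
pose h x : R := (2 * pi * t)^-1 * x ^+ m.
have ch : continuous h.
  by move=> x; apply: cvgM; [exact: cvg_cst|exact: exprn_continuous].
rewrite [X in fine X](_ : _ = (\int[leb]_x (if (0 - 2 * Num.sqrt t < x < 0 + 2 * Num.sqrt t)%R then
     h x * Num.sqrt (4 * Num.sqrt t ^+ 2 - (x - 0) ^+ 2) else 0)%R%:E)%E); last first.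
  apply: eq_integral => x _; congr EFin.
  rewrite /semicircular_pdf sub0r add0r subr0 ltr_norml sqr_sqrtr ?(ltW t0)//.
  by case: ifPn => _; rewrite ?mulr0// /h; ring.
rewrite integral_semicircle_support//; last exact: continuous_subspaceT.
rewrite semicircleE -RintegralZl//; last first.
  by apply: integrable_continuous_itv; exact: continuous_trig.
apply: eq_Rintegral => x _; rewrite /h hornerXn sqr_sqrtr ?(ltW t0)//.
rewrite add0r [Num.sqrt t * 2]mulrC add0r.
have t0' : t != 0 by rewrite gt_eqF.
have pi0 : pi != 0 :> R by rewrite gt_eqF// pi_gt0.
by move: (pi : R) pi0 => p pi0; field; rewrite pi0 t0'.
Qed.

End semicircle.

Section free_poisson_moments.
Variable R : realType.
Local Notation leb := (@lebesgue_measure R).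

(* The antiderivative comes from sin x ^+ 2 / D = (- D + 2 (1 + r ^+ 2) -
   (1 - r ^+ 2) ^+ 2 / D) / (4 r ^+ 2) with D = 1 + r ^+ 2 + 2 r cos x, and from
   the derivative (1 - r ^+ 2) / D of x - 2 atan (r sin x / (1 + r cos x)). *)
Lemma Rintegral_poisson_kernel (r : R) : 0 < r < 1 ->
  \int[leb]_(x in `[0, pi]) (sin x ^+ 2 / (1 + r ^+ 2 + 2 * r * cos x)) = pi / 2.
Proof.
move=> /andP[r0 r1].
have u0 (x : R) : 0 < 1 + r * cos x.
  have c1 : -1 <= cos x := cos_geN1 x.
  by have : r * -1 <= r * cos x; [rewrite ler_pM2l|lra].
have DE (x : R) : 1 + r ^+ 2 + 2 * r * cos x = (1 + r * cos x) ^+ 2 + (r * sin x) ^+ 2.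
  by rewrite !exprMn sin2cos2; ring.
have D0 (x : R) : 0 < 1 + r ^+ 2 + 2 * r * cos x.
  by rewrite DE ltr_pwDl ?exprn_gt0 ?sqr_ge0.
pose v x : R := r * sin x / (1 + r * cos x).
pose F x : R := (4 * r ^+ 2)^-1 * ((1 + r ^+ 2) * x - 2 * r * sin x -
  (1 - r ^+ 2) * (x - 2 * atan (v x))).
transitivity (F pi - F 0).
  apply: Rintegral_is_derive; first exact: pi_gt0.
    move=> x; have un0 : 1 + r * cos x != 0 by rewrite gt_eqF.
    have dv : is_derive x 1 v ((r * cos x + r ^+ 2) / (1 + r * cos x) ^+ 2).
      rewrite /v; apply: is_derive_eq; rewrite /GRing.scale/=.
      have -> : (r * cos x + r ^+ 2) = r * cos x * (1 + r * cos x) + (r * sin x) ^+ 2.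
        by rewrite exprMn sin2cos2; ring.
      by field.
    have datan : is_derive x 1 (fun x : R => atan (v x))
       ((1 + v x ^+ 2)^-1 * ((r * cos x + r ^+ 2) / (1 + r * cos x) ^+ 2)).
      exact: is_derive1_comp.
    apply: is_derive_eq.
    have Dn0 : 1 + r ^+ 2 + 2 * r * cos x != 0 by rewrite gt_eqF.
    have -> : (1 + v x ^+ 2)^-1 * ((r * cos x + r ^+ 2) / (1 + r * cos x) ^+ 2) =
        (r * cos x + r ^+ 2) / (1 + r ^+ 2 + 2 * r * cos x).
      have := Dn0; rewrite DE => Dn0'.
      by rewrite /v; field; rewrite Dn0' un0.
    have r20 : r != 0 by rewrite gt_eqF.
    transitivity ((4 * r ^+ 2)^-1 * ((1 + r ^+ 2) * 1 - 2 * r * cos x - (1 - r ^+ 2) *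
        (1 - 2 * ((r * cos x + r ^+ 2) / (1 + r ^+ 2 + 2 * r * cos x))))) => //.
    by rewrite sin2cos2; move: (cos x) Dn0 => k Dn0; field; rewrite Dn0 r20.
  move=> x; apply: cvgM; first exact: continuous_sin2.
  apply: cvgV; first by rewrite gt_eqF.
  exact: continuous_affine_cos.
rewrite /F /v sinpi sin0 !(mulr0, mul0r, atan0, subr0).
have r20 : r != 0 by rewrite gt_eqF.
by move: (pi : R) => p; field.
Qed.

(** Up to the factor pi / 2, this is the Cauchy transform at z of the semicircular law of variance
    rho^2. *)
Lemma Rintegral_shifted_kernel (rho z : R) : 0 < rho -> 2 * rho < z ->
  \int[leb]_(x in `[0, pi]) (sin x ^+ 2 / (z + 2 * rho * cos x)) =
  pi / 2 * ((z - Num.sqrt (z ^+ 2 - 4 * rho ^+ 2)) / (2 * rho ^+ 2)).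
Proof.
move=> rho0 z2; set d := Num.sqrt _.
have zz : 0 < z ^+ 2 - 4 * rho ^+ 2.
  rewrite (_ : _ - _ = (z - 2 * rho) * (z + 2 * rho)); last by ring.
  by apply: mulr_gt0; lra.
have d0 : 0 < d by rewrite sqrtr_gt0.
have dE : d ^+ 2 = z ^+ 2 - 4 * rho ^+ 2 by rewrite sqr_sqrtr// ltW.
have dz : d < z.
  by rewrite -(@ltr_pXn2r _ 2) ?nnegrE ?(ltW d0)//; [rewrite dE; nra|lra].
have zd : z - 2 * rho < d.
  by rewrite -(@ltr_pXn2r _ 2) ?nnegrE ?(ltW d0)//; [rewrite dE; nra|lra].
(* The root in ]0, 1[ of rho r^2 - z r + rho = 0, so that z + 2 rho cos x = (rho / r) (1 + r^2 + 2 r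
   cos x): the integral reduces to the Poisson kernel. *)
pose r := (z - d) / (2 * rho).
have r0 : 0 < r by rewrite divr_gt0 ?mulr_gt0 ?subr_gt0.
have r1 : r < 1 by rewrite ltr_pdivrMr ?mulr_gt0// mul1r; lra.
have rhon : rho != 0 by rewrite gt_eqF.
have rn : r != 0 by rewrite gt_eqF.
have zr : z = rho / r * (1 + r ^+ 2).
  apply: (mulIf rn); rewrite [RHS]mulrAC divfK// /r.
  have -> : rho * (1 + ((z - d) / (2 * rho)) ^+ 2) =
      (4 * rho ^+ 2 + (z - d) ^+ 2) / (4 * rho) by field.
  have -> : 4 * rho ^+ 2 = z ^+ 2 - d ^+ 2 by rewrite dE; ring.
  by field.
have -> : \int[leb]_(x in `[0, pi]) (sin x ^+ 2 / (z + 2 * rho * cos x)) =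
    \int[leb]_(x in `[0, pi]) (r / rho * (sin x ^+ 2 / (1 + r ^+ 2 + 2 * r * cos x))).
  apply: eq_Rintegral => x _.
  have -> : z + 2 * rho * cos x = rho / r * (1 + r ^+ 2 + 2 * r * cos x).
    by rewrite zr; field.
  by rewrite invfM invf_div mulrCA.
rewrite RintegralZl//; last first.
  apply: integrable_continuous_itv => x; apply: cvgM; first exact: continuous_sin2.
  apply: cvgV; last exact: continuous_affine_cos.
  have c1 : -1 <= cos x := cos_geN1 x.
  rewrite gt_eqF//; have : r * -1 <= r * cos x by rewrite ler_pM2l.
  have : 0 < (1 - r) ^+ 2 by rewrite exprn_gt0// subr_gt0.
  by nra.
rewrite Rintegral_poisson_kernel ?r0// /r mulrC.
by congr (_ * _); field.
Qed.

Variable lambda : R.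
Hypothesis lambda0 : 0 < lambda.
Local Notation rho := (Num.sqrt lambda).
Local Notation pdf := (free_poisson_pdf lambda).
Local Notation c := (1 + lambda).

Let rho0 : 0 < rho. Proof. by rewrite sqrtr_gt0. Qed.

Let rho2 : rho ^+ 2 = lambda. Proof. by rewrite sqr_sqrtr// ltW. Qed.

Let support_l : (1 - rho) ^+ 2 = c - 2 * rho. Proof. by rewrite sqrrB rho2; ring. Qed.

Let support_r : (1 + rho) ^+ 2 = c + 2 * rho. Proof. by rewrite sqrrD rho2; ring. Qed.

Let support_ge0 : 0 <= c - 2 * rho. Proof. by rewrite -support_l sqr_ge0. Qed.

(* x times the density of P(lambda) is lambda times a semicircular density. *)
Lemma integral_mul_free_poisson_pdf (h : R -> R) :
  {within `[c - 2 * rho, c + 2 * rho], continuous h} ->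
  (\int[leb]_x (x * h x * pdf x)%R%:E = \int[leb]_(x in `[0%R, pi])
     (lambda * (2 / pi) * (h (c + 2 * rho * cos x) * sin x ^+ 2))%R%:E)%E.
Proof.
move=> ch; pose k x : R := (2 * pi)^-1 * h x.
have ck : {within `[c - 2 * rho, c + 2 * rho], continuous k}.
  by move=> x; apply: cvgM; [exact: cvg_cst|exact: ch].
have pi0 : pi != 0 :> R by rewrite gt_eqF// pi_gt0.
transitivity (\int[leb]_x (if (c - 2 * rho < x < c + 2 * rho)%R then
     k x * Num.sqrt (4 * rho ^+ 2 - (x - c) ^+ 2) else 0)%R%:E)%E.
  apply: eq_integral => x _; congr EFin.
  rewrite /free_poisson_pdf support_l support_r; case: ifPn; rewrite ?mulr0//.
  move=> /andP[x0 _]; rewrite rho2 /k opprD addrA.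
  have xn : x != 0 by rewrite gt_eqF// (le_lt_trans support_ge0).
  by move: (pi : R) pi0 => p p0; field; rewrite xn p0.
rewrite integral_semicircle_support//.
apply: eq_integral => x _; congr EFin; rewrite /k rho2.
by move: (pi : R) pi0 => p p0; field.
Qed.

(** For lambda = 1 the support reaches 0 and the density is unbounded there. The factor x / (x + e),
    increasing to 1 as e decreases to 0, replaces 1 / x by a function continuous on the closed
    support. *)
Let mul_pdf_approx n (x : R) : 0 <= x / (x + n.+1%:R^-1) * pdf x.
Proof.
rewrite /free_poisson_pdf; case: ifPn => [/andP[]|]; last by rewrite mulr0.
rewrite support_l => /(le_lt_trans support_ge0) x0 _.
rewrite mulr_ge0// ?divr_ge0 ?addr_ge0 ?(ltW x0)//.
by rewrite mulr_ge0 ?sqrtr_ge0// invr_ge0 mulr_ge0 ?(ltW x0)// mulr_ge0// pi_ge0.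
Qed.

Let integral_pdf_approx n :
  (\int[leb]_x (x / (x + n.+1%:R^-1) * pdf x)%R%:E =
   ((c + n.+1%:R^-1 - Num.sqrt ((c + n.+1%:R^-1) ^+ 2 - 4 * lambda)) / 2)%:E)%E.
Proof.
set e := n.+1%:R^-1; have e0 : 0 < e by rewrite invr_gt0.
rewrite integral_mul_free_poisson_pdf; last first.
  apply: continuous_in_subspaceT => x; rewrite inE/= in_itv/= => /andP[x0 _].
  apply: cvgV; last by apply: cvgD; [exact: cvg_id|exact: cvg_cst].
  by rewrite gt_eqF// ltr_wpDl// (le_trans support_ge0).
have cD : continuous (fun x : R => sin x ^+ 2 / (c + e + 2 * rho * cos x)).
  move=> x; apply: cvgM; first exact: continuous_sin2.
  apply: cvgV; last exact: continuous_affine_cos.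
  have c1 : -1 <= cos x := cos_geN1 x.
  rewrite gt_eqF//; have : 2 * rho * -1 <= 2 * rho * cos x by rewrite ler_pM2l ?mulr_gt0.
  by have := support_ge0; lra.
have -> : (\int[leb]_(x in `[0%R, pi])
     (lambda * (2 / pi) * ((c + 2 * rho * cos x + e)^-1 * sin x ^+ 2))%R%:E)%E =
   (\int[leb]_(x in `[0%R, pi])
     (lambda * (2 / pi) * (sin x ^+ 2 / (c + e + 2 * rho * cos x)))%R%:E)%E.
  by apply: eq_integral => x _; congr EFin; rewrite [c + _ + e]addrAC; ring.
rewrite integral_itv_Rintegral; last first.
  by move=> x; apply: cvgM; [exact: cvg_cst|exact: cD].
rewrite RintegralZl//; last exact: integrable_continuous_itv.
rewrite Rintegral_shifted_kernel//; last by have := support_ge0; lra.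
rewrite rho2; congr EFin.
have pi0 : pi != 0 :> R by rewrite gt_eqF// pi_gt0.
have ln : lambda != 0 by rewrite gt_eqF.
by move: (pi : R) pi0 => p p0; field; rewrite ln p0.
Qed.

(** The regularized integrals are explicit and increase to (1 + lambda - |1 - lambda|) / 2, the
    minimum of 1 and lambda, which is the mass left over by the atom. *)
Lemma integral_free_poisson_pdf :
  (\int[leb]_x (pdf x)%:E = (1 - free_poisson_atom lambda)%:E)%E.
Proof.
have cvgh : n.+1%:R^-1 @[n --> \oo] --> (0 : R) by exact: (@cvg_harmonic R).
pose g n (x : R) := (x / (x + n.+1%:R^-1) * pdf x)%:E.
have mg n : measurable_fun setT (g n).
  apply/measurable_EFinP; apply: measurable_funM; last exact: measurable_free_poisson_pdf.
  apply: measurable_funM => //.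
  apply: (@measurableT_comp _ _ _ _ _ _ (@GRing.inv R)); first exact: Defs.measurable_inv.
  exact: measurable_funD.
have h1 : (\int[leb]_x g n x)%E @[n --> \oo] --> (\int[leb]_x (pdf x)%:E)%E.
  rewrite [X in _ --> X](_ : _ = \int[leb]_x limn (g ^~ x))%E.
    apply: cvg_monotone_convergence => //.
    - by move=> n x _; rewrite lee_fin mul_pdf_approx.
    - move=> x _ m n mn; rewrite lee_fin /free_poisson_pdf.
      case: ifPn => [/andP[+ _]|_]; last by rewrite !mulr0.
      rewrite support_l => /(le_lt_trans support_ge0) x0.
      rewrite ler_wpM2r//.
        by rewrite mulr_ge0 ?sqrtr_ge0// invr_ge0 mulr_ge0 ?(ltW x0)// mulr_ge0// pi_ge0.
      rewrite ler_wpM2l ?(ltW x0)// lef_pV2 ?posrE ?addr_gt0// lerD2l.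
      by rewrite lef_pV2 ?posrE// ler_nat.
  apply: eq_integral => x _; apply/esym/cvg_lim => //.
  apply: cvg_EFin; first exact: nearW.
  suff : x / (x + n.+1%:R^-1) * pdf x @[n --> \oo] --> pdf x by [].
  rewrite /free_poisson_pdf; case: ifPn => [/andP[+ _]|_]; last first.
    by under eq_fun do rewrite mulr0; exact: cvg_cst.
  rewrite support_l => /(le_lt_trans support_ge0) x0.
  rewrite -[X in _ --> X]mul1r; apply: cvgM; last exact: cvg_cst.
  rewrite -[X in _ --> X](@divff _ x) ?gt_eqF//; apply: cvgM; first exact: cvg_cst.
  apply: cvgV; first by rewrite gt_eqF.
  by rewrite -[X in _ --> X]addr0; apply: cvgD; [exact: cvg_cst|exact: cvgh].
have h2 : (\int[leb]_x g n x)%E @[n --> \oo] --> (1 - free_poisson_atom lambda)%:E.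
  rewrite /g; under eq_fun do rewrite integral_pdf_approx.
  apply: cvg_EFin; first exact: nearW.
  suff : (c + n.+1%:R^-1 - Num.sqrt ((c + n.+1%:R^-1) ^+ 2 - 4 * lambda)) / 2 @[n --> \oo] -->
    1 - free_poisson_atom lambda by [].
  have cz : c + n.+1%:R^-1 @[n --> \oo] --> (c : R).
    by rewrite -[X in _ --> X]addr0; apply: cvgD; [exact: cvg_cst|exact: cvgh].
  have -> : 1 - free_poisson_atom lambda = (c - Num.sqrt (c ^+ 2 - 4 * lambda)) / 2.
    rewrite (_ : c ^+ 2 - 4 * lambda = (1 - lambda) ^+ 2) ?sqrtr_sqr; last by ring.
    rewrite /free_poisson_atom; case: (leP lambda 1) => l1.
      by rewrite ger0_norm ?subr_ge0//; field.
    by rewrite ltr0_norm ?subr_lt0//; field.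
  apply: cvgM; last exact: cvg_cst.
  apply: cvgB => //; apply: continuous_cvg; first exact: sqrt_continuous.
  apply: cvgB; last exact: cvg_cst.
  by under eq_fun do rewrite expr2; rewrite expr2; exact: cvgM.
exact: (cvg_unique _ h1 h2).
Qed.

Lemma integrable_free_poisson_pdf (u : R -> R) : continuous u ->
  leb.-integrable setT (EFin \o (fun x => u x * pdf x)).
Proof.
move=> cu.
have mu : measurable_fun setT u by exact: continuous_measurable_fun.
have mpdf : measurable_fun setT pdf := measurable_free_poisson_pdf lambda.
have ipdf : leb.-integrable setT (EFin \o pdf).
  apply/integrableP; split; first exact/measurable_EFinP.
  under eq_integral do rewrite /= ger0_norm ?free_poisson_pdf_ge0//.
  by rewrite integral_free_poisson_pdf ltry.
have [y _ uy] : exists2 y, y \in `[c - 2 * rho, c + 2 * rho] &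
    forall t, t \in `[c - 2 * rho, c + 2 * rho] -> `|u t| <= `|u y|.
  apply: EVT_max; first by have := rho0; lra.
  apply: continuous_subspaceT => x.
  by apply: continuous_comp; [exact: cu|exact: norm_continuous].
apply: (le_integrable _ _ _ (integrableZl _ `|u y| ipdf)) => //.
  by apply/measurable_EFinP; exact: measurable_funM.
move=> x _; rewrite /= lee_fin !normrM normr_id.
have [-> | p0] := eqVneq (pdf x) 0; first by rewrite normr0 !mulr0.
rewrite ler_wpM2r// uy//.
move: p0; rewrite /free_poisson_pdf support_l support_r; case: ifPn; last by rewrite eqxx.
by rewrite in_itv/= => /andP[/ltW -> /ltW ->].
Qed.

Lemma ge0_integral_centered_free_poisson (h : R -> R) : continuous h ->
  (forall x, 0 <= h x) ->
  (\int[centered_free_poisson lambda]_x (h x)%:E = (free_poisson_atom lambda *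
    h (- lambda) + \int[leb]_x (h (x - lambda) * pdf x))%R%:E)%E.
Proof.
move=> ch h0; have mh : measurable_fun setT h by exact: continuous_measurable_fun.
have cs : continuous (fun x : R => h (x - lambda)).
  move=> x; apply: (@continuous_comp _ _ _ (fun x => x - lambda) h); last exact: ch.
  by apply: cvgB; [exact: cvg_id|exact: cvg_cst].
have ms : measurable_fun setT (fun x : R => h (x - lambda)).
  exact: continuous_measurable_fun.
have mE : measurable_fun setT (fun x : measurableTypeR R => (h (x - lambda))%:E).
  exact/measurable_EFinP.
rewrite /centered_free_poisson ge0_integral_pushforward//; last first.
- by move=> x _; rewrite lee_fin.
- exact/measurable_EFinP.
- exact: measurable_funB.
rewrite preimage_setT /= ge0_integral_measure_add//; last first.
  by move=> x _; rewrite /= lee_fin.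
rewrite ge0_integral_mscale//; last by move=> x _; rewrite lee_fin.
rewrite integral_dirac//.
rewrite diracT mul1e /= sub0r.
rewrite (ge0_integral_density (measurable_free_poisson_pdf lambda)
  (@free_poisson_pdf_ge0 _ lambda))//.
rewrite EFinD EFinM; congr (_ + _)%E; rewrite /Rintegral fineK//.
by apply: integrable_fin_num => //; exact: integrable_free_poisson_pdf.
Qed.

Lemma integral_centered_free_poisson (h : R -> R) : continuous h ->
  (\int[centered_free_poisson lambda]_x (h x)%:E = (free_poisson_atom lambda *
    h (- lambda) + \int[leb]_x (h (x - lambda) * pdf x))%R%:E)%E.
Proof.
move=> ch; rewrite integralE; first exact: measurable_funB.
(* The positive and negative parts of h, written through the absolute value because the nonnegative
   case requires continuous functions. *)
move=> mphi; pose hp x := 2^-1 * (`|h x| + h x); pose hn x := 2^-1 * (`|h x| - h x).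
have cabs : continuous (fun x : R => `|h x|).
  by move=> x; apply: continuous_comp; [exact: ch|exact: norm_continuous].
have cp : continuous hp.
  by move=> x; apply: cvgM; [exact: cvg_cst|apply: cvgD; [exact: cabs|exact: ch]].
have cn : continuous hn.
  by move=> x; apply: cvgM; [exact: cvg_cst|apply: cvgB; [exact: cabs|exact: ch]].
have hE x : h x = hp x - hn x by rewrite /hp /hn; field.
have maxp x : Num.max (h x) 0 = hp x.
  by rewrite /hp; case: (leP 0 (h x)) => hx; [rewrite ger0_norm//|rewrite ltr0_norm//]; field.
have maxn x : Num.max (- h x) 0 = hn x.
  rewrite /hn; have [hx|hx] := leP 0 (h x).
    by rewrite max_r ?oppr_le0// ger0_norm//; field.
  by rewrite max_l ?oppr_ge0 ?ltW// ltr0_norm//; field.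
transitivity (\int[centered_free_poisson lambda]_x (hp x)%:E -
    \int[centered_free_poisson lambda]_x (hn x)%:E)%E.
  congr (_ - _)%E; congr (integral _ _ _); apply/funext => x.
    by rewrite funeposE -EFin_max maxp.
  by rewrite funenegE -EFinN -EFin_max maxn.
rewrite !ge0_integral_centered_free_poisson//; last 2 first.
- by move=> x; rewrite -maxn le_max lexx orbT.
- by move=> x; rewrite -maxp le_max lexx orbT.
rewrite -EFinB; congr EFin.
have shift (k : R -> R) : continuous k -> continuous (fun x : R => k (x - lambda)).
  move=> ck x; apply: (@continuous_comp _ _ _ (fun x => x - lambda) k); last exact: ck.
  by apply: cvgB; [exact: cvg_id|exact: cvg_cst].
have -> : \int[leb]_x (h (x - lambda) * pdf x) =
   \int[leb]_x (hp (x - lambda) * pdf x) - \int[leb]_x (hn (x - lambda) * pdf x).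
  rewrite -RintegralB//; try by apply: integrable_free_poisson_pdf; exact: shift.
  by apply: eq_Rintegral => x _; rewrite hE mulrBl.
by rewrite hE; ring.
Qed.

Let mean (p : {poly R}) : R :=
  free_poisson_atom lambda * p.[0] + \int[leb]_x (p.[x] * pdf x).

Let meanP a p1 p2 : mean (a *: p1 + p2) = a * mean p1 + mean p2.
Proof.
have ip (p : {poly R}) : leb.-integrable setT (EFin \o (fun x => p.[x] * pdf x)).
  by apply: integrable_free_poisson_pdf; exact: continuous_horner.
rewrite /mean (_ : \int[leb]_x ((a *: p1 + p2).[x] * pdf x) =
  a * (\int[leb]_x (p1.[x] * pdf x)) + \int[leb]_x (p2.[x] * pdf x)).
  by rewrite hornerD hornerZ; ring.
rewrite -RintegralZl// -RintegralD//.
  by apply: eq_Rintegral => x _; rewrite hornerD hornerZ; ring.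
rewrite (_ : EFin \o _ = EFin \o (fun x => (a *: p1).[x] * pdf x)) ?ip//.
by apply/funext => x /=; rewrite hornerZ mulrA.
Qed.

(** The factor X vanishes at the atom and cancels the 1 / x of the density, leaving lambda times the
    semicircular law of centre 1 + lambda and variance lambda. *)
Let mean_const_mulX a p : mean (a%:P + 'X * p) = a + lambda * semicircle c rho p.
Proof.
have mean1 : mean 1 = 1.
  rewrite /mean hornerC mulr1.
  have -> : \int[leb]_x (1.[x] * pdf x) = 1 - free_poisson_atom lambda.
    rewrite /Rintegral; under eq_integral do rewrite hornerC mul1r.
    by rewrite integral_free_poisson_pdf.
  by rewrite addrC subrK.
rewrite -[a%:P]mulr1 mul_polyC meanP mean1 mulr1; congr (_ + _).
rewrite /mean hornerM hornerX mul0r mulr0 add0r semicircleE mulrA.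
rewrite -RintegralZl//; last by apply: integrable_continuous_itv; exact: continuous_trig.
rewrite /Rintegral; under eq_integral do rewrite hornerM hornerX.
rewrite integral_mul_free_poisson_pdf; last first.
  by apply: continuous_subspaceT; exact: continuous_horner.
by congr fine; apply: eq_integral => x _; rewrite [rho * 2]mulrC.
Qed.

Let meanD p1 p2 : mean (p1 + p2) = mean p1 + mean p2.
Proof. by rewrite -[p1]scale1r meanP mul1r scale1r. Qed.

(** The monic orthogonal polynomials of the semicircular law of centre 1 + lambda and variance
    lambda. *)
Fixpoint shifted_cheb n : {poly R} :=
  if n is n'.+1 then ('X - c%:P) * shifted_cheb n' -
    (if n' is n''.+1 then lambda *: shifted_cheb n'' else 0)
  else 1.

(** The quotient of [poisson_poly n] by X, the remainder being (- lambda)^n. *)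
Fixpoint poisson_quotient n : {poly R} :=
  if n is n'.+1 then shifted_cheb n' - lambda *: poisson_quotient n' else 0.

(** The polynomials P_n behind [jacobi_moment], evaluated at X - lambda: they are the orthogonal
    polynomials of P(lambda) before centering. *)
Fixpoint poisson_poly n : {poly R} :=
  if n is n'.+1 then
    if n' is n''.+1 then
      ('X - lambda%:P) * poisson_poly n' - poisson_poly n' - lambda *: poisson_poly n''
    else 'X - lambda%:P
  else 1.

Let shifted_chebE n z : (shifted_cheb n).[c + rho * z] = rho ^+ n * (chebU R n).[z].
Proof.
have [k] := ubnP n; elim: k n => // k IH [|[|n]]; rewrite ltnS => nk.
- by rewrite /= !hornerC mulr1.
- rewrite /= !subr0 !mulr1 !hornerE; ring.
- have -> : shifted_cheb n.+2 = ('X - c%:P) * shifted_cheb n.+1 -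
    lambda *: shifted_cheb n by [].
  have -> : chebU R n.+2 = 'X * chebU R n.+1 - chebU R n by [].
  rewrite hornerD hornerN hornerM hornerZ IH// IH; last exact: ltnW.
  have -> : lambda * (rho ^+ n * (chebU R n).[z]) = rho * rho * (rho ^+ n * (chebU R n).[z]).
    by rewrite -expr2 rho2.
  have -> : ('X - c%:P).[c + rho * z] = rho * z by rewrite !hornerE; ring.
  have -> : ('X * chebU R n.+1 - chebU R n).[z] = z * (chebU R n.+1).[z] - (chebU R n).[z].
    by rewrite hornerD hornerN hornerM hornerX.
  by move: (chebU R n.+1).[z] (chebU R n).[z] => u1 u0; rewrite !exprS; ring.
Qed.

Let semicircle_shifted_cheb n : semicircle c rho (shifted_cheb n) = (n == 0%N)%:R.
Proof.
transitivity (rho ^+ n * semicircle 0 1 (chebU R n)).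
  rewrite /semicircle mulrCA; congr (_ * _).
  rewrite -RintegralZl//; last first.
    rewrite (_ : _ \o _ = EFin \o (fun x => (chebU R n).[0 + 2 * cos x] * sin x ^+ 2)).
      by apply: integrable_continuous_itv; exact: continuous_trig.
    by apply/funext => x /=; rewrite mul1r.
  by apply: eq_Rintegral => x _; rewrite shifted_chebE add0r mul1r -mulrA.
by rewrite semicircle_chebU; case: n => [|n]; rewrite ?mulr1 ?mulr0.
Qed.

Let semicircle0 : semicircle c rho 0 = 0.
Proof.
have := semicircleP c rho 1 0 0; rewrite scaler0 addr0 mul1r => e.
by apply: (addrI (semicircle c rho 0)); rewrite addr0 -e.
Qed.

Let semicircle_poisson_quotient n :
  semicircle c rho (poisson_quotient n.+1) = (- lambda) ^+ n.
Proof.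
elim: n => [|n IH].
  by rewrite /= scaler0 subr0 -[LHS]/(semicircle c rho (shifted_cheb 0)) semicircle_shifted_cheb.
rewrite -[poisson_quotient n.+2]/(shifted_cheb n.+1 - lambda *: poisson_quotient n.+1).
by rewrite [_ - lambda *: _]addrC -scaleNr semicircleP IH semicircle_shifted_cheb addr0 exprS.
Qed.

Let poisson_quotient_rec n :
  ('X - c%:P) * poisson_quotient n.+1 - lambda *: poisson_quotient n +
    ((- lambda) ^+ n.+1)%:P = poisson_quotient n.+2.
Proof.
elim: n => [|n IH].
  by rewrite /= expr1 polyCN !scaler0 !subr0 !mulr1 alg_polyC.
have -> : poisson_quotient n.+3 = ('X - c%:P) * shifted_cheb n.+1 -
   lambda *: shifted_cheb n - lambda *: poisson_quotient n.+2 by [].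
rewrite -{2}IH.
have -> : poisson_quotient n.+2 = shifted_cheb n.+1 - lambda *: poisson_quotient n.+1 by [].
have -> : poisson_quotient n.+1 = shifted_cheb n - lambda *: poisson_quotient n by [].
rewrite -!mul_polyC [(- lambda) ^+ n.+2]exprS polyCM polyCN; ring.
Qed.

Let poisson_polyE n : poisson_poly n = ((- lambda) ^+ n)%:P + 'X * poisson_quotient n.
Proof.
have [k] := ubnP n; elim: k n => // k IH [|[|n]]; rewrite ltnS => nk.
- by rewrite /= mulr0 addr0.
- by rewrite /= scaler0 subr0 mulr1 expr1 polyCN addrC.
- have -> : poisson_poly n.+2 = ('X - lambda%:P) * poisson_poly n.+1 -
    poisson_poly n.+1 - lambda *: poisson_poly n by [].
  rewrite IH// IH; last exact: ltnW.
  rewrite -poisson_quotient_rec -!mul_polyC !exprS !polyCM !polyCN polyCD; ring.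
Qed.

(** For n >= 1 the remainder contributes (- lambda)^n and the quotient contributes lambda (-
    lambda)^(n-1); the two cancel. *)
Let mean_poisson_poly n : mean (poisson_poly n) = (n == 0%N)%:R.
Proof.
rewrite poisson_polyE mean_const_mulX; case: n => [|n].
  by rewrite semicircle0 mulr0 addr0 expr0.
by rewrite semicircle_poisson_quotient exprS mulNr addNr.
Qed.

(** The integrals of (x - lambda)^m P_n satisfy the recursion that defines [jacobi_moment]; the
    vanishing means of the P_n supply its initial values at m = 0. *)
Lemma moment_centered_free_poisson m :
  moment (centered_free_poisson lambda) m = jacobi_moment lambda m 0.
Proof.
have mX n : mean (('X - lambda%:P) ^+ m * poisson_poly n) = jacobi_moment lambda m n.
  elim: m n => [|m IH] n; first by rewrite expr0 mul1r mean_poisson_poly.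
  rewrite exprSr -mulrA; case: n => [|n]; first by
    rewrite mulr1 -[RHS]/(jacobi_moment lambda m 1) -IH.
  have -> : ('X - lambda%:P) * poisson_poly n.+1 = lambda *: poisson_poly n +
      (poisson_poly n.+2 + poisson_poly n.+1).
    have -> : poisson_poly n.+2 = ('X - lambda%:P) * poisson_poly n.+1 -
      poisson_poly n.+1 - lambda *: poisson_poly n by [].
    rewrite -mul_polyC; ring.
  rewrite -[RHS]/(jacobi_moment lambda m n.+2 + jacobi_moment lambda m n.+1 +
    lambda * jacobi_moment lambda m n) -!IH.
  move: (poisson_poly n.+2) (poisson_poly n.+1) (poisson_poly n) => a b d.
  by rewrite [_ * (_ *: d + _)]mulrDr -scalerAr meanP [_ * (a + b)]mulrDr meanD addrC.
rewrite -mX mulr1 /moment.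
rewrite (integral_centered_free_poisson (h := fun x => x ^+ m)); last exact: exprn_continuous.
rewrite /= /mean; congr (_ * _ + _).
  by rewrite horner_exp !hornerE.
by apply: eq_Rintegral => x _; rewrite horner_exp !hornerE.
Qed.

End free_poisson_moments.

(** * Increments of free Brownian motion *)

Section bounded_operators.
Variables (R : realType) (H : hilbert_space R).
Implicit Types (X Y T : H -> H) (B : set (H -> H)).

Lemma innerPl a (u v w : H) : inner H (a *: u + v) w = a * inner H u w + inner H v w.
Proof. exact: linearPl. Qed.

Lemma innerPr a (u v w : H) :
  inner H w (a *: u + v) = Num.conj a * inner H w u + inner H w v.
Proof. exact: linearPr. Qed.

Lemma inner_conj (u v : H) : inner H u v = Num.conj (inner H v u).
Proof. by rewrite hermC expr0 mul1r. Qed.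

Lemma innerBr (u v w : H) : inner H w (u - v) = inner H w u - inner H w v.
Proof. exact: linearBr. Qed.

Lemma inner_inj (u v : H) : (forall w, inner H w u = inner H w v) -> u = v.
Proof.
move=> h; apply/eqP; rewrite -subr_eq0 -normr_eq0 -sqrf_eq0.
by rewrite inner_norm innerBr h subrr.
Qed.

Lemma is_adjoint_uniq X Y Y' : is_adjoint X Y -> is_adjoint X Y' -> Y = Y'.
Proof.
move=> XY XY'; apply/funext => v; apply: inner_inj => u.
by rewrite -XY -XY'.
Qed.

Lemma adjointE X Y : is_adjoint X Y -> adjoint X = Y.
Proof. by move=> XY; apply: (@is_adjoint_uniq X) => //; apply: (xgetPex 0); exists Y. Qed.

Lemma is_adjoint_sym X Y : is_adjoint X Y -> is_adjoint Y X.
Proof. by move=> XY u v; rewrite inner_conj -XY -inner_conj. Qed.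

Lemma is_adjoint_comp X X' Y Y' : is_adjoint X X' -> is_adjoint Y Y' ->
  is_adjoint (X \o Y) (Y' \o X').
Proof. by move=> XX YY u v; rewrite /= XX YY. Qed.

Lemma is_adjointP a X X' Y Y' : is_adjoint X X' -> is_adjoint Y Y' ->
  is_adjoint (a *: X + Y) (Num.conj a *: X' + Y').
Proof.
move=> XX YY u v; rewrite !fctE innerPl innerPr conjCK XX YY //.
Qed.

Lemma bounded_operator_ge0 X : bounded_operator X ->
  exists2 M : R[i], 0 <= M & forall x : H, `|X x| <= M * `|x|.
Proof.
case=> _ [M XM]; exists `|M| => [//|x].
rewrite -[in leRHS](normr_id x) -normrM ger0_norm//.
exact: le_trans (XM x).
Qed.

Lemma bounded_operatorP a X Y : bounded_operator X -> bounded_operator Y ->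
  bounded_operator (a *: X + Y).
Proof.
move=> bX bY; split.
  move=> b u v; rewrite !fctE (proj1 bX) (proj1 bY) !scalerDr !scalerA mulrC.
  by rewrite addrACA.
have [[M _ XM] [N _ YN]] := (bounded_operator_ge0 bX, bounded_operator_ge0 bY).
exists (`|a| * M + N) => x; rewrite fctE (le_trans (ler_normD _ _))// mulrDl lerD//.
by rewrite normrZ -mulrA ler_wpM2l.
Qed.

Lemma bounded_operator_comp X Y : bounded_operator X -> bounded_operator Y ->
  bounded_operator (X \o Y).
Proof.
move=> bX bY; split; first by move=> b u v; rewrite /= (proj1 bY) (proj1 bX).
have [[M M0 XM] [N _ YN]] := (bounded_operator_ge0 bX, bounded_operator_ge0 bY).
by exists (M * N) => x; rewrite (le_trans (XM _))// -mulrA ler_wpM2l.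
Qed.

Lemma bounded_operator_id : bounded_operator (id : H -> H).
Proof. by split=> //; exists 1 => x; rewrite mul1r. Qed.

Lemma linear_commutant_closed B : (forall X, B X -> linear X) ->
  unital_subalgebra (commutant B).
Proof.
move=> lB; split.
- by split; [exact: bounded_operator_id|].
- move=> a X Y [bX cX] [bY cY]; split; first exact: bounded_operatorP.
  move=> T BT; apply/funext => x; rewrite /= !fctE (lB T BT).
  by rewrite -[X (T x)]/((X \o T) x) -[Y (T x)]/((Y \o T) x) cX// cY.
- move=> X Y [bX cX] [bY cY]; split; first exact: bounded_operator_comp.
  move=> T BT; apply/funext => x /=; rewrite -[Y (T x)]/((Y \o T) x) cY//=.
  by rewrite -[X (T _)]/((X \o T) _) cX.
Qed.

(** An algebra equal to its bicommutant is the commutant of a set of linear operators, and such a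
    commutant is a unital subalgebra. *)
Lemma von_neumann_closed B : von_neumann_algebra B -> unital_subalgebra B.
Proof. by case=> _ <-; apply: linear_commutant_closed => X [[]]. Qed.

Lemma von_neumann_bounded B X : von_neumann_algebra B -> B X -> bounded_operator X.
Proof. by case=> _ <- []. Qed.

Lemma von_neumann_adjoint B X : von_neumann_algebra B -> B X ->
  B (adjoint X) /\ is_adjoint X (adjoint X).
Proof. by case=> h _ /h[Y BY XY]; rewrite (adjointE XY). Qed.

End bounded_operators.

(** * The von Neumann algebra as an algebra with a tracial state *)

Section wstar_ring.
Variables (R : realType) (P : tracial_wstar_space R).
Local Notation H := (wstar_hilbert P).

Definition wstar_pred : {pred H -> H} := mem (wstar_algebra P : set (H -> H)).

Let closed : unital_subalgebra (wstar_algebra P).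
Proof. exact: von_neumann_closed (wstar_algebraP P). Qed.

Let wstar_submod : GRing.submod_closed wstar_pred.
Proof.
have [c1 cP cM] := closed; split.
  rewrite inE. have := cP (-1) _ _ c1 c1. by rewrite scaleN1r addNr.
by move=> a X Y; rewrite !inE; exact: cP.
Qed.

HB.instance Definition _ := GRing.isSubmodClosed.Build R[i] (H -> H)
  wstar_pred wstar_submod.

(** Operators on H do not form a ring under composition, since left multiplication by a nonlinear
    map is not additive. The elements of the algebra do, and the abstract theory of tracial states
    applies to this type. *)
Record wstar := WStar { wstar_val :> H -> H; wstar_valP : wstar_val \in wstar_pred }.

HB.instance Definition _ := [isSub for wstar_val].
HB.instance Definition _ := [Choice of wstar by <:].
HB.instance Definition _ := [SubChoice_isSubLmodule of wstar by <:].

Implicit Types x y z : wstar.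

Lemma wstarP x : wstar_algebra P x.
Proof. by have := wstar_valP x; rewrite inE. Qed.

Lemma wstar_linear x : linear x.
Proof. exact: (von_neumann_bounded (wstar_algebraP P) (wstarP x)).1. Qed.

Lemma wstar_valD x y : (x + y : wstar) = (x : H -> H) + (y : H -> H) :> (H -> H).
Proof. by []. Qed.

Lemma wstar_valZ a x : (a *: x : wstar) = a *: (x : H -> H) :> (H -> H).
Proof. by []. Qed.

Let comp_subproof x y : (x : H -> H) \o y \in wstar_pred.
Proof. by rewrite inE; have [_ _] := closed; apply; exact: wstarP. Qed.

Let id_subproof : (id : H -> H) \in wstar_pred.
Proof. by rewrite inE; have [] := closed. Qed.

Definition wstar_mul x y := WStar (comp_subproof x y).
Definition wstar_one := WStar id_subproof.

Let mulA : associative wstar_mul.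
Proof. by move=> x y z; apply: val_inj. Qed.

Let mul1 : left_id wstar_one wstar_mul.
Proof. by move=> x; apply: val_inj. Qed.

Let mulx1 : right_id wstar_one wstar_mul.
Proof. by move=> x; apply: val_inj. Qed.

Let mulDl : left_distributive wstar_mul +%R.
Proof. by move=> x y z; apply: val_inj. Qed.

Let mulDr : right_distributive wstar_mul +%R.
Proof.
move=> x y z; apply: val_inj; apply/funext => v /=.
by have := wstar_linear x 1 (y v) (z v); rewrite !scale1r.
Qed.

Let one_neq0 : wstar_one != 0.
Proof.
apply/eqP => /(congr1 (fun x => wstar_state P x)) /=; rewrite state_unital.
have z0 : wstar_algebra P (0 : H -> H) by have := wstarP 0.
have := @state_linear _ P (-1) 0 0 z0 z0.
rewrite scaler0 addr0 mulN1r addNr => -> /eqP.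
by rewrite oner_eq0.
Qed.

HB.instance Definition _ := GRing.Zmodule_isNzRing.Build wstar
  mulA mul1 mulx1 mulDl mulDr one_neq0.

Let scaleAl a x y : a *: (x * y) = (a *: x) * y.
Proof. by apply: val_inj. Qed.

HB.instance Definition _ := GRing.Lmodule_isLalgebra.Build R[i] wstar scaleAl.

Let scaleAr a x y : a *: (x * y) = x * (a *: y).
Proof.
apply: val_inj; apply/funext => v /=.
have x0 : x 0 = 0.
  by have := wstar_linear x (-1) 0 0; rewrite scaler0 addr0 scaleN1r addNr.
by have := wstar_linear x a (y v) 0; rewrite !addr0 x0 addr0 => ->.
Qed.

HB.instance Definition _ := GRing.Lalgebra_isAlgebra.Build R[i] wstar scaleAr.

Let adjoint_subproof x : adjoint (x : H -> H) \in wstar_pred.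
Proof. by rewrite inE; have [] := von_neumann_adjoint (wstar_algebraP P) (wstarP x). Qed.

Definition wstar_star x := WStar (adjoint_subproof x).

Lemma wstar_star_adjoint x : is_adjoint (x : H -> H) (wstar_star x).
Proof. by have [] := von_neumann_adjoint (wstar_algebraP P) (wstarP x). Qed.

Definition wstar_phi x : R[i] := wstar_state P x.

Lemma wstar_tracial_state : tracial_state wstar_star wstar_phi.
Proof.
split.
- move=> a x y; apply: val_inj; apply: adjointE.
  exact: (is_adjointP a (wstar_star_adjoint x) (wstar_star_adjoint y)).
- move=> x y; apply: val_inj; apply: adjointE.
  exact: (is_adjoint_comp (wstar_star_adjoint x) (wstar_star_adjoint y)).
- move=> x; apply: val_inj; apply: adjointE.
  exact: is_adjoint_sym (wstar_star_adjoint x).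
- by move=> a x y; apply: state_linear; exact: wstarP.
- exact: state_unital.
(* Positivity and faithfulness are given for X composed with its adjoint; traciality exchanges the
   two factors, here and in the next case. *)
- move=> x; rewrite /wstar_phi state_tracial; [|exact: wstarP|exact: wstarP].
  by apply: (state_positive (wstarP x)).
- move=> x; rewrite /wstar_phi state_tracial; [|exact: wstarP|exact: wstarP].
  by move=> h; apply: val_inj; exact: (state_faithful (wstarP x) h).
- by move=> x y; apply: state_tracial; exact: wstarP.
Qed.

Lemma wstar_valX x n : (x ^+ n : wstar) = iter n x :> (H -> H).
Proof. by elim: n => [//|n IH]; rewrite exprS /= IH. Qed.

End wstar_ring.

(** The maximal runs on which p is constant, the format in which freeness of two algebras is
    applied. Blocks are nonempty and of one colour, so [has p] is the colour of a block. *)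
Lemma alternating_runs (T : eqType) (p : pred T) (w : seq T) : w != [::] ->
  exists bs : seq (seq T), [/\ flatten bs = w, bs != [::],
    all (fun b => b != [::]) bs,
    all (fun b => all p b || all (predC p) b) bs &
    sorted (fun b1 b2 => has p b1 != has p b2) bs].
Proof.
elim: w => // i [_ _|j w IH _].
  exists [:: [:: i]]; split=> //=; first by rewrite !andbT orbN.
have [[|b bs] [fl bs0 ne co so]] := IH isT; first by [].
clear bs0; move: fl ne co => /= fl /= /andP[bn ne] /andP[bc co].
have hb : has p b = p j.
  case: b fl bn bc {so} => // k b [-> _] _ /= bc; case/orP: bc => /andP[kp].
    by rewrite kp.
  by rewrite all_predC => /negPf ->; rewrite orbF.
have [pij|pij] := eqVneq (p i) (p j).
  exists ((i :: b) :: bs); split=> //=; rewrite ?fl//.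
  - rewrite co andbT pij -hb; case/orP: bc => [bp|bp]; rewrite bp !andbT.
      by case: b bn bp {fl so hb} => //= k b _ /andP[-> _].
    by rewrite -all_predC bp orbT.
  - by case: bs so {fl ne co} => //= b' bs /andP[h ->]; rewrite andbT pij -hb orbb.
exists ([:: i] :: b :: bs); split=> //=; rewrite ?fl ?bn ?ne ?bc ?co//.
  by rewrite !andbT orbN.
by rewrite orbF hb pij.
Qed.

Section cheb_words.
Variables (R : rcfType) (A : algType R[i]) (I : finType) (x : I -> A).
Implicit Types (w : seq I).

(** The recursion of [cheb] compares neighbouring letters only, and across a junction of different
    letters it subtracts nothing. *)
Lemma cheb_cat w1 w2 : (forall i j u v, w1 = rcons u i -> w2 = j :: v -> i != j) ->
  cheb x (w1 ++ w2) = cheb x w1 * cheb x w2.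
Proof.
have [n] := ubnP (size w1); elim: n w1 => // n IH [|i w1] ; first by rewrite mul1r.
rewrite ltnS => w1n h.
have -> : cheb x (i :: w1) * cheb x w2 = x i * (cheb x w1 * cheb x w2) -
   (if w1 is k :: w1' then (i == k)%:R *: (cheb x w1' * cheb x w2) else 0).
  rewrite /= mulrBl mulrA; congr (_ - _).
  by case: w1 {w1n h} => [|k w1]; rewrite ?mul0r// -scalerAl.
rewrite -IH//; last first.
  by move=> k l u v e1 e2; apply: (h _ _ (i :: u) v) => //=; rewrite e1.
rewrite /=; congr (_ - _); case: w1 w1n h => [|k w1] /= w1n h.
  by case: w2 h {IH} => // j v /(_ i j [::] v erefl erefl)/negPf ->; rewrite scale0r.
rewrite IH//; first exact: ltnW.
by move=> k' l u v e1 e2; apply: (h _ _ [:: i, k & u] v) => //=; rewrite e1.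
Qed.

Lemma cheb_flatten (p : pred I) (bs : seq (seq I)) :
  all (fun b => b != [::]) bs -> all (fun b => all p b || all (predC p) b) bs ->
  sorted (fun b1 b2 => has p b1 != has p b2) bs ->
  cheb x (flatten bs) = \prod_(b <- bs) cheb x b.
Proof.
elim: bs => [|b bs IH]; first by rewrite big_nil.
move=> /= /andP[bn nes] /andP[bc cos] so; rewrite big_cons -IH//; last exact: path_sorted so.
apply: cheb_cat => i j u v bE flE; apply/eqP => ij.
case: bs flE nes cos so {IH} => // b' bs; case: b' => // k b' [kj _] _ /=.
move=> /andP[bc' _] /andP[+ _]; rewrite bE in bc *.
have -> : has p (rcons u i) = p i.
  rewrite has_rcons; move: bc; rewrite !all_rcons => /orP[/andP[-> _]//|/andP[ip]].
  by rewrite all_predC => /negPf ->; rewrite orbF.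
have -> : p k || has p b' = p k.
  by move: bc' => /orP[/andP[-> _]//|/andP[_]]; rewrite all_predC => /negPf ->; rewrite orbF.
by rewrite ij kj eqxx.
Qed.

End cheb_words.

Section wstar_of_operator.
Variables (R : realType) (P : tracial_wstar_space R).

Definition wstar_of (X : operator P) : wstar P := insubd (0 : wstar P) X.

Lemma wstar_ofK (X : operator P) : wstar_algebra P X -> wstar_of X = X :> operator P.
Proof. by move=> AX; rewrite /wstar_of insubdK// inE. Qed.

Lemma wstar_val_prod (n : nat) (F : nat -> wstar P) :
  (\prod_(i < n) F i : wstar P) =
  \big[(fun Y Z : operator P => Y \o Z)/id]_(i < n) (F i : operator P) :> operator P.
Proof. exact: (big_morph (fun y : wstar P => y : operator P)). Qed.

Lemma wstar_val_sum (J : Type) (s : seq J) (F : J -> wstar P) :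
  (\sum_(i <- s) F i : wstar P) = \sum_(i <- s) (F i : operator P) :> operator P.
Proof. exact: (big_morph (fun y : wstar P => y : operator P)). Qed.

Lemma unital_subalgebra_cheb (B : set (operator P)) (I : finType) (x : I -> wstar P) w :
  unital_subalgebra B -> (forall i, i \in w -> B (x i)) -> B (cheb x w).
Proof.
move=> [B1 BP BM]; have [n] := ubnP (size w); elim: n w => // n IH [//|i w].
rewrite ltnS => wn Bx.
have B0 : B 0.
  by have := BP (-1) _ _ B1 B1; rewrite scaleN1r addNr.
have Bxw : B (x i * cheb x w).
  apply: BM; first by apply: Bx; rewrite inE eqxx.
  by apply: IH => // j jw; apply: Bx; rewrite inE jw orbT.
pose E : wstar P := if w is j :: w' then (i == j)%:R *: cheb x w' else 0.
have Bw2 : B E.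
  rewrite /E; clear E Bxw; case: w wn Bx => [|j w] //= wn Bx.
  rewrite -[X in B X]addr0; apply: BP => //; apply: IH; first exact: ltnW.
  by move=> k kw; apply: Bx; rewrite !inE kw !orbT.
have -> : cheb x (i :: w) = -1 *: E + x i * cheb x w by rewrite scaleN1r addrC.
exact: (BP (-1) _ _ Bw2 Bxw).
Qed.

Lemma unital_subalgebra_generated (X : operator P) :
  unital_subalgebra (generated_algebra X).
Proof.
split.
- by move=> B [[]].
- by move=> a Y Z hY hZ B BP; have [[_ + _] _] := BP; apply; [exact: hY|exact: hZ].
- by move=> Y Z hY hZ B BP; have [[_ _ +] _] := BP; apply; [exact: hY|exact: hZ].
Qed.

End wstar_of_operator.

Section increments.
Variables (R : realType) (P : tracial_wstar_space R) (S : free_brownian_motion P).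
Variables (N : nat) (t : nat -> R).
Hypotheses (t0 : 0 <= t 0%N) (t_lt : forall i, (i < N)%N -> t i < t i.+1).
Local Notation phi := (@wstar_phi R P).
Local Notation st := (@wstar_star R P).
Local Notation W := (@wstar R P).
Local Notation tr := (wstar_tracial_state P).

Definition bm (s : R) : W := wstar_of (S s).

Lemma bmE s : 0 <= s -> bm s = S s :> operator P.
Proof. by move=> s0; rewrite wstar_ofK//; apply: filtration_sub (brownian_adapted S s0). Qed.

Definition increment (i : 'I_N) : W :=
  ((Num.sqrt (t i.+1 - t i))^-1)%:C *: (bm (t i.+1) - bm (t i)).

Let t_le i : (i <= N)%N -> 0 <= t i.
Proof. by elim: i => // i IH iN; rewrite (le_trans (IH (ltnW iN)))// ltW// t_lt. Qed.

Let t_mono i j : (i <= j)%N -> (j <= N)%N -> t i <= t j.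
Proof.
elim: j => [|j IH]; first by rewrite leqn0 => /eqP ->.
rewrite leq_eqVlt => /predU1P[-> //|]; rewrite ltnS => ij jN.
by rewrite (le_trans (IH ij (ltnW jN)))// ltW// t_lt.
Qed.

Lemma star_increment i : st (increment i) = increment i.
Proof.
have iN := ltn_ord i.
have sa s : 0 <= s -> st (bm s) = bm s.
  move=> s0; apply: val_inj; apply: adjointE; rewrite /= bmE//.
  exact: brownian_self_adjoint.
by rewrite (starZ tr) (starB tr) !sa ?conjC_real_complex// t_le// ltnW.
Qed.

Lemma increment_val i : increment i =
  ((Num.sqrt (t i.+1 - t i))^-1)%:C *: (S (t i.+1) - S (t i)) :> operator P.
Proof.
have iN := ltn_ord i.
have e : (bm (t i.+1) - bm (t i) : W) =
    (bm (t i.+1) : operator P) - (bm (t i) : operator P) :> operator P.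
  by [].
rewrite wstar_valZ e !bmE// t_le// ltnW//.
Qed.

Let filtration_increment (i : 'I_N) (s : R) : t i.+1 <= s -> filtration S s (increment i).
Proof.
move=> ts; have iN := ltn_ord i.
have s0 : 0 <= s by rewrite (le_trans _ ts)// t_le.
have [c1 cP cM] := von_neumann_closed (filtration_algebra S s0).
have inF u : 0 <= u -> u <= s -> filtration S s (S u).
  move=> u0; rewrite le_eqVlt => /predU1P[<-|us]; first exact: brownian_adapted.
  by apply: (filtration_le u0 us); exact: brownian_adapted.
rewrite increment_val.
have F0 : filtration S s 0.
  by have := cP (-1) _ _ c1 c1; rewrite scaleN1r addNr.
rewrite -[X in filtration S s X]addr0; apply: (cP) => //.
have i0 : 0 <= t i by rewrite t_le// ltnW.
have := cP (-1) _ _ (inF _ i0 (le_trans (ltW (t_lt iN)) ts)) (inF _ (t_le iN) ts).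
by rewrite scaleN1r addrC.
Qed.

Lemma phi_increment_pow (i : 'I_N) m : phi (increment i ^+ m) = (semicircle 0 1 'X^m)%:C.
Proof.
have iN := ltn_ord i.
have tt := t_lt iN; have i0 : 0 <= t i by rewrite t_le// ltnW.
set s := Num.sqrt (t i.+1 - t i).
have s0 : s != 0 by rewrite gt_eqF// sqrtr_gt0 subr_gt0.
have -> : increment i ^+ m = (s^-1 ^+ m)%:C *: (bm (t i.+1) - bm (t i)) ^+ m.
  by rewrite exprZn rcX.
rewrite (phiZ tr) /wstar_phi wstar_valX.
have -> : (bm (t i.+1) - bm (t i) : W) = (S (t i.+1) - S (t i)) :> operator P.
  have -> : (bm (t i.+1) - bm (t i) : W) =
      (bm (t i.+1) : operator P) - (bm (t i) : operator P) :> operator P.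
    by [].
  by rewrite !bmE// t_le.
rewrite brownian_increment_law// moment_semicircular ?subr_gt0// -/s -rcM; congr (_%:C).
rewrite !semicircleE mulrCA; congr (_ * _).
rewrite -RintegralZl//; last by apply: integrable_continuous_itv; exact: continuous_trig.
apply: eq_Rintegral => x _; rewrite !hornerXn !add0r mul1r -mulrA exprMn -mulrA.
by rewrite exprVn mulKf ?expf_neq0.
Qed.

(** For a single letter [cheb] is the polynomial [chebU] of one normalized increment. Both phi and
    the semicircular integral are linear on polynomials and agree on monomials, so orthogonality to
    1 carries over. *)
Lemma phi_cheb_nseq (i : 'I_N) n : phi (cheb increment (nseq n i)) = (n == 0%N)%:R.
Proof.
pose ev (p : {poly R}) := horner_alg (increment i) (map_poly (real_complex R) p).
have phi_ev p : phi (ev p) = (semicircle 0 1 p)%:C.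
  have s0 : semicircle 0 1 (0 : {poly R}) = 0.
    have := semicircleP 0 1 1 (0 : {poly R}) 0; rewrite scaler0 addr0 mul1r => e.
    by apply: (addrI (semicircle 0 1 (0 : {poly R}))); rewrite addr0 -e.
  have ev0 : ev 0 = 0 by rewrite /ev rmorph0 rmorph0.
  have evP a p1 p2 : ev (a *: p1 + p2) = a%:C *: ev p1 + ev p2.
    by rewrite /ev !rmorphD/= -mul_polyC !rmorphM/= map_polyC/= horner_algC mulr_algl.
  have evX m : ev 'X^m = increment i ^+ m.
    by rewrite /ev map_polyXn rmorphXn/= horner_algX.
  rewrite -[p]coefK poly_def; elim/big_rec: _ => [|k q _ IH].
    by rewrite ev0 s0 (phi0 tr).
  rewrite evP (phiP tr) evX phi_increment_pow IH semicircleP rcD; congr (_ + _); exact/esym/rcM.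
have -> : cheb increment (nseq n i) = ev (chebU R n).
  have [k] := ubnP n; elim: k n => // k IH [|[|n]]; rewrite ltnS => nk.
  - by rewrite /= /ev rmorph1 rmorph1.
  - by rewrite /= !subr0 !mulr1 /ev map_polyX horner_algX.
  - have -> : chebU R n.+2 = 'X * chebU R n.+1 - chebU R n by [].
    have -> : cheb increment (nseq n.+2 i) = increment i * cheb increment (nseq n.+1 i) -
       cheb increment (nseq n i) by rewrite /= eqxx scale1r.
    rewrite IH// IH; last exact: ltnW.
    move: (chebU R n.+1) (chebU R n) => u1 u0.
    by rewrite /ev !rmorphB/= !rmorphM/= map_polyX horner_algX.
by rewrite phi_ev semicircle_chebU; case: (n == 0%N).
Qed.

(** Induction on a strict bound for the indices of the letters. A word with letters at most j is cut
    into blocks of the letter j and blocks of smaller letters. The former are centered by the case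
    of one letter, the latter by induction and lie in the filtration at time [t j]; the increment
    number j is free from that algebra, so the alternating product has trace 0. *)
Lemma phi_cheb_increment w : phi (cheb increment w) = (w == [::])%:R.
Proof.
case: (eqVneq w [::]) => [->|w0]; first exact: (phi1 tr).
suff h j u : (j <= N)%N -> all (fun i : 'I_N => (i < j)%N) u -> u != [::] ->
    phi (cheb increment u) = 0.
  by apply: (h N) => //; apply/allP => i _.
elim: j u => [|j IH] u jN uj u0.
  by case: u uj u0.
pose p (i : 'I_N) := val i == j.
have [bs [ubs bs0 ne co so]] := alternating_runs p u0.
have bj b : b \in bs -> all (fun i : 'I_N => (i < j.+1)%N) b.
  move=> bbs; apply/allP => i ib; move/allP : uj; apply.
  by rewrite -ubs; apply/flattenP; exists b.
rewrite -ubs (cheb_flatten _ ne co so) (big_nth [::]) big_mkord.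
rewrite /wstar_phi (wstar_val_prod _ (fun k => cheb increment (nth [::] bs k))).
have jN' : (j < N)%N by [].
have tj0 : 0 <= t j by rewrite t_le// ltnW.
have phib b : b \in bs -> phi (cheb increment b) = 0.
  move=> bbs; have b0 := allP ne _ bbs; have /orP[bp|bp] := allP co _ bbs.
    have -> : b = nseq (size b) (Ordinal jN').
      apply/all_pred1P; apply/allP => i ib /=; rewrite -val_eqE/=.
      by have := allP bp _ ib.
    by rewrite phi_cheb_nseq -[size b == 0%N]/(_) size_eq0 (negPf b0).
  apply: IH => //; first exact: ltnW.
  apply/allP => i ib; have := allP (bj _ bbs) _ ib; have := allP bp _ ib.
  by rewrite /= /p ltnS leq_eqVlt => /negPf ->.
apply: (@brownian_increment_free R P S _ _ tj0 (t_lt jN') (size bs)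
  (fun k => has p (nth [::] bs k))
  (fun k => cheb increment (nth [::] bs k) : operator P)).
- by rewrite lt0n size_eq0.
- move=> k kbs; have bbs := mem_nth [::] kbs; have b0 := allP ne _ bbs.
  have /orP[bp|bp] := allP co _ bbs.
    rewrite (_ : has p _ = true); last first.
      by case: (nth _ _ _) b0 bp => //= i b _ /andP[->].
    apply: unital_subalgebra_cheb; first exact: unital_subalgebra_generated.
    move=> i ib; have /eqP ij := allP bp _ ib; rewrite increment_val ij.
    have [_ GP _] := @unital_subalgebra_generated R P (S (t j.+1) - S (t j)).
    have G0 : generated_algebra (S (t j.+1) - S (t j)) 0.
      have [G1 _ _] := @unital_subalgebra_generated R P (S (t j.+1) - S (t j)).
      by have := GP (-1) _ _ G1 G1; rewrite scaleN1r addNr.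
    rewrite -[X in generated_algebra _ X]addr0; apply: GP => // B [_]; exact.
  rewrite (_ : has p _ = false); last by move: bp; rewrite all_predC => /negPf.
  apply: unital_subalgebra_cheb; first exact: von_neumann_closed (filtration_algebra S tj0).
  move=> i ib; apply: filtration_increment.
  have ij : (i < j)%N.
    have := allP (bj _ bbs) _ ib; have := allP bp _ ib.
    by rewrite /= /p ltnS leq_eqVlt => /negPf ->.
  by rewrite t_mono// ltnW.
- by move=> k kbs; apply: phib; exact: mem_nth.
- move=> k kbs; have := so; move/(sortedP [::]) : so => /(_ k kbs).
  by [].
Qed.

End increments.

(** * Integrals of step functions on a grid *)

Section grid.
Variables (R : realType) (P : tracial_wstar_space R) (S : free_brownian_motion P).
Variable E : seq R.
Hypotheses (E_sorted : sorted <%R E) (E_ge0 : forall a, a \in E -> 0 <= a).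
Local Notation N := (size E).-1.
Local Notation t := (nth 0 E).
Local Notation W := (@wstar R P).
Local Notation bm := (bm S).
Local Notation x := (increment S (N := N) t).
Implicit Types (a b : R) (i : 'I_N) (l : seq (R * R)) (w : seq 'I_N).

Lemma grid_ge0 : 0 <= t 0%N.
Proof. by case: E E_ge0 => //= a s; apply; rewrite inE eqxx. Qed.

Lemma grid_lt k : (k < N)%N -> t k < t k.+1.
Proof. by move=> kN; apply: (sortedP 0 E_sorted); case: E kN. Qed.

Lemma grid_le k m : (k <= m)%N -> (m <= N)%N -> t k <= t m.
Proof.
elim: m => [|m IH]; first by rewrite leqn0 => /eqP ->.
rewrite leq_eqVlt => /predU1P[-> //|]; rewrite ltnS => km mN.
by rewrite (le_trans (IH km (ltnW mN)))// ltW// grid_lt.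
Qed.

Let index_grid a : a \in E -> (index a E <= N)%N.
Proof. by rewrite -index_mem; case: E. Qed.

(* Whether the cell number i of the grid lies between the grid points p.1 and p.2. *)
Definition covers (p : R * R) i := (index p.1 E <= i < index p.2 E)%N.

Lemma in_cell (p : R * R) i (y : R) : p.1 \in E -> p.2 \in E ->
  t i < y < t i.+1 -> (y \in `]p.1, p.2[) = covers p i.
Proof.
move=> p1 p2 /andP[iy yi]; have iN := ltn_ord i.
rewrite in_itv/= /covers; congr andb.
  have [ki|ik] := leqP (index p.1 E) i.
    by rewrite (le_lt_trans _ iy)// -(nth_index 0 p1) grid_le// ltnW.
  apply/negbTE; rewrite -leNgt (le_trans (ltW yi))// -(nth_index 0 p1).
  by rewrite grid_le// index_grid.
have [ki|ik] := ltnP i (index p.2 E).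
  by rewrite (lt_le_trans yi)// -(nth_index 0 p2) grid_le// index_grid.
apply/negbTE; rewrite -leNgt (le_trans _ (ltW iy))// -(nth_index 0 p2).
by rewrite grid_le// ltnW.
Qed.

Definition cell_length i : R := t i.+1 - t i.

Lemma cell_length_gt0 i : 0 < cell_length i.
Proof. by rewrite subr_gt0 grid_lt. Qed.

(** Telescoping over the cells between two grid points; the square root of the cell length undoes
    the normalization of the increments. *)
Lemma bm_covers (p : R * R) : p.1 \in E -> p.2 \in E -> p.1 < p.2 ->
  bm p.2 - bm p.1 =
  \sum_i ((covers p i)%:R * (Num.sqrt (cell_length i))%:C) *: x i.
Proof.
move=> p1 p2 p12.
have i12 : (index p.1 E <= index p.2 E)%N.
  rewrite leqNgt; apply/negP => /ltnW/grid_le/(_ (index_grid p1)).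
  by rewrite !nth_index// leNgt p12.
have -> : \sum_i ((covers p i)%:R * (Num.sqrt (cell_length i))%:C) *: x i =
    \sum_(i < N | covers p i) (bm (t i.+1) - bm (t i)).
  rewrite [RHS]big_mkcond; apply: eq_bigr => i _; rewrite /x /increment -/(cell_length i).
  case: (covers p i); rewrite ?mul0r ?scale0r// mul1r scalerA -rcM divff ?scale1r//.
  by rewrite gt_eqF// sqrtr_gt0 cell_length_gt0.
rewrite -[in LHS](nth_index 0 p1) -[in LHS](nth_index 0 p2).
rewrite -(telescope_sumr (fun k => bm (t k)) i12).
rewrite (big_nat_widen _ _ _ _ _ (index_grid p2)) (big_nat_widenl _ 0)//= big_mkord.
by apply: eq_bigl => i; rewrite /covers andbC.
Qed.

Definition box_covers l w := all2 covers l w.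

Definition word_length w : R := \prod_(i <- w) cell_length i.

Lemma word_length_gt0 w : 0 < word_length w.
Proof. by rewrite /word_length prodr_gt0// => i _; exact: cell_length_gt0. Qed.

Lemma prod_bm_covers l : all (fun p => (p.1 \in E) && (p.2 \in E) && (p.1 < p.2)) l ->
  \prod_(p <- l) (bm p.2 - bm p.1) = \sum_(w <- words 'I_N (size l))
    ((box_covers l w)%:R * (Num.sqrt (word_length w))%:C) *: xprod x w.
Proof.
elim: l => [_|p l IH /= /andP[/andP[/andP[p1 p2] p12] lE]].
  rewrite big_nil big_words0 /word_length /xprod !big_nil sqrtr1.
  by rewrite mulr1 scale1r.
rewrite big_cons IH// bm_covers// big_allpairs_dep big_enum mulr_suml.
apply: eq_bigr => i _; rewrite mulr_sumr; apply: eq_bigr => w _.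
rewrite -scalerAl -scalerAr scalerA /xprod big_cons; congr (_ *: _).
rewrite /word_length big_cons sqrtrM ?ltW ?cell_length_gt0// rcM /= -mulnb natrM.
by rewrite mulrACA.
Qed.

Section step.
Variables (q : nat) (s : seq (R[i] * q.-tuple (R * R))).
Hypothesis s_box : forall p, p \in s -> off_diagonal_box p.2.
Hypothesis s_grid : forall p, p \in s -> all (fun ab => (ab.1 \in E) && (ab.2 \in E)) p.2.

Let box_grid p : p \in s ->
  all (fun p => (p.1 \in E) && (p.2 \in E) && (p.1 < p.2)) p.2.
Proof.
move=> ps; apply/allP => ab abp; rewrite (allP (s_grid ps) _ abp)/=.
have [h _] := s_box ps; have /tnthP[i ->] := abp.
by have /andP[_] := h i.
Qed.

Definition step_value w : R[i] := \sum_(p <- s) p.1 * (box_covers p.2 w)%:R.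

(** The square root of the volume of the cell compensates for the normalized increments, and makes
    the squared modulus of the coefficient the integral of the squared modulus of the step function
    over the cell. *)
Definition step_coef w : R[i] := step_value w * (Num.sqrt (word_length w))%:C.

Lemma step_coef_off_diagonal : off_diagonal q step_coef.
Proof.
move=> w sw wn; rewrite /step_coef /step_value big1_seq ?mul0r// => p /= ps.
case h: (box_covers p.2 w); rewrite ?mulr0//.
exfalso; move/negP : wn; apply; case: w sw h => // i0 w' sw h.
set w := i0 :: w' in sw h *; apply/(sortedP i0) => k kw; apply/eqP => kk.
move: h; rewrite /box_covers all2E => /andP[_ /allP h].
have [_ dis] := s_box ps.
have kq : (k < q)%N by rewrite -sw; exact: ltnW.
have kq1 : (k.+1 < q)%N by rewrite -sw.
have cov m (mq : (m < q)%N) : covers (tnth p.2 (Ordinal mq)) (nth i0 w m).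
  rewrite (tnth_nth (0, 0))/=.
  apply: (h (nth (0, 0) p.2 m, nth i0 w m)).
  rewrite -nth_zip ?size_tuple ?sw// mem_nth// size_zip size_tuple sw minnn//.
have c1 := cov _ kq; have c2 := cov _ kq1; rewrite -kk in c2.
set i := nth i0 w k in c1 c2.
(* Two neighbouring letters equal to i would put the midpoint of the cell i into two sides of the
   box, which are disjoint. *)
pose y := (t i + t i.+1) / 2.
have yc : t i < y < t i.+1 by rewrite midf_lt ?midf_lt// grid_lt.
have mE m : ((tnth p.2 m).1 \in E) && ((tnth p.2 m).2 \in E).
  exact: (allP (s_grid ps) _ (mem_tnth _ _)).
have : Ordinal kq != Ordinal kq1 by rewrite -val_eqE/=; rewrite neq_ltn ltnSn.
move=> /dis/seteqP[/(_ y) + _] => /=; apply; split => /=.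
  by have /andP[m1 m2] := mE (Ordinal kq); rewrite (in_cell m1 m2 yc).
by have /andP[m1 m2] := mE (Ordinal kq1); rewrite (in_cell m1 m2 yc).
Qed.

Let val_box (b : q.-tuple (R * R)) : off_diagonal_box b ->
  (\prod_(p <- b) (bm p.2 - bm p.1) : W) = box_integral S b :> operator P.
Proof.
move=> [h _]; rewrite big_tuple (big_morph (fun y : W => y : operator P)
  (id1 := id) (op1 := fun Y Z : operator P => Y \o Z))//.
apply: eq_bigr => i _; have /andP[b0 b1] := h i.
transitivity ((bm (tnth b i).2 : operator P) - (bm (tnth b i).1 : operator P)) => //.
by rewrite !bmE// (le_trans b0)// ltW.
Qed.

Lemma step_integral_hom : hom x q step_coef = step_integral S s :> operator P.
Proof.
rewrite (off_diagonal_hom _ step_coef_off_diagonal).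
transitivity (\sum_(p <- s) p.1 *: (\prod_(ab <- p.2) (bm ab.2 - bm ab.1)) : W).
  congr wstar_val.
  under eq_bigr do rewrite /step_coef /step_value mulr_suml scaler_suml.
  rewrite exchange_big/=; apply: eq_big_seq => p ps.
  rewrite prod_bm_covers ?box_grid// size_tuple scaler_sumr.
  by apply: eq_bigr => w _; rewrite scalerA mulrA.
rewrite wstar_val_sum /step_integral; apply: eq_big_seq => p ps.
by rewrite -val_box//; exact: s_box.
Qed.

End step.

End grid.

(** * Step functions *)

Section lebesgue_boxes.
Variable R : realType.
Local Notation T := (measurableTypeR R).
Implicit Types (l : seq (R * R)).

(** The sides form a plain list, which permits induction on q; a list of the wrong length gives the
    empty set. *)
Definition open_box q l : set (q.-tuple T) :=
  [set y | all2 (fun (z : R) (p : R * R) => p.1 < z < p.2) y l].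
Arguments open_box : clear implicits.

Lemma open_box_cons q p l : open_box q.+1 (p :: l) =
  [set y : q.+1.-tuple T | `]p.1, p.2[%classic (thead y)] `&`
  [set y : q.+1.-tuple T | open_box q l (behead_tuple y)].
Proof.
apply/seteqP; split => y; case/tupleP: y => z y; rewrite /open_box /= theadE.
  by move=> /andP[h1 h2]; split=> //=; rewrite in_itv.
by case=> /=; rewrite in_itv/= => -> ->.
Qed.

Lemma measurable_open_box q l : measurable (open_box q l).
Proof.
elim: q l => [|q IH] [|p l].
- rewrite (_ : open_box 0 [::] = setT)//; apply/seteqP; split => // y _.
  by rewrite /open_box /= tuple0.
- rewrite (_ : open_box 0 (p :: l) = set0)//; apply/seteqP; split => // y.
  by rewrite /open_box /= tuple0.
- rewrite (_ : open_box q.+1 [::] = set0)//; apply/seteqP; split => // y.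
  by case/tupleP: y => z y; rewrite /open_box.
rewrite open_box_cons; apply: measurableI; rewrite -[X in measurable X]setTI.
  by apply: (measurable_tnth ord0) => //; exact: measurable_itv.
exact: measurable_behead.
Qed.

Lemma lebesgue_open_box q l : size l = q -> all (fun p => p.1 < p.2) l ->
  lebesgue_tuple R q (open_box q l) = (\prod_(p <- l) (p.2 - p.1))%:E.
Proof.
elim: q l => [|q IH] [|p l]//.
  by move=> _ _; rewrite big_nil /= diracE mem_set// /open_box /=.
case=> lq /= /andP[p12 l12].
rewrite /lebesgue_cons /pushforward.
rewrite [X in (_ \x _)%E X](_ : _ = `]p.1, p.2[ `*` open_box q l); last first.
  apply/seteqP; split => -[z y]; rewrite /open_box /= in_itv/=.
    by move=> /andP[].
  by case=> -> ->.
rewrite product_measure1E ?IH//; [|exact: measurable_open_box].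
by rewrite /= lebesgue_measure_itv/= lte_fin p12 big_cons EFinM EFinB.
Qed.

Lemma box_indicatorE q (b : q.-tuple (R * R)) y :
  box_indicator b y = (\1_(open_box q b) y)%:C.
Proof.
rewrite /box_indicator indicE.
have -> : (y \in open_box q b) = [forall i, (tnth y i : R) \in `](tnth b i).1, (tnth b i).2[].
  rewrite /open_box; apply/idP/forallP => [|h].
    rewrite inE /= all2E => /andP[_ /allP h] i; rewrite in_itv/=.
    apply: (h (tnth y i, tnth b i)).
    rewrite (tnth_nth (0 : R)) (tnth_nth (0, 0)) -nth_zip ?size_tuple//.
    by rewrite mem_nth// size_zip !size_tuple minnn.
  rewrite inE/= all2E !size_tuple eqxx/=; apply/(all_nthP (0, (0, 0))) => k.
  rewrite size_zip !size_tuple minnn => kq; rewrite nth_zip ?size_tuple//=.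
  by have := h (Ordinal kq); rewrite in_itv/= (tnth_nth (0 : R)) (tnth_nth (0, 0)).
case: forallP => h; first by rewrite big1// => i _; rewrite h.
have /existsP[i hi] : [exists i, (tnth y i : R) \notin `](tnth b i).1, (tnth b i).2[].
  by rewrite -negb_forall; apply/forallP.
by rewrite (bigD1 i)//= (negPf hi) mul0r.
Qed.

Section measurability.
Variable q : nat.
Local Notation Rq := (q.-tuple T).
Implicit Types (f g : Rq -> R[i]).

Definition cmeasurable f := measurable_fun (@orthant R q) (fun y => complex.Re (f y)) /\
  measurable_fun (@orthant R q) (fun y => complex.Im (f y)).

Lemma measurable_orthant : measurable (@orthant R q).
Proof.
rewrite (_ : @orthant R q = \bigcap_(i in [set: 'I_q]) [set y | `[0, +oo[%classic (tnth y i : R)]).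
  apply: fin_bigcap_measurable => // i _; rewrite -[X in measurable X]setTI.
  by apply: (measurable_tnth i) => //; exact: measurable_itv.
apply/seteqP; split => y h i; first by move=> _; rewrite /= in_itv/= andbT; exact: (h i).
by have := h i I; rewrite /= in_itv/= andbT.
Qed.

Lemma cmeasurable_step (s : seq (R[i] * q.-tuple (R * R))) : cmeasurable (step_function s).
Proof.
have mi (b : q.-tuple (R * R)) : measurable_fun (@orthant R q) (\1_(open_box q b) : Rq -> R).
  by apply: measurable_indic; exact: measurable_open_box.
have eR y : complex.Re (step_function s y) =
    \sum_(p <- s) complex.Re p.1 * \1_(open_box q p.2) y.
  rewrite /step_function (big_morph _ (@ReD R) (erefl : complex.Re (0 : R[i]) = 0)).
  by apply: eq_bigr => p _; rewrite box_indicatorE mulrC Re_realM mulrC.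
have eI y : complex.Im (step_function s y) =
    \sum_(p <- s) complex.Im p.1 * \1_(open_box q p.2) y.
  rewrite /step_function (big_morph _ (@ImD R) (erefl : complex.Im (0 : R[i]) = 0)).
  by apply: eq_bigr => p _; rewrite box_indicatorE ImM/= mulr0 add0r.
split.
  under eq_fun do rewrite eR.
  by apply: measurable_sum => p; apply: measurable_funM.
under eq_fun do rewrite eI.
by apply: measurable_sum => p; apply: measurable_funM.
Qed.

Lemma cmeasurable_sub f g : cmeasurable f -> cmeasurable g -> cmeasurable (fun y => f y - g y).
Proof.
move=> [fR fI] [gR gI]; split.
  by under eq_fun do rewrite ReD ReN; exact: measurable_funB.
under eq_fun do rewrite ImD.
by rewrite (_ : (fun y => _) = (fun y => complex.Im (f y) - complex.Im (g y)));
  [exact: measurable_funB|apply/funext => y; case: (g y)].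
Qed.

Lemma cmeasurable_normc2 f : cmeasurable f ->
  measurable_fun (@orthant R q) (fun y => (normc (f y) ^+ 2)%:E).
Proof.
move=> [fR fI]; apply/measurable_EFinP.
rewrite (_ : (fun y => _) = (fun y => complex.Re (f y) ^+ 2 + complex.Im (f y) ^+ 2)).
  by apply: measurable_funD; exact: measurable_funX.
by apply/funext => y; case: (f y) => a b /=; rewrite sqr_sqrtr// addr_ge0 ?sqr_ge0.
Qed.

Lemma l2normsq_ge0 f : (0 <= l2normsq f)%E.
Proof. by apply: integral_ge0 => y _; rewrite lee_fin sqr_ge0. Qed.

(** A substitute for the triangle inequality that stays with squared norms in the extended reals:
    pointwise (a + b)^2 <= (1 + e) a^2 + (1 + 1/e) b^2, the gap being (e a - b)^2 / e. *)
Lemma l2normsq_le_perturb f g (e : R) : 0 < e -> cmeasurable f -> cmeasurable g ->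
  (l2normsq g <= (1 + e)%:E * l2normsq f + (1 + e^-1)%:E * l2normsq (fun y => f y - g y)%R)%E.
Proof.
move=> e0 mf mg; have mfg := cmeasurable_sub mf mg.
rewrite /l2normsq -!ge0_integralZl//; try exact: measurable_orthant;
  try exact: cmeasurable_normc2; try (by move=> y _; rewrite lee_fin sqr_ge0);
  try (by rewrite lee_fin addr_ge0 ?invr_ge0 ?ltW).
have k0 (k : R) (h : Rq -> R[i]) : 0 <= k ->
    forall y, orthant y -> (0 <= k%:E * (normc (h y) ^+ 2)%:E)%E.
  by move=> k0 y _; rewrite mule_ge0// lee_fin// sqr_ge0.
have mk (k : R) (h : Rq -> R[i]) : cmeasurable h ->
    measurable_fun (@orthant R q) (fun y => k%:E * (normc (h y) ^+ 2)%:E)%E.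
  by move=> mh; apply: measurable_funeM; exact: cmeasurable_normc2.
rewrite -ge0_integralD//; [|exact: measurable_orthant|exact: k0 (addr_ge0 ler01 (ltW e0))
  |exact: mk|by apply: k0; rewrite addr_ge0 ?invr_ge0 ?ltW|exact: mk].
apply: ge0_le_integral; try exact: measurable_orthant.
- by move=> y _; rewrite lee_fin sqr_ge0.
- exact: cmeasurable_normc2.
- by apply: emeasurable_funD; apply: measurable_funeM; exact: cmeasurable_normc2.
move=> y _; rewrite -!EFinM -EFinD lee_fin.
set a := normc (f y); set b := normc (f y - g y).
have gab : normc (g y) <= a + b.
  by rewrite -{1}[g y](subKr (f y)) (le_trans (normcB _ _)).
have [a0 b0] : 0 <= a /\ 0 <= b by rewrite !normc_ge0.
apply: (@le_trans _ _ ((a + b) ^+ 2)).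
  by rewrite ler_pXn2r ?nnegrE ?normc_ge0 ?addr_ge0.
have h : 0 <= (e * a - b) ^+ 2 / e by rewrite divr_ge0 ?sqr_ge0// ltW.
have -> : (1 + e) * a ^+ 2 + (1 + e^-1) * b ^+ 2 = (a + b) ^+ 2 + (e * a - b) ^+ 2 / e.
  by field; rewrite gt_eqF.
by rewrite lerDl.
Qed.

End measurability.
End lebesgue_boxes.
Arguments open_box {R} q l.

Section step_norm.
Variables (R : realType) (E : seq R).
Hypotheses (E_sorted : sorted <%R E) (E_ge0 : forall a, a \in E -> 0 <= a).
Local Notation N := (size E).-1.
Local Notation t := (nth 0 E).
Variables (q : nat) (s : seq (R[i] * q.-tuple (R * R))).
Hypothesis s_grid : forall p, p \in s -> all (fun ab => (ab.1 \in E) && (ab.2 \in E)) p.2.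
Implicit Types (w : seq 'I_N).

Let cells w : seq (R * R) := map (fun i : 'I_N => (t i, t i.+1)) w.

Let covers_cells l w (y : seq R) : size l = size w ->
  all (fun ab => (ab.1 \in E) && (ab.2 \in E)) l ->
  all2 (fun z p => p.1 < z < p.2) y (cells w) ->
  all2 (fun z p => p.1 < z < p.2) y l = box_covers l w.
Proof.
elim: l w y => [|p l IH] [|i w] [|z y]//= [lw] /andP[/andP[p1 p2] lE] /andP[zi yw].
by rewrite (IH w)// -(in_cell E_sorted p1 p2 zi) in_itv.
Qed.

Let step_on_cell w y : size w = q -> y \in open_box q (cells w) ->
  step_function s y = step_value s w.
Proof.
move=> sw; rewrite inE => yw; apply: eq_big_seq => p ps; congr (_ * _).
rewrite box_indicatorE indicE.
have -> : (y \in open_box q p.2) = box_covers p.2 w.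
  rewrite -(@covers_cells _ _ y) ?size_tuple ?s_grid//.
  by apply/idP/idP; rewrite inE.
by case: box_covers.
Qed.

Let cells_inj w1 w2 (y : seq R) : size w1 = size w2 ->
  all2 (fun z p => p.1 < z < p.2) y (cells w1) ->
  all2 (fun z p => p.1 < z < p.2) y (cells w2) -> w1 = w2.
Proof.
elim: w1 w2 y => [|i w1 IH] [|j w2] [|z y]//= [s12] /andP[zi y1] /andP[zj y2].
congr cons; last exact: IH y1 y2.
apply: val_inj; apply/eqP; rewrite eqn_leq; apply/andP; split; rewrite leqNgt; apply/negP.
  move=> ji; have := grid_le E_sorted ji (ltnW (ltn_ord i)).
  move/andP: zi => [zi _]; move/andP: zj => [_ zj].
  by rewrite leNgt (lt_trans zi zj).
move=> ij; have := grid_le E_sorted ij (ltnW (ltn_ord j)).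
move/andP: zi => [_ zi]; move/andP: zj => [zj _].
by rewrite leNgt (lt_trans zj zi).
Qed.

Let cells_orthant w : open_box q (cells w) `<=` @orthant R q.
Proof.
move=> y h k; have : all (fun z : R => 0 <= z) y.
  move: h; rewrite /open_box /=; elim: (y : seq R) w => [|z y' IH] [|i w]//= /andP[/andP[zi _] yw].
  rewrite (IH w)// (le_trans _ (ltW zi))// (le_trans (grid_ge0 E_ge0))//.
  by rewrite grid_le// ltnW.
by move/allP; apply; exact: mem_tnth.
Qed.

(** The cells are pairwise disjoint, so at most one summand is nonzero. At points in no open cell,
    such as those on the grid hyperplanes, the left side is 0. *)
Let normc2_step y : \sum_(w <- words 'I_N q)
    normc (step_value s w) ^+ 2 * \1_(open_box q (cells w)) y
  <= normc (step_function s y) ^+ 2.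
Proof.
have [|/hasPn no] := boolP (has (fun w => y \in open_box q (cells w)) (words 'I_N q)).
  move=> /hasP[w ww yw]; rewrite (big_rem w ww)/= indicE yw mulr1.
  rewrite big1_seq ?addr0 => [|w' /= w'w]; last first.
    move: w'w; rewrite (mem_rem_uniq _ (uniq_words _ _)) inE => /andP[/eqP w'w w'w2].
    rewrite indicE; case yw': (y \in _); rewrite ?mulr0//; exfalso; apply: w'w.
    apply: (@cells_inj w' w y).
    - by move: ww w'w2; rewrite !mem_words => /eqP -> /eqP.
    - exact: set_mem yw'.
    - exact: set_mem yw.
  by rewrite (step_on_cell _ yw)//; move: ww; rewrite mem_words => /eqP.
rewrite big1_seq ?sqr_ge0// => w /= /no yw.
by rewrite indicE (negPf yw) mulr0.
Qed.

(** An inequality spares the proof that the faces of the cells are negligible. In the limit it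
    bounds the norm of the Wigner integral by that of its kernel, which is the direction that
    self-adjointness requires. *)
Lemma hnorm_step_coef_le :
  ((hnorm q (step_coef (E := E) s) ^+ 2)%:E <= l2normsq (step_function s))%E.
Proof.
have mb w : measurable (open_box q (cells w)) by exact: measurable_open_box.
have int_cell w : w \in words 'I_N q ->
    (\int[lebesgue_tuple R q]_(y in @orthant R q)
       (normc (step_value s w) ^+ 2 * \1_(open_box q (cells w)) y)%:E)%E =
    (normc (step_coef s w) ^+ 2)%:E.
  rewrite mem_words => /eqP sw; under eq_integral do rewrite EFinM.
  rewrite ge0_integralZl_EFin ?sqr_ge0//; first last.
  - by apply/measurable_EFinP; exact: measurable_indic.
  - exact: measurable_orthant.
  rewrite integral_indic//; last exact: measurable_orthant.
  rewrite setIidl; last exact: cells_orthant.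
  rewrite [X in (_ * X)%E](_ : _ = (\prod_(p <- cells w) (p.2 - p.1))%:E);
    last apply: lebesgue_open_box; rewrite ?size_map//; last first.
    by rewrite all_map; apply/allP => i _ /=; rewrite grid_lt.
  rewrite -EFinM /step_coef normcM normc_real ger0_norm ?sqrtr_ge0// exprMn.
  by rewrite sqr_sqrtr ?ltW ?word_length_gt0// /word_length big_map.
rewrite sqr_hnorm -sumEFin -(eq_big_seq _ int_cell) -ge0_integral_sum//; first last.
- by move=> w y _; rewrite lee_fin mulr_ge0 ?sqr_ge0.
- by move=> w; apply/measurable_EFinP; apply: measurable_funM.
- exact: measurable_orthant.
apply: ge0_le_integral.
- exact: measurable_orthant.
- by move=> y _; apply: sume_ge0 => w _; rewrite lee_fin mulr_ge0 ?sqr_ge0.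
- by apply: emeasurable_sum => w; apply/measurable_EFinP; apply: measurable_funM.
- by apply: cmeasurable_normc2; exact: cmeasurable_step.
by move=> y _; rewrite sumEFin lee_fin normc2_step.
Qed.

End step_norm.

Lemma rc_nat (R : rcfType) n : (n%:R : R)%:C = n%:R :> R[i].
Proof. exact: (rmorph_nat (real_complex R)). Qed.

Lemma normc_dist (R : rcfType) (a b : R[i]) : `|normc a - normc b| <= normc (a - b).
Proof.
have h (u v : R[i]) : normc u - normc v <= normc (u - v).
  by rewrite lerBlDr -{1}(subrK v u) normcD.
by rewrite ler_norml h lerNl opprB -[X in _ <= X]normcNE opprB h.
Qed.

(** * Moment bounds for Wigner integrals *)

Section chaos_limit.
Variables (R : realType) (A : algType R[i]) (st : A -> A) (phi : A -> R[i]).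
Hypothesis tr : tracial_state st phi.
Local Notation nrm := (nrm st phi).
Variables (N : nat -> nat) (x : forall k, 'I_(N k) -> A) (c : forall k, seq 'I_(N k) -> R[i]).
Arguments x : clear implicits.
Arguments c : clear implicits.
Hypothesis xsa : forall k i, st (x k i) = x k i.
Hypothesis phi_cheb : forall k w, phi (cheb (x k) w) = (w == [::])%:R.
Arguments xsa : clear implicits.
Arguments phi_cheb : clear implicits.

Section order.
Variables (q : nat) (X : A).
Hypothesis oc : forall k, off_diagonal q (c k).
Arguments oc : clear implicits.
Hypothesis chaos_cvg : nrm (hom (x k) q (c k) - X) @[k --> \oo] --> (0 : R).

Lemma hnorm_near_le : \forall k \near \oo, hnorm q (c k) <= nrm X + 1.
Proof.
near=> k; rewrite -(nrm_hom tr (xsa k) (phi_cheb k)).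
rewrite -[hom _ _ _](subrK X) addrC (le_trans (nrmD tr _ _))// lerD2l.
rewrite (le_trans (ler_norm _))//.
near: k; move/cvgrPdist_le : chaos_cvg => /(_ 1 ltr01).
by apply: filterS => k; rewrite sub0r normrN.
Unshelve. all: by end_near. Qed.

Lemma hom_mul_near_le : \forall k \near \oo,
  forall y, nrm (hom (x k) q (c k) * y) <= q.+1%:R * (nrm X + 1) * nrm y.
Proof.
near=> k; have hk : hnorm q (c k) <= nrm X + 1 by near: k; exact: hnorm_near_le.
apply: (nrm_mul_le_of_moments tr) => [|n].
  by rewrite mulr_ge0// addr_ge0// nrm_ge0.
apply: le_trans (normc_phi_pow tr (xsa k) (phi_cheb k) n (oc k)) _.
by rewrite lerXn2r ?nnegrE ?mulr_ge0 ?hnorm_ge0 ?addr_ge0 ?nrm_ge0// ler_wpM2l.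
Unshelve. all: by end_near. Qed.

End order.

Variables (p : nat) (X : A) (lambda : R).
Hypothesis p_gt0 : (0 < p)%N.
Local Notation q := (p + p)%N.
Hypothesis oc : forall k, off_diagonal q (c k).
Arguments oc : clear implicits.
Local Notation T k := (hom (x k) q (c k)).
Hypothesis chaos_cvg : nrm (T k - X) @[k --> \oo] --> (0 : R).
Hypotheses (X_sa : st X = X) (lambda_gt0 : 0 < lambda) (phi_sqrX : phi (X ^+ 2) = lambda%:C).

Local Notation K := (q.+1%:R * (Num.sqrt lambda + 1)).

(** The limit of the defects of the approximations, and the quantity that assertion (ii) sends to 0
    along the sequence. *)
Definition excess : R :=
  complex.Re (phi (X ^+ 4) - 2 * phi (X ^+ 3)) - (2 * lambda ^+ 2 - lambda).

Let nrmX2 : nrm X ^+ 2 = lambda.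
Proof.
by have := phi_sqr tr X; rewrite X_sa -expr2 phi_sqrX => -[].
Qed.

Let nrmX : nrm X = Num.sqrt lambda.
Proof. by rewrite -nrmX2 sqrtr_sqr ger0_norm ?nrm_ge0. Qed.

Let K_ge0 : 0 <= K.
Proof. by rewrite mulr_ge0// addr_ge0// sqrtr_ge0. Qed.

Let T_le : \forall k \near \oo, forall y, nrm (T k * y) <= K * nrm y.
Proof. by rewrite -nrmX; exact: hom_mul_near_le. Qed.

Let phi_sqr_cvg : normc (phi (T k * T k) - lambda%:C) @[k --> \oo] --> (0 : R).
Proof.
have := phi_pow_cvg tr chaos_cvg T_le K_ge0 2; rewrite phi_sqrX.
by under eq_fun do rewrite expr2.
Qed.

(** By [defectE] the defect is a continuous expression in norms and traces of powers of T, all of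
    which converge to those of X; self-adjointness of X identifies the limit. *)
Lemma defect_cvg : defect p (c k) @[k --> \oo] --> excess.
Proof.
have n2 := @nrm_powr_cvg _ _ _ _ tr _ _ _ chaos_cvg T_le K_ge0 2.
have n1 := @nrm_powr_cvg _ _ _ _ tr _ _ _ chaos_cvg T_le K_ge0 1.
have p12 := @phi_star_pow_cvg _ _ _ _ tr _ _ _ chaos_cvg T_le K_ge0 1 2.
have a2 : normc (phi (T k * T k)) @[k --> \oo] --> lambda.
  apply/cvgrPdist_le => e e0; move/cvgrPdist_le : phi_sqr_cvg => /(_ e e0).
  apply: filterS => k; rewrite sub0r normrN; apply: le_trans.
  rewrite [X in _ <= X]ger0_norm ?normc_ge0//.
  by have := normc_dist (phi (T k * T k)) lambda%:C;
    rewrite normc_real (gtr0_norm lambda_gt0) distrC.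
have -> : excess = nrm (X ^+ 2) ^+ 2 - 2 * complex.Re (phi (st (X ^+ 1) * X ^+ 2)) +
    nrm (X ^+ 1) ^+ 2 - nrm (X ^+ 1) ^+ 4 - lambda ^+ 2.
  have -> : nrm (X ^+ 2) ^+ 2 = complex.Re (phi (X ^+ 4)).
    have := phi_sqr tr (X ^+ 2); rewrite (starX tr) X_sa -exprD => ->//.
  rewrite expr1 X_sa -exprS nrmX2 (_ : nrm X ^+ 4 = lambda ^+ 2); last first.
    by rewrite -nrmX2 -exprM.
  rewrite /excess ReD ReN -rc_nat Re_realM.
  ring.
have -> : (fun k => defect p (c k)) = fun k => nrm (T k ^+ 2) ^+ 2 -
    2 * complex.Re (phi (st (T k ^+ 1) * T k ^+ 2)) + nrm (T k ^+ 1) ^+ 2 -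
    nrm (T k ^+ 1) ^+ 4 - normc (phi (T k * T k)) ^+ 2.
  by apply/funext => k; rewrite (defectE tr (xsa k) (phi_cheb k) p_gt0 (oc k)).
have cX (u : nat -> R) (l : R) n : u k @[k --> \oo] --> l ->
    u k ^+ n @[k --> \oo] --> l ^+ n.
  by move=> ul; exact: (cvg_comp _ _ ul (@exprn_continuous R n l)).
apply: cvgB; [apply: cvgB; [apply: cvgD; [apply: cvgB|]|]|]; try exact: cX.
by apply: cvgM => //; exact: cvg_cst.
Qed.

Lemma excess_ge0 : 0 <= excess.
Proof.
rewrite -(cvg_lim _ defect_cvg)//; apply: limr_ge.
  by apply/cvg_ex; exists excess; exact: defect_cvg.
by near=> k; exact: defect_ge0.
Unshelve. all: by end_near. Qed.

(** The error of the recursion for [T k] also contains the discrepancy of its variance from lambda,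
    which tends to 0, so only the square root of the limiting defect survives. *)
Lemma moment_le_excess m : normc (phi (X ^+ m) - (jacobi_moment lambda m 0)%:C) <=
  jacobi_bound lambda K (Num.sqrt lambda + 1) m 0 * (q.+2%:R * Num.sqrt excess).
Proof.
set J := jacobi_bound _ _ _ _ _.
pose eta k := q.+2%:R * Num.sqrt (defect p (c k)) + normc (phi (T k * T k) - lambda%:C).
have eta_cvg : eta k @[k --> \oo] --> q.+2%:R * Num.sqrt excess.
  rewrite -[X in _ --> X]addr0; apply: cvgD => //; apply: cvgM; first exact: cvg_cst.
  by apply: continuous_cvg; [exact: sqrt_continuous|exact: defect_cvg].
have step : \forall k \near \oo, normc (phi (X ^+ m) - (jacobi_moment lambda m 0)%:C) <=
    normc (phi (T k ^+ m) - phi (X ^+ m)) + J * eta k.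
  near=> k.
  have Tk : forall y, nrm (T k * y) <= K * nrm y by near: k; exact: T_le.
  have ck : hnorm q (c k) <= Num.sqrt lambda + 1.
    by rewrite -nrmX; near: k; exact: hnorm_near_le.
  have e0 : 0 <= eta k by rewrite addr_ge0 ?mulr_ge0 ?sqrtr_ge0 ?normc_ge0.
  have := jacobi_approx tr (ltW lambda_gt0) K_ge0 (M := Num.sqrt lambda + 1) (eta := eta k)
    (chaos_power0 (x k) p (c k)) (chaos_power1 _ _ _)
    (phi_chaos_power tr (xsa k) (phi_cheb k) (c k) p_gt0) Tk.
  move=> h; rewrite -normcNE opprB.
  have -> : (jacobi_moment lambda m 0)%:C - phi (X ^+ m) = (phi (T k ^+ m) - phi (X ^+ m)) -
     (phi (T k ^+ m) - (jacobi_moment lambda m 0)%:C) by ring.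
  apply: le_trans (normcB _ _) _; rewrite lerD2l; apply: h => n.
  apply: le_trans (chaos_power_step tr (xsa k) (phi_cheb k) p_gt0 (oc k) _ _) _.
  by rewrite ler_wpM2l// lerXn2r ?nnegrE ?hnorm_ge0.
have lim : normc (phi (T k ^+ m) - phi (X ^+ m)) + J * eta k @[k --> \oo] -->
    0 + J * (q.+2%:R * Num.sqrt excess).
  apply: cvgD; last by apply: cvgM => //; exact: cvg_cst.
  exact: (phi_pow_cvg tr chaos_cvg T_le K_ge0).
rewrite -[X in _ <= X]add0r; apply: ler_cvg_to (cvg_cst _) lim step.
Unshelve. all: by end_near. Qed.

End chaos_limit.

Lemma step_grid_exists (R : realType) q (s : seq (R[i] * q.-tuple (R * R))) :
  (forall p, p \in s -> off_diagonal_box p.2) ->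
  exists E : seq R, [/\ sorted <%R E, (forall a, a \in E -> 0 <= a) &
    forall p, p \in s -> all (fun ab => (ab.1 \in E) && (ab.2 \in E)) p.2].
Proof.
move=> s_box; pose F := [seq ab | p <- s, ab <- tval p.2].
have FE ab : ab \in F -> 0 <= ab.1 < ab.2.
  by move=> /allpairsPdep[p [ab' [ps /tnthP[i ->] ->]]]; have [] := s_box _ ps.
pose E := sort <=%R (undup (map fst F ++ map snd F)).
have mE a : (a \in E) = (a \in map fst F ++ map snd F) by rewrite mem_sort mem_undup.
exists E; split => [|a|p ps].
- by rewrite lt_sorted_uniq_le sort_uniq undup_uniq sort_sorted//; exact: le_total.
- rewrite mE mem_cat => /orP[] /mapP[ab /FE/andP[a0 ab12] ->] //.
  exact: le_trans a0 (ltW ab12).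
apply/allP => ab abp; rewrite !mE !mem_cat.
have abF : ab \in F by apply/allpairsPdep; exists p, ab.
by rewrite (map_f fst abF) (map_f snd abF) orbT.
Qed.

(** * Approximation of a Wigner integral on grids *)

Section wigner_approximation.
Variables (R : realType) (P : tracial_wstar_space R) (S : free_brownian_motion P).
Variables (q : nat) (f : q.-tuple (measurableTypeR R) -> R[i]) (X : operator P).
Local Notation nrm := (nrm (@wstar_star R P) (@wstar_phi R P)).
Local Notation tr := (wstar_tracial_state P).

Definition grid_chaos (E : seq R) (s : seq (R[i] * q.-tuple (R * R))) : wstar P :=
  hom (increment S (N := (size E).-1) (nth 0 E)) q (step_coef (E := E) s).

Lemma wigner_approx : is_wigner_integral S f X -> l2_orthant f ->
  exists (E : nat -> seq R) (s : nat -> seq (R[i] * q.-tuple (R * R))),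
  [/\ (forall k, sorted <%R (E k)) /\ (forall k a, a \in E k -> 0 <= a),
      forall k, off_diagonal q (step_coef (E := E k) (s k)),
      nrm (grid_chaos (E k) (s k) - wstar_of X) @[k --> \oo] --> (0 : R) &
      (((nrm (wstar_of X)) ^+ 2)%:E <= l2normsq f)%E].
Proof.
move=> [AX [s [s_box cvg_l2 cvg_phi]]] [mR mI f_fin].
have /choice[E hE] k := step_grid_exists (s_box k).
have E_sorted k : sorted <%R (E k) by have [] := hE k.
have E_ge0 k : forall a, a \in E k -> 0 <= a by have [] := hE k.
have s_grid k : forall p, p \in s k -> all (fun ab => (ab.1 \in E k) && (ab.2 \in E k)) p.2.
  by have [] := hE k.
have chaosE k : grid_chaos (E k) (s k) = step_integral S (s k) :> operator P.
  exact: step_integral_hom (s_box k) (s_grid k).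
have chaos_cvg : nrm (grid_chaos (E k) (s k) - wstar_of X) @[k --> \oo] --> (0 : R).
  apply: cvg_sqr0 => [k|]; first exact: nrm_ge0.
  have e k : wstar_state P (adjoint (X - step_integral S (s k)) \o (X - step_integral S (s k))) =
      (nrm (grid_chaos (E k) (s k) - wstar_of X) ^+ 2)%:C.
    rewrite -[grid_chaos _ _ - _]opprB (nrmN tr) -(phi_sqr tr) /wstar_phi.
    have -> : X - step_integral S (s k) = (wstar_of X - grid_chaos (E k) (s k) : wstar P).
      rewrite -[in RHS](scaleN1r (grid_chaos _ _)) wstar_valD wstar_valZ scaleN1r.
      by rewrite wstar_ofK// chaosE.
    by [].
  apply/cvgrPdist_le => d d0; move/cvgrPdist_le : cvg_phi => /(_ d%:C).
  rewrite ltcR => /(_ d0); apply: filterS => k.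
  by rewrite e !sub0r !normrN normcE normc_real lecR.
exists E, s; split => [//|k|//|].
  exact: (step_coef_off_diagonal (E_sorted k) (s_box k) (s_grid k)).
have nrmE k : nrm (grid_chaos (E k) (s k)) = hnorm q (step_coef (E := E k) (s k)).
  apply: (nrm_hom tr); first exact: (star_increment S (grid_ge0 (E_ge0 k)) (grid_lt (E_sorted k))).
  exact: (phi_cheb_increment S (grid_ge0 (E_ge0 k)) (grid_lt (E_sorted k))).
have nrm_cvg : nrm (grid_chaos (E k) (s k)) @[k --> \oo] --> nrm (wstar_of X).
  apply/cvgrPdist_le => d d0; move/cvgrPdist_le : chaos_cvg => /(_ d d0).
  apply: filterS => k; rewrite sub0r normrN ger0_norm ?nrm_ge0// => h.
  rewrite distrC ler_norml lerNl opprB !lerBlDr; apply/andP; split.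
    rewrite -{1}(subrKC (grid_chaos (E k) (s k)) (wstar_of X)).
    by rewrite (le_trans (nrmD tr _ _))// [leLHS]addrC lerD2r -(nrmN tr) opprB.
  rewrite -{1}(subrK (wstar_of X) (grid_chaos (E k) (s k))).
  by rewrite (le_trans (nrmD tr _ _))// lerD2r.
have hnorm_cvg : hnorm q (step_coef (E := E k) (s k)) ^+ 2 @[k --> \oo] -->
    nrm (wstar_of X) ^+ 2.
  under eq_fun do rewrite -nrmE.
  exact: (cvg_comp _ _ nrm_cvg (@exprn_continuous R 2 _)).
have f_finE : l2normsq f \is a fin_num by rewrite ge0_fin_numE// l2normsq_ge0.
rewrite -(fineK f_finE) lee_fin; set a := fine (l2normsq f).
have a0 : 0 <= a by rewrite fine_ge0// l2normsq_ge0.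
(* The tolerance d is halved: e makes e a at most d / 2, and b below makes (1 + 1/e) b equal to d /
   2. *)
apply/ler_addgt0Pr => d d0; pose e := d / 2 / (a + 1).
have a1 : 0 < a + 1 by rewrite ltr_wpDl.
have e0 : 0 < e by rewrite !divr_gt0.
have e1 : 0 < 1 + e^-1 by rewrite addr_gt0// invr_gt0.
pose b := d / 2 / (1 + e^-1); have b0 : 0 < b by rewrite !divr_gt0.
apply: ler_cvg_to hnorm_cvg (cvg_cst _) _.
move/fine_cvgP : cvg_l2 => [fin_l2 /cvgrPdist_le/(_ b b0)].
apply: filterS2 fin_l2 => k fin_k; rewrite sub0r normrN /= => le_k.
have := hnorm_step_coef_le (E_sorted k) (E_ge0 k) (s_grid k).
have le_pert := l2normsq_le_perturb e0 (conj mR mI) (cmeasurable_step (s k)).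
move/le_trans => /(_ _ le_pert).
rewrite -(fineK f_finE) -(fineK fin_k) -!EFinM -EFinD lee_fin => h.
apply: le_trans h _; rewrite -/a.
rewrite mulrDl mul1r -addrA lerD2l [d]splitr; apply: lerD.
  by rewrite /e mulrAC ler_pdivrMr// ler_wpM2l ?lerDl// ltW// divr_gt0.
by rewrite mulrC -ler_pdivlMr// (le_trans (ler_norm _) le_k).
Qed.

End wigner_approximation.

Section wigner_moments.
Variables (R : realType) (P : tracial_wstar_space R) (S : free_brownian_motion P).
Variables (q : nat) (f : q.-tuple (measurableTypeR R) -> R[i]) (X : operator P).
Variable lambda : R.
Hypotheses (q_ge2 : (2 <= q)%N) (q_even : ~~ odd q) (lambda_gt0 : 0 < lambda).
Hypotheses (X_wigner : is_wigner_integral S f X) (f_l2 : l2_orthant f).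
Hypotheses (phi_sqrX : wstar_state P (iter 2 X) = lambda%:C) (norm_f : l2normsq f = lambda%:E).
Local Notation phi := (@wstar_phi R P).
Local Notation st := (@wstar_star R P).
Local Notation tr := (wstar_tracial_state P).
Local Notation x := (wstar_of X).

Let phi_powX m : phi (x ^+ m) = wstar_state P (iter m X).
Proof. by rewrite /wstar_phi wstar_valX wstar_ofK//; have [] := X_wigner. Qed.

(** Expanding, |x - st x|^2 = 2 |x|^2 - 2 Re phi(x^2), and phi(x^2) = lambda is at least |x|^2 by
    hypothesis. *)
Lemma wigner_self_adjoint : nrm st phi x ^+ 2 <= lambda -> st x = x.
Proof.
move=> nrm_le; suff sqr_le : nrm st phi (x - st x) ^+ 2 <= 0.
  apply/esym/subr0_eq/(nrm_eq0 tr)/eqP.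
  by rewrite -sqrf_eq0 eq_le sqr_le sqr_ge0.
rewrite -lecR -(phi_sqr tr) (starB tr) (starK tr) mulrBl !mulrBr !(phiB tr).
rewrite (phi_trace tr x (st x)) (phi_sqr tr) -(starM tr) (phi_star tr) -expr2.
rewrite phi_powX phi_sqrX conjC_real_complex -!rcB lecR.
by move: nrm_le; lra.
Qed.

(** A bound for one kernel, not for a sequence: the constants depend only on q, lambda and m, so the
    square root of D controls each moment along any sequence. *)
Lemma wigner_moment_le (D := complex.Re (wstar_state P (iter 4 X) - 2 * wstar_state P (iter 3 X))
    - (2 * lambda ^+ 2 - lambda)) :
  0 <= D /\ forall m, normc (wstar_state P (iter m X) - (jacobi_moment lambda m 0)%:C) <=
    jacobi_bound lambda (q.+1%:R * (Num.sqrt lambda + 1)) (Num.sqrt lambda + 1) m 0 *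
    (q.+2%:R * Num.sqrt D).
Proof.
have [E [s [[E_sorted E_ge0] oc chaos_cvg nrm_le]]] := wigner_approx X_wigner f_l2.
rewrite norm_f lee_fin in nrm_le.
have qE : (q./2 + q./2)%N = q by rewrite addnn -[RHS]odd_double_half (negPf q_even).
have p_gt0 : (0 < q./2)%N by rewrite half_gt0.
have x_sa := wigner_self_adjoint nrm_le.
have xsa k := star_increment S (grid_ge0 (E_ge0 k)) (grid_lt (E_sorted k)).
have phi_cheb k := phi_cheb_increment S (grid_ge0 (E_ge0 k)) (grid_lt (E_sorted k)).
have sqr_x : phi (x ^+ 2) = lambda%:C by rewrite phi_powX.
rewrite /D -!phi_powX -/(excess phi x lambda).
have chaos_cvg' : nrm st phi (hom (increment S (N := (size (E k)).-1) (nth 0 (E k)))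
    (q./2 + q./2) (step_coef (E := E k) (s k)) - x) @[k --> \oo] --> (0 : R).
  by rewrite qE.
have oc' k : off_diagonal (q./2 + q./2) (step_coef (E := E k) (s k)) by rewrite qE.
split; first exact: (excess_ge0 tr xsa phi_cheb p_gt0 oc' chaos_cvg' x_sa lambda_gt0 sqr_x).
move=> m; rewrite -phi_powX.
have := moment_le_excess tr xsa phi_cheb p_gt0 oc' chaos_cvg' x_sa lambda_gt0 sqr_x m.
by rewrite qE.
Qed.

End wigner_moments.

Lemma jacobi_moments (R : comPzRingType) (lambda : R) :
  [/\ jacobi_moment lambda 2 0 = lambda, jacobi_moment lambda 3 0 = lambda &
      jacobi_moment lambda 4 0 = 2 * lambda ^+ 2 + lambda].
Proof. by split; rewrite /= ; ring. Qed.

Theorem theorem1p4 (R : realType) (P : tracial_wstar_space R)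
    (S : free_brownian_motion P) (q : nat) (lambda : R)
    (f : nat -> q.-tuple (measurableTypeR R) -> R[i])
    (X := fun n : nat => wigner_integral S (f n))
    (Z := centered_free_poisson lambda) :
  (2 <= q)%N -> ~~ odd q -> 0 < lambda ->
  (forall n, l2_orthant (f n)) ->
  (forall n, mirror_symmetric (f n)) ->
  (forall n, wstar_state P (iter 2 (X n)) = lambda%:C) ->
  (forall n, l2normsq (f n) = lambda%:E) ->
  [/\ moment Z 2 = lambda,
      moment Z 4 - 2 * moment Z 3 = 2 * lambda ^+ 2 - lambda &
      cvg_in_distribution X Z <->
      ((wstar_state P (iter 4 (X n)) - 2 * wstar_state P (iter 3 (X n))
         : (R[i])^o) @[n --> \oo] -->
       ((moment Z 4 - 2 * moment Z 3)%:C : (R[i])^o))].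
Proof.
move=> q2 q_even lambda_gt0 f_l2 _ phi_sqrX norm_f.
have momentZ m : moment Z m = jacobi_moment lambda m 0.
  exact: moment_centered_free_poisson.
have [j2 j3 j4] := jacobi_moments lambda.
have Z43 : moment Z 4 - 2 * moment Z 3 = 2 * lambda ^+ 2 - lambda.
  by rewrite !momentZ j3 j4; ring.
split=> [||]; [by rewrite momentZ|exact: Z43|].
(* Without a Wigner integral [xget] would return its default 0, whose second moment is 0 instead of
   lambda > 0. *)
have X_wigner n : is_wigner_integral S (f n) (X n).
  rewrite /X /wigner_integral; case: xgetP => [_ _ //|no].
  exfalso; have := phi_sqrX n; rewrite /X /wigner_integral xgetPN//.
  have <- : (0 ^+ 2 : wstar P) = iter 2 0 :> operator P by rewrite wstar_valX.
  rewrite expr2 mul0r -[wstar_state _ _]/(wstar_phi _).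
  rewrite (phi0 (wstar_tracial_state P)) => /esym/eqP.
  by rewrite rc_eq0 gt_eqF.
pose s m n := wstar_state P (iter m (X n)).
pose D n := complex.Re (s 4 n - 2 * s 3 n) - (2 * lambda ^+ 2 - lambda).
have D_ge0 n : 0 <= D n.
  exact: (wigner_moment_le q2 q_even lambda_gt0 (X_wigner n) (f_l2 n) (phi_sqrX n) (norm_f n)).1.
have s_le n := (wigner_moment_le q2 q_even lambda_gt0
  (X_wigner n) (f_l2 n) (phi_sqrX n) (norm_f n)).2.
split=> [cvg_moments|cvg_excess m m_gt0].
  rewrite rcB rcM rc_nat; apply: cvgB; first exact: cvg_moments.
  by apply: cvgM; [exact: cvg_cst|exact: cvg_moments].
have D_cvg : D n @[n --> \oo] --> (0 : R).
  apply/cvgrPdist_le => e e0; move/cvgrPdist_le : cvg_excess => /(_ e%:C).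
  rewrite ltcR => /(_ e0); apply: filterS => n; rewrite normcE lecR; apply: le_trans.
  rewrite sub0r normrN ger0_norm// -/(s 4 n) -/(s 3 n) -normcNE opprB.
  by apply: le_trans (Re_le_normc _); rewrite ReD ReN Z43.
have bound_cvg : jacobi_bound lambda (q.+1%:R * (Num.sqrt lambda + 1)) (Num.sqrt lambda + 1) m 0 *
    (q.+2%:R * Num.sqrt (D n)) @[n --> \oo] --> (0 : R).
  rewrite -[X in _ --> X](mulr0 (jacobi_bound lambda (q.+1%:R * (Num.sqrt lambda + 1))
    (Num.sqrt lambda + 1) m 0)) -(mulr0 q.+2%:R).
  apply: cvgM; first exact: cvg_cst.
  apply: cvgM; first exact: cvg_cst.
  rewrite -[X in _ --> X]sqrtr0.
  by apply: continuous_cvg => //; exact: sqrt_continuous.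
(* In [R[i]] a positive e is real, so the complex estimate reduces to the real bound. *)
apply/cvgrPdist_le => e e0; have eE := ge0_complexE (ltW e0).
move/cvgrPdist_le : bound_cvg => /(_ (complex.Re e)).
rewrite -ltcR -eE => /(_ e0); apply: filterS => n; rewrite sub0r normrN => h.
rewrite normcE eE lecR -normcNE opprB momentZ.
by apply: le_trans (s_le n m) _; apply: le_trans (ler_norm _) h.
Qed.
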